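(* Let $m,n$ be non-negative integers. The following identities hold in a neighborhood of $z=0$. Here $a,b,c$ can be any complex numbers, if only the involved lower parameters $c$, $2-c$, $a+b+\frac12$ (those among them that occur in the identity in question) are not zero or negative integers. (1) $${}_2F_1\!\left(\left.{a,\,b\atop c}\right|z\right)\,{}_2F_1\!\left(\left.{1+a-c,\,1+b-c\atop 2-c}\right|z\right)=(1-z)^{c-a-b-\frac12}\,F^{1:2;2}_{2:0;0}\!\left(\left. {\frac12;\; a-b+\frac12,\,a+b-c+\frac12;\; b-a+\frac12,\, c-a-b+\frac12 \atop c;\;2-c} \right| z,\,\frac{z}{z-1}\right).$$ (2) $${}_2F_1\!\left(\left.{a,\;b\atop a+b+n+\frac12}\right|z\right)^2=\frac{(\frac12)_n\,(a+b+\frac12)_n}{(a+\frac12)_n\,(b+\frac12)_n}\,F^{2:1;1}_{1:1;1}\!\left(\left. {2a;\,2b;\;a+b+n,\,-n \atop a+b+\frac12;\, 2a+2b+2n,\, -2n} \right| z,\,1-z\right).$$ Here the $F^{2:1;1}_{1:1;1}$ series is understood to terminate in the second argument at the power $(1-z)^n$ (i.e. the second summation index runs over $0\le j\le n$), but it is not regarded as terminating in the first argument through the parameter $a+b+n$, even if $a+b+n$ is a non-positive integer $-m$; in that case the term-wise limit $b\to -a-n-m$ is to be applied. (3) $$\frac{\left(a+\frac12\right)_n\left(a+m+\frac12\right)_n}{\left(\frac12\right)_n\left(m+\frac12\right)_n}\,{}_2F_1\!\left(\left.{a,\;-a-m-n\atop \frac12-m}\right|z\right)^2+\frac{\left(a+\frac12\right)_{m}\left(a+n+\frac12\right)_m\,(a)_{m+n+1}^2}{\left(\frac12\right)_m\left(\frac12\right)_{m+1}^2\left(\frac12\right)_n\left(\frac12\right)_{m+n}}\,z^{2m+1}\,{}_2F_1\!\left(\left.{a+m+\frac12,\,\frac12-a-n\atop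 m+\frac32}\right|z\right)^2$$ $$=F^{2:1;1}_{1:1;1}\!\left(\left. {2a;\,-2a-2m-2n;\;-m,\,-n \atop \frac12-m-n;\, -2m,\, -2n} \right| z,\,1-z\right),$$ where the $F^{2:1;1}_{1:1;1}$ series is the finite rectangular sum with $(m+1)(n+1)$ terms (summation indices $0\le i\le m$, $0\le j\le n$).
   Context: $(\alpha)_k=\alpha(\alpha+1)\cdots(\alpha+k-1)$ is the Pochhammer symbol, $(\alpha)_0=1$, and ${}_2F_1\!\left(\left.{\alpha,\beta\atop\gamma}\right|z\right)=\sum_{k\ge0}\frac{(\alpha)_k(\beta)_k}{(\gamma)_k\,k!}z^k$ is the Gauss hypergeometric series. The double hypergeometric series are $$F^{2:1;1}_{1:1;1}\!\left(\left. {a; b; p_1, p_2\atop c; q_1, q_2} \right| x,y\right)=\sum_{i=0}^{\infty}\sum_{j=0}^{\infty}\frac{(a)_{i+j}(b)_{i+j}(p_1)_i(p_2)_j}{(c)_{i+j}(q_1)_i(q_2)_j\,i!\,j!}x^iy^j,$$ $$F^{1:2;2}_{2:0;0}\!\left(\left. {a; p_1, p_2; q_1, q_2 \atop b;\; c} \right| x,y\right)=\sum_{i=0}^{\infty}\sum_{j=0}^{\infty}\frac{(a)_{i+j}(p_1)_i(p_2)_j(q_1)_i(q_2)_j}{(b)_{i+j}(c)_{i+j}\,i!\,j!}x^iy^j$$ (the parameters $a,b,c$ in these two definitions are generic placeholders). The power $(1-z)^{\beta}$ near $z=0$ denotes the branch equal to $1$ at $z=0$.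
   Formalization: In (2) the fraction is undefined when (a+1/2)_n (b+1/2)_n = 0 (e.g. n=1, a=-1/2, b=1); the displayed identity is stated when this product is nonzero, and the identity with this denominator cleared is stated for all admissible a, b. *)

(* Defs.v *)
From Stdlib Require Import Reals Factorial.
From Coquelicot Require Import Coquelicot.

Open Scope R_scope.
Open Scope C_scope.

Definition nonpos_int (c : C) : Prop := exists k : nat, c = - INR k.

Fixpoint poch (a : C) (k : nat) : C :=
  match k with
  | O => 1
  | S k => poch a k * (a + INR k)
  end.

Definition is_2F1 (a b c z s : C) : Prop :=
  is_series
    (fun k => poch a k * poch b k / (poch c k * INR (fact k)) * z ^ k) s.

(* General terms of the two double series, with the parameters in the order
   F^{2:1;1}_{1:1;1}(a; b; p1, p2 / c; q1, q2 | x, y) and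
   F^{1:2;2}_{2:0;0}(a; p1, p2; q1, q2 / b; c | x, y) *)
Definition F211_term (a b p1 p2 c q1 q2 x y : C) (i j : nat) : C :=
  poch a (i + j) * poch b (i + j) * poch p1 i * poch p2 j
  / (poch c (i + j) * poch q1 i * poch q2 j * INR (fact i) * INR (fact j))
  * x ^ i * y ^ j.

Definition F122_term (a p1 p2 q1 q2 b c x y : C) (i j : nat) : C :=
  poch a (i + j) * poch p1 i * poch p2 j * poch q1 i * poch q2 j
  / (poch b (i + j) * poch c (i + j) * INR (fact i) * INR (fact j))
  * x ^ i * y ^ j.

Definition is_F122 (a p1 p2 q1 q2 b c x y s : C) : Prop :=
  exists v : nat -> C,
    (forall i, is_series (F122_term a p1 p2 q1 q2 b c x y i) (v i))
    /\ is_series v s.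

Definition F211_rect (m n : nat) (a b p1 p2 c q1 q2 x y : C) : C :=
  sum_n (fun i => sum_n (F211_term a b p1 p2 c q1 q2 x y i) n) m.

Definition clausen_term (a b : C) (n : nat) (z : C) (i j : nat) : C :=
  F211_term (2 * a) (2 * b) (a + b + INR n) (- INR n)
    (a + b + 1 / 2) (2 * a + 2 * b + 2 * INR n) (- (2 * INR n)) z (1 - z) i j.

(* When a + b + n = - m, the quotient (a+b+n)_i / (2a+2b+2n)_i is 0/0 for
   i > 2m; each term then stands for its limit as b' -> b. *)
Definition is_clausen_term
    (a b : C) (n : nat) (z : C) (i j : nat) (t : C) : Prop :=
  (~ nonpos_int (a + b + INR n) -> t = clausen_term a b n z i j)
  /\ (nonpos_int (a + b + INR n) ->
      filterlim (fun b' => clausen_term a b' n z i j) (locally' b) (locally t)).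

(* The first index runs over all of nat, the second over 0 <= j <= n. *)
Definition is_clausen_F211 (a b : C) (n : nat) (z s : C) : Prop :=
  exists t : nat -> nat -> C,
    (forall i j, (j <= n)%nat -> is_clausen_term a b n z i j (t i j))
    /\ is_series (fun i => sum_n (t i) n) s.

Definition Cexp (w : C) : C :=
  ((exp (Re w) * cos (Im w))%R, (exp (Re w) * sin (Im w))%R).

(* The principal logarithm on the half-plane 0 < Re w (elsewhere a junk value);
   this half-plane contains 1 - z for every z with Cmod z < 1. *)
Definition Clog (w : C) : C := (ln (Cmod w), atan (Im w / Re w)%R).

Definition Cpower (w beta : C) : C := Cexp (beta * Clog w).

(* Main.v *)
Require Import Defs.
From Stdlib Require Import Reals Factorial Lia Lra FunctionalExtensionality.
From Coquelicot Require Import Coquelicot.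

(* Products of two solutions of the hypergeometric equation are annihilated by the
   symmetric square of the hypergeometric operator, a third-order operator whose
   power series solutions obey a three-term recurrence.  Each double series is
   annihilated by the same operator: applied to its general term, the operator gives
   a double telescoping difference.  The recurrence then determines both sides from
   their constant terms, which for identity (2) agree by Watson's terminating
   3F2(1) sum.  In (2) the recurrence degenerates when a + b + n is a non-positive
   integer; there the coefficients are compared by continuity in b.  Identity (3) is
   this degenerate case with a + b + n = -m: the terms with i <= m form the finite
   sum, those with m < i <= 2m vanish, and those with i > 2m add up, by (2) again,
   to a multiple of the square of the second solution. *)

Open Scope R_scope.
Open Scope C_scope.


(** Neither the prefactor $(1-z)^{c-a-b-1/2}$ in (1) nor the argument $1-z$ in (2) is compatible
    with a double expansion in powers of $z$ alone. With the prefactor absorbed, however, the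
    general terms are constants times $X^p(1-X)^q$, where $p=i+j$, $q=c-a-b-\frac12-j$ in (1) and
    $p=i$, $q=j$ in (2). These products are the atoms of the formal computation: the Euler operator
    sends each to a combination of itself and one neighbour, so that a telescoping certificate
    becomes a finite linear identity with polynomial coefficients. In (1) the second factor solves
    the hypergeometric equation only after multiplication by $X^{1-c}$, hence the shift [s] carried
    by the operators. In (2) the leading coefficient of the recurrence contains $k+2(a+b+n)$, the
    source of the degeneration; the identity is kept multiplied out because
    $(a+\frac12)_n(b+\frac12)_n$ may vanish. On the analytic side, a disc is chosen so small that
    the series are dominated by geometric ones of ratio below $1/2$; there, double series may be
    summed by rows or by diagonals. For (1) the formal $(1-X)^q$ must also be shown to sum to the
    prescribed branch of $(1-z)^q$. *)

Lemma C_INR_S k : RtoC (INR (S k)) = INR k + 1.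
Proof. now rewrite S_INR, RtoC_plus. Qed.

Lemma C_INR_plus i j : RtoC (INR (i + j)) = INR i + INR j.
Proof. now rewrite plus_INR, RtoC_plus. Qed.

Lemma C_INR_fact_neq0 k : RtoC (INR (fact k)) <> 0.
Proof. intros H. apply RtoC_inj in H. exact (INR_fact_neq_0 k H). Qed.

Lemma C_INR_fact_S k : RtoC (INR (fact (S k))) = (INR k + 1) * INR (fact k).
Proof. now rewrite fact_simpl, mult_INR, RtoC_mult, C_INR_S. Qed.

Lemma C_INR_S_neq0 k : RtoC (INR k) + 1 <> 0.
Proof.
  rewrite <- C_INR_S. intros H. apply RtoC_inj in H. now apply (not_0_INR (S k)).
Qed.

Lemma Cmult_integral (x y : C) : x * y = 0 -> x = 0 \/ y = 0.
Proof.
  intros H. destruct (Ceq_dec x 0) as [|Hx]; [now left|].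
  destruct (Ceq_dec y 0) as [|Hy]; [now right|].
  now destruct (Cmult_neq_0 x y Hx Hy).
Qed.

(** * Finite sums *)

Fixpoint Csum (f : nat -> C) (n : nat) : C :=
  match n with
  | O => 0
  | S n => Csum f n + f n
  end.

Lemma sum_n_Csum (f : nat -> C) n : sum_n f n = Csum f (S n).
Proof.
  induction n as [|n IH].
  - rewrite sum_O. simpl. ring.
  - rewrite sum_Sn, IH. reflexivity.
Qed.

Lemma Csum_ext_lt (f g : nat -> C) n : (forall i, (i < n)%nat -> f i = g i) -> Csum f n = Csum g n.
Proof.
  intros H. induction n as [|n IH]; simpl; trivial.
  rewrite IH, H; auto with arith.
Qed.

Lemma Csum_ext (f g : nat -> C) n : (forall i, f i = g i) -> Csum f n = Csum g n.
Proof. intros H. apply Csum_ext_lt. auto. Qed.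

Lemma Csum_0 (f : nat -> C) n : (forall i, (i < n)%nat -> f i = 0) -> Csum f n = 0.
Proof.
  intros H. induction n as [|n IH]; simpl; trivial.
  rewrite IH, H; auto with arith; ring.
Qed.

Lemma Csum_plus f g n : Csum (fun i => f i + g i) n = Csum f n + Csum g n.
Proof. induction n as [|n IH]; simpl; [|rewrite IH]; ring. Qed.

Lemma Csum_scal c f n : Csum (fun i => c * f i) n = c * Csum f n.
Proof. induction n as [|n IH]; simpl; [|rewrite IH]; ring. Qed.

Lemma Csum_scal_r c f n : Csum (fun i => f i * c) n = Csum f n * c.
Proof. induction n as [|n IH]; simpl; [|rewrite IH]; ring. Qed.

Lemma Csum_opp f n : Csum (fun i => - f i) n = - Csum f n.
Proof. induction n as [|n IH]; simpl; [|rewrite IH]; ring. Qed.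

Lemma Csum_S_l f n : Csum f (S n) = f O + Csum (fun i => f (S i)) n.
Proof.
  induction n as [|n IH]; [simpl; ring|].
  change (Csum f (S n) + f (S n) = f O + (Csum (fun i => f (S i)) n + f (S n))).
  rewrite IH. ring.
Qed.

Lemma Csum_add f n p : Csum f (n + p) = Csum f n + Csum (fun i => f (n + i)%nat) p.
Proof.
  induction p as [|p IH]; simpl.
  - rewrite Nat.add_0_r. ring.
  - rewrite Nat.add_succ_r. simpl. rewrite IH. ring.
Qed.

Lemma Csum_rev f n : Csum f n = Csum (fun i => f (n - S i)%nat) n.
Proof.
  induction n as [|n IH]; trivial.
  rewrite (Csum_S_l (fun i => f (S n - S i)%nat)). simpl.
  rewrite IH, Nat.sub_0_r. rewrite Cplus_comm. reflexivity.
Qed.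

Lemma Csum_telescope f n : Csum (fun i => f (S i) - f i) n = f n - f O.
Proof. induction n as [|n IH]; simpl; [|rewrite IH]; ring. Qed.

Lemma Csum_swap (f : nat -> nat -> C) n p :
  Csum (fun i => Csum (f i) p) n = Csum (fun j => Csum (fun i => f i j) n) p.
Proof.
  induction n as [|n IH]; simpl.
  - symmetry. now apply Csum_0.
  - now rewrite IH, <- Csum_plus.
Qed.

(** The triangle $i+j<n$ is traversed by diagonals on the left and by rows on the right. This
    reindexing gives associativity of the Cauchy product and, later, the comparison of diagonal and
    iterated sums. *)
Lemma Csum_triangle (f : nat -> nat -> C) n :
  Csum (fun k => Csum (fun i => f i (k - i)%nat) (S k)) n
  = Csum (fun i => Csum (f i) (n - i)) n.
Proof.
  induction n as [|n IH]; trivial.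
  change (Csum (fun k => Csum (fun i => f i (k - i)%nat) (S k)) n
          + Csum (fun i => f i (n - i)%nat) (S n)
          = Csum (fun i => Csum (f i) (S n - i)) n + Csum (f n) (S n - n)).
  rewrite IH. change (Csum (fun i => f i (n - i)%nat) (S n))
    with (Csum (fun i => f i (n - i)%nat) n + f n (n - n)%nat).
  rewrite Cplus_assoc, <- Csum_plus. f_equal.
  - apply Csum_ext_lt. intros i Hi. now replace (S n - i)%nat with (S (n - i)) by lia.
  - replace (S n - n)%nat with 1%nat by lia. rewrite Nat.sub_diag. simpl. ring.
Qed.

(** * Formal power series *)

(** Series are compared by Leibniz equality, through functional extensionality, so that [ring]
    applies to whole series and operator identities need no coefficients. *)
Definition fps := nat -> C.

Definition fps_cst (c : C) : fps := fun k => match k with O => c | S _ => 0 end.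
Definition fps_X : fps := fun k => match k with S O => 1 | _ => 0 end.
Definition fps_add (f g : fps) : fps := fun k => f k + g k.
Definition fps_opp (f : fps) : fps := fun k => - f k.
Definition fps_sub (f g : fps) : fps := fun k => f k - g k.
Definition fps_mul (f g : fps) : fps :=
  fun k => Csum (fun i => f i * g (k - i)%nat) (S k).
(** The Euler operator $\theta=X\,d/dX$. *)
Definition fps_theta (f : fps) : fps := fun k => INR k * f k.
Definition fps_shift (f : fps) : fps := fun k => match k with O => 0 | S k => f k end.

Lemma fps_mul_comm f g : fps_mul f g = fps_mul g f.
Proof.
  extensionality k. unfold fps_mul. rewrite Csum_rev.
  apply Csum_ext_lt. intros i Hi.
  replace (S k - S i)%nat with (k - i)%nat by lia.
  replace (k - (k - i))%nat with i by lia. ring.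
Qed.

Lemma fps_mul_assoc f g h : fps_mul f (fps_mul g h) = fps_mul (fps_mul f g) h.
Proof.
  extensionality k. unfold fps_mul.
  rewrite (Csum_ext_lt (fun i => Csum (fun j => f j * g (i - j)%nat) (S i) * h (k - i)%nat)
    (fun i => Csum (fun j => (fun j l => f j * g l * h (k - (j + l))%nat) j (i - j)%nat) (S i))).
  - rewrite (Csum_triangle (fun j l => f j * g l * h (k - (j + l))%nat)). apply Csum_ext_lt. intros i Hi.
    rewrite <- Csum_scal. replace (S k - i)%nat with (S (k - i)) by lia.
    apply Csum_ext. intros j. rewrite Nat.sub_add_distr. ring.
  - intros i Hi. rewrite <- Csum_scal_r. apply Csum_ext_lt. intros j Hj.
    replace (j + (i - j))%nat with i by lia. reflexivity.
Qed.

Lemma fps_cst_mul c f : fps_mul (fps_cst c) f = fun k => c * f k.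
Proof.
  extensionality k. unfold fps_mul. rewrite Csum_S_l.
  rewrite (Csum_0 (fun i => fps_cst c (S i) * f (k - S i)%nat)).
  - simpl. rewrite Nat.sub_0_r. ring.
  - intros i _. simpl. ring.
Qed.

Lemma fps_X_mul f : fps_mul fps_X f = fps_shift f.
Proof.
  extensionality k. unfold fps_mul. rewrite Csum_S_l. destruct k as [|k].
  - simpl. ring.
  - rewrite Csum_S_l, (Csum_0 (fun i => fps_X (S (S i)) * f (S k - S (S i))%nat)).
    + simpl. rewrite Nat.sub_0_r. ring.
    + intros i _. simpl. ring.
Qed.

Lemma fps_ring_theory :
  ring_theory (fps_cst 0) (fps_cst 1) fps_add fps_mul fps_sub fps_opp eq.
Proof.
  split; intros; try apply fps_mul_comm; try apply fps_mul_assoc;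
    extensionality k; unfold fps_add, fps_sub, fps_opp; try ring.
  - destruct k; simpl; ring.
  - rewrite fps_cst_mul. ring.
  - unfold fps_mul. rewrite <- Csum_plus. apply Csum_ext. intros i. ring.
  - destruct k; simpl; ring.
Qed.

Add Ring fps_ring : fps_ring_theory.

(** Leibniz rule: in each term of the Cauchy product, $k=i+(k-i)$. *)
Lemma fps_theta_mul f g :
  fps_theta (fps_mul f g) = fps_add (fps_mul (fps_theta f) g) (fps_mul f (fps_theta g)).
Proof.
  extensionality k. unfold fps_theta, fps_mul, fps_add.
  rewrite <- Csum_scal, <- Csum_plus. apply Csum_ext_lt. intros i Hi.
  replace (RtoC (INR k)) with (INR i + INR (k - i)).
  - ring.
  - rewrite <- C_INR_plus. do 2 f_equal. lia.
Qed.

(** * The symmetric square of the hypergeometric equation *)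

Section SymmetricSquare.

Variables a b c : C.

(* The coefficients of [X^0], [X^1], [X^2] in the operator annihilating products
   of two solutions of [θ (θ + c - 1) y = X (θ + a) (θ + b) y]. *)
Definition sq0 (x : C) : C := x * (x + c - 1) * (x + 2 * c - 2).
Definition sq1 (x : C) : C :=
  - (2) * x ^ 3 - 3 * (a + b + c - 1) * x ^ 2
  - (4 * a * b + a + b + 1 - c + 4 * (c - 1) * (a + b)) * x
  - a * b * (4 * c - 2).
Definition sq2 (x : C) : C := (x + 2 * a) * (x + 2 * b) * (x + a + b).

(* The operator twisted by [X^s], so that it also applies to [X^(-s)] times a
   product of solutions. *)
Definition symsq (s : C) (f : fps) : fps := fun k =>
  sq0 (INR k + s) * f k
  + fps_shift (fun l => sq1 (INR l + s) * f l) k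
  + fps_shift (fps_shift (fun l => sq2 (INR l + s) * f l)) k.

(** The conjugate $X^{-s}\theta X^s=\theta+s$. *)
Definition theta_tw (s : C) (f : fps) : fps := fps_add (fps_theta f) (fps_mul (fps_cst s) f).

Lemma theta_tw_eq s f k : theta_tw s f k = (INR k + s) * f k.
Proof. unfold theta_tw, fps_add, fps_theta. rewrite fps_cst_mul. ring. Qed.

Lemma theta_tw_mul s f g :
  theta_tw s (fps_mul f g) = fps_add (fps_mul (fps_theta f) g) (fps_mul f (theta_tw s g)).
Proof. unfold theta_tw. rewrite fps_theta_mul. ring. Qed.

(** Coefficients of the hypergeometric equation for $X^sf$; the first conjunct is the indicial
    equation. *)
Definition hyp_eq (s : C) (f : fps) : Prop :=
  (s * (s + c - 1) * f O = 0)
  /\ forall k, (INR k + 1 + s) * (INR k + s + c) * f (S k)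
           = (INR k + s + a) * (INR k + s + b) * f k.

(** The equation solved for its second derivative: $(1-X)\theta^2y=(1-c+(a+b)X)\,\theta
    y+abX\,y$. *)
Lemma hyp_eq_fps s f : hyp_eq s f ->
  let f1 := theta_tw s f in
  let f2 := theta_tw s f1 in
  fps_sub (fps_mul (fps_sub (fps_cst 1) fps_X) f2)
    (fps_add (fps_mul (fps_add (fps_cst (1 - c)) (fps_mul fps_X (fps_cst (a + b)))) f1)
       (fps_mul fps_X (fps_mul (fps_cst (a * b)) f))) = fps_cst 0.
Proof.
  intros [H0 H] f1 f2.
  replace (fps_mul (fps_sub (fps_cst 1) fps_X) f2) with (fps_sub f2 (fps_mul fps_X f2)) by ring.
  replace (fps_mul (fps_add (fps_cst (1 - c)) (fps_mul fps_X (fps_cst (a + b)))) f1)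
    with (fps_add (fps_mul (fps_cst (1 - c)) f1) (fps_mul fps_X (fps_mul (fps_cst (a + b)) f1)))
    by ring.
  rewrite !fps_X_mul, !fps_cst_mul. extensionality k.
  unfold fps_sub, fps_add, f2, f1. destruct k as [|k]; cbn [fps_shift]; rewrite !theta_tw_eq.
  - simpl. transitivity (s * (s + c - 1) * f O); [ring|exact H0].
  - specialize (H k). rewrite C_INR_S. simpl fps_cst.
    transitivity ((INR k + 1 + s) * (INR k + s + c) * f (S k)
           - (INR k + s + a) * (INR k + s + b) * f k); [ring|rewrite H; ring].
Qed.

Lemma theta_tw_cst_mul s d f : theta_tw s (fps_mul (fps_cst d) f) = fps_mul (fps_cst d) (theta_tw s f).
Proof.
  extensionality k. rewrite theta_tw_eq, !fps_cst_mul, theta_tw_eq. ring.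
Qed.

Lemma theta_tw_X_mul s f :
  theta_tw s (fps_mul fps_X f) = fps_add (fps_mul fps_X f) (fps_mul fps_X (theta_tw s f)).
Proof.
  extensionality k. rewrite theta_tw_eq. unfold fps_add. rewrite !fps_X_mul.
  destruct k as [|k]; cbn [fps_shift]; rewrite ?theta_tw_eq, ?C_INR_S; ring.
Qed.

Lemma theta_tw_add s f g : theta_tw s (fps_add f g) = fps_add (theta_tw s f) (theta_tw s g).
Proof. extensionality k. unfold fps_add. rewrite !theta_tw_eq. ring. Qed.

(** One more application of the twisted Euler operator; the extra terms come from $\theta X=X$
    acting on the coefficients. *)
Lemma hyp_eq_fps_deriv s f : hyp_eq s f ->
  let f1 := theta_tw s f in
  let f2 := theta_tw s f1 in
  let f3 := theta_tw s f2 in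
  let p := fps_add (fps_cst (1 - c)) (fps_mul fps_X (fps_cst (a + b))) in
  let q := fps_mul fps_X (fps_cst (a * b)) in
  fps_sub (fps_mul (fps_sub (fps_cst 1) fps_X) f3)
    (fps_add (fps_mul (fps_add fps_X p) f2)
       (fps_add (fps_mul (fps_add (fps_mul fps_X (fps_cst (a + b))) q) f1)
          (fps_mul q f))) = fps_cst 0.
Proof.
  intros H f1 f2 f3 p q. generalize (hyp_eq_fps s f H). intros E. cbv zeta in E.
  fold f1 in E. fold f2 in E.
  assert (E' : f2 = fps_add (fps_mul fps_X f2)
     (fps_add (fps_mul (fps_cst (1 - c)) f1)
        (fps_add (fps_mul fps_X (fps_mul (fps_cst (a + b)) f1))
           (fps_mul fps_X (fps_mul (fps_cst (a * b)) f))))).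
  { transitivity (fps_add f2 (fps_opp (fps_cst 0))); [ring|]. rewrite <- E. ring. }
  apply (f_equal (theta_tw s)) in E'.
  rewrite !theta_tw_add, !theta_tw_X_mul, !theta_tw_cst_mul in E'.
  fold f1 in E'. fold f2 in E'. fold f3 in E'.
  transitivity (fps_sub f3 f3); [|ring]. rewrite E' at 3. unfold p, q. ring.
Qed.

Lemma theta_tw_0 f : theta_tw 0 f = fps_theta f.
Proof. extensionality k. rewrite theta_tw_eq. unfold fps_theta. ring. Qed.

(** For a derivation and $u''=Pu'+Qu$, products of two solutions satisfy
    $w'''=3Pw''+(P'+4Q-2P^2)w'+(2Q'-4PQ)w$. The right-hand side is this equation for $P=p/y$,
    $Q=abX/y$, multiplied by $y^2$ to clear denominators. *)
Lemma symsq_fps s f :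
  let f1 := theta_tw s f in
  let f2 := theta_tw s f1 in
  let f3 := theta_tw s f2 in
  let y := fps_sub (fps_cst 1) fps_X in
  let s0 := fps_cst (1 - c) in
  let s1 := fps_cst (a + b) in
  let ab := fps_cst (a * b) in
  let p := fps_add s0 (fps_mul fps_X s1) in
  let n2 := fps_add (fps_cst 1) (fps_cst 1) in
  let n3 := fps_add (fps_cst 1) n2 in
  let n4 := fps_add n2 n2 in
  symsq s f =
  fps_sub (fps_mul (fps_mul y y) f3)
    (fps_add (fps_mul n3 (fps_mul y (fps_mul p f2)))
    (fps_add (fps_mul (fps_sub (fps_add (fps_mul n4 (fps_mul ab (fps_mul fps_X y)))
                                  (fps_mul fps_X (fps_add s1 s0)))
                         (fps_mul n2 (fps_mul p p))) f1)
       (fps_mul (fps_sub (fps_mul n2 (fps_mul ab fps_X))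
                   (fps_mul n4 (fps_mul ab (fps_mul fps_X p)))) f))).
Proof.
  intros.
  (* Regrouping by powers of $X$ turns every multiplication by $X$ into an outermost shift, as in
     the definition of [symsq]. *)
  transitivity (fps_add (fps_add f3 (fps_mul (fps_opp n3) (fps_mul s0 f2)))
      (fps_add (fps_mul n2 (fps_mul s0 (fps_mul s0 f1)))
    (fps_add (fps_mul fps_X
      (fps_sub (fps_mul (fps_opp n2) f3)
        (fps_add (fps_mul n3 (fps_mul (fps_sub s1 s0) f2))
        (fps_add (fps_mul (fps_sub (fps_add (fps_mul n4 ab) (fps_add s1 s0)) (fps_mul n4 (fps_mul s0 s1))) f1)
           (fps_mul (fps_sub (fps_mul n2 ab) (fps_mul n4 (fps_mul ab s0))) f)))))
      (fps_mul fps_X (fps_mul fps_X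
        (fps_add f3 (fps_add (fps_mul n3 (fps_mul s1 f2))
         (fps_add (fps_mul (fps_add (fps_mul n4 ab) (fps_mul n2 (fps_mul s1 s1))) f1)
           (fps_mul n4 (fps_mul ab (fps_mul s1 f)))))))))));
    [|unfold p, y, n4, n3, n2; ring].
  assert (Ha : forall u v, fps_add (fps_cst u) (fps_cst v) = fps_cst (u + v)).
  { intros. extensionality k. destruct k; unfold fps_add; simpl; ring. }
  assert (Hs : forall u v, fps_sub (fps_cst u) (fps_cst v) = fps_cst (u - v)).
  { intros. extensionality k. destruct k; unfold fps_sub; simpl; ring. }
  assert (Ho : forall u, fps_opp (fps_cst u) = fps_cst (- u)).
  { intros. extensionality k. destruct k; unfold fps_opp; simpl; ring. }
  assert (Hm : forall u v, fps_mul (fps_cst u) (fps_cst v) = fps_cst (u * v)).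
  { intros. rewrite fps_cst_mul. extensionality k. destruct k; simpl; ring. }
  unfold n4, n3, n2, s0, s1, ab.
  rewrite ?Ha, ?Hs, ?Ho, ?Hm, ?Ha, ?Hs, ?Ho, ?Hm, ?Ha, ?Hs.
  rewrite !fps_X_mul, !fps_cst_mul. unfold fps_add, fps_sub.
  extensionality k. unfold symsq, f3, f2, f1, sq0, sq1, sq2.
  rewrite !theta_tw_eq.
  destruct k as [|[|k]]; cbn [fps_shift]; rewrite ?theta_tw_eq; ring.
Qed.

Lemma symsq_mul s f g : hyp_eq 0 f -> hyp_eq s g ->
  forall k, symsq s (fps_mul f g) k = 0.
Proof.
  intros Hf Hg.
  pose proof (hyp_eq_fps 0 f Hf) as F2. pose proof (hyp_eq_fps_deriv 0 f Hf) as F3.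
  pose proof (hyp_eq_fps s g Hg) as G2. pose proof (hyp_eq_fps_deriv s g Hg) as G3.
  cbv zeta in F2, F3, G2, G3. repeat rewrite theta_tw_0 in F2. repeat rewrite theta_tw_0 in F3.
  assert (E : symsq s (fps_mul f g) = fps_cst 0);
    [|intros k; rewrite E; now destruct k].
  rewrite symsq_fps. cbv zeta.
  rewrite !theta_tw_mul, !theta_tw_add, !theta_tw_mul, !theta_tw_add, !theta_tw_mul.
  set (f1 := fps_theta f) in *. set (f2 := fps_theta f1) in *. set (f3 := fps_theta f2) in *.
  set (g1 := theta_tw s g) in *. set (g2 := theta_tw s g1) in *. set (g3 := theta_tw s g2) in *.
  set (s0 := fps_cst (1 - c)) in *. set (s1 := fps_cst (a + b)) in *.
  set (ab := fps_cst (a * b)) in *.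
  set (y := fps_sub (fps_cst 1) fps_X) in *.
  set (p := fps_add s0 (fps_mul fps_X s1)) in *.
  match type of F2 with ?u = _ => set (e2 := u) in F2 end.
  match type of F3 with ?u = _ => set (e3 := u) in F3 end.
  match type of G2 with ?u = _ => set (d2 := u) in G2 end.
  match type of G3 with ?u = _ => set (d3 := u) in G3 end.
  pose (n2 := fps_add (fps_cst 1) (fps_cst 1)).
  pose (n3 := fps_add (fps_cst 1) n2).
  (* The multipliers follow from the Leibniz expansion: [e3] and [d3] remove the third derivatives,
     the multiples $3yg_1$ and $3yf_1$ remove the mixed products $f_2g_1$ and $f_1g_2$, and $X-2p$
     accounts for what is left of $f_2g$ and $fg_2$. *)
  transitivity (fps_add
     (fps_add (fps_mul (fps_mul y g) e3) (fps_mul (fps_mul y f) d3))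
     (fps_add
       (fps_mul (fps_add (fps_mul (fps_sub fps_X (fps_mul n2 p)) g) (fps_mul n3 (fps_mul y g1))) e2)
       (fps_mul (fps_add (fps_mul (fps_sub fps_X (fps_mul n2 p)) f) (fps_mul n3 (fps_mul y f1))) d2))).
  - unfold e2, e3, d2, d3, n3, n2, p, y. ring.
  - rewrite F2, F3, G2, G3. ring.
Qed.

Lemma symsq_unique s f g :
  (forall k, sq0 (INR (S k) + s) <> 0) ->
  (forall k, symsq s f k = 0) -> (forall k, symsq s g k = 0) ->
  f O = g O -> forall k, f k = g k.
Proof.
  intros H Hf Hg E0 k.
  (* The recurrence reaches two steps back, so two consecutive coefficients are carried along. *)
  assert (E : forall k, f k = g k /\ f (S k) = g (S k)); [|apply E].
  assert (Hstep : forall k l, fps_shift (fun l => sq1 (INR l + s) * f l) (S k)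
                 = fps_shift (fun l => sq1 (INR l + s) * g l) (S k) ->
            fps_shift (fps_shift (fun l => sq2 (INR l + s) * f l)) (S k)
                 = fps_shift (fps_shift (fun l => sq2 (INR l + s) * g l)) (S k) ->
            l = S k -> f l = g l).
  { intros j l E1 E2 ->. specialize (Hf (S j)). specialize (Hg (S j)).
    unfold symsq in Hf, Hg. rewrite <- Hg, E1, E2 in Hf.
    assert (Hm : sq0 (INR (S j) + s) * (f (S j) - g (S j)) = 0).
    { match type of Hf with ?u + ?v + ?w = ?u' + _ + _ =>
        transitivity ((u + v + w) - (u' + v + w)); [ring|rewrite Hf; ring] end. }
    apply Cmult_integral in Hm. destruct Hm as [Hm|Hm]; [now destruct (H j)|].
    transitivity (f (S j) - g (S j) + g (S j)); [ring|rewrite Hm; ring]. }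
  clear k. induction k as [|k [IH1 IH2]]; (split; [assumption|]).
  - apply (Hstep O); trivial. simpl. now rewrite E0.
  - apply (Hstep (S k)); trivial.
    + cbn [fps_shift]. now rewrite IH2.
    + cbn [fps_shift]. now rewrite IH1.
Qed.

End SymmetricSquare.


(** * The series [X^p (1 - X)^q] *)

Lemma poch_S_l a k : poch a (S k) = a * poch (a + 1) k.
Proof.
  induction k as [|k IH].
  - simpl. ring.
  - change (poch a (S k) * (a + INR (S k)) = a * (poch (a + 1) k * (a + 1 + INR k))).
    rewrite IH, C_INR_S. ring.
Qed.

(** Coefficients of $(1-X)^q$ for complex $q$. *)
Definition binser (q : C) : fps := fun l => poch (- q) l / INR (fact l).
Definition mon (p : nat) (q : C) : fps := Nat.iter p fps_shift (binser q).

Lemma mon_0 q k : mon 0 q k = binser q k.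
Proof. reflexivity. Qed.

Lemma mon_S p q k : mon (S p) q (S k) = mon p q k.
Proof. reflexivity. Qed.

Lemma mon_lt p q k : (k < p)%nat -> mon p q k = 0.
Proof.
  revert k. induction p as [|p IH]; intros k Hk; [lia|].
  destruct k as [|k]; [reflexivity|]. rewrite mon_S. apply IH. lia.
Qed.

(** Multiplication by $1-X$; at $p=0$ this is Pascal's rule for $(-q)_l/l!$. *)
Lemma mon_q1 p q k : mon p (q + 1) k = mon p q k - mon (S p) q k.
Proof.
  revert k. induction p as [|p IH]; intros k.
  - destruct k as [|k].
    + rewrite (mon_lt 1) by lia. rewrite (mon_0 (q + 1)), !(mon_0 q). unfold binser. simpl. field.
    + rewrite mon_S. rewrite (mon_0 (q + 1)), (mon_0 q (S k)), (mon_0 q k). unfold binser.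
      rewrite (poch_S_l (- (q + 1))). replace (- (q + 1) + 1) with (- q) by ring. cbn [poch].
      rewrite C_INR_fact_S. field. split; [apply C_INR_fact_neq0|apply C_INR_S_neq0].
  - destruct k as [|k]; [cbn; ring|]. rewrite !mon_S. apply IH.
Qed.

(** The derivative $\theta\,X^p(1-X)^q=pX^p(1-X)^q-qX^{p+1}(1-X)^{q-1}$. *)
Lemma mon_theta p q k :
  INR k * mon p q k = INR p * mon p q k - q * mon (S p) (q - 1) k.
Proof.
  revert k. induction p as [|p IH]; intros k.
  - destruct k as [|k].
    + rewrite (mon_lt 1) by lia. rewrite (mon_0 q). unfold binser. simpl. field.
    + rewrite mon_S. rewrite (mon_0 q), (mon_0 (q - 1)). unfold binser.
      rewrite poch_S_l. replace (- q + 1) with (- (q - 1)) by ring.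
      rewrite C_INR_fact_S, C_INR_S. simpl INR.
      field. split; [apply C_INR_fact_neq0|apply C_INR_S_neq0].
  - destruct k as [|k]; [cbn; ring|]. rewrite !mon_S, !C_INR_S.
    specialize (IH k).
    transitivity (INR k * mon p q k + mon p q k); [ring|rewrite IH; ring].
Qed.

(** For a polynomial $Q$, the coefficient of $X^{p+i}(1-X)^{q-i}$ in $Q(\theta)X^p(1-X)^q$ is
    $(-1)^iq(q-1)\cdots(q-i+1)\,\Delta^iQ(p)/i!$. Degree three suffices, since [sq0], [sq1] and
    [sq2] are cubic. *)
Lemma mon_theta_cubic (c3 c2 c1 c0 : C) p q k :
  (c3 * INR k ^ 3 + c2 * INR k ^ 2 + c1 * INR k + c0) * mon p q k =
  (c3 * INR p ^ 3 + c2 * INR p ^ 2 + c1 * INR p + c0) * mon p q k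
  - q * (c3 * (3 * INR p ^ 2 + 3 * INR p + 1) + c2 * (2 * INR p + 1) + c1) * mon (S p) (q - 1) k
  + q * (q - 1) * (c3 * (3 * INR p + 3) + c2) * mon (S (S p)) (q - 2) k
  - q * (q - 1) * (q - 2) * c3 * mon (S (S (S p))) (q - 3) k.
Proof.
  pose proof (mon_theta p q k) as H0.
  pose proof (mon_theta (S p) (q - 1) k) as H1.
  pose proof (mon_theta (S (S p)) (q - 2) k) as H2.
  replace (q - 1 - 1) with (q - 2) in H1 by ring.
  replace (q - 2 - 1) with (q - 3) in H2 by ring.
  rewrite C_INR_S in H1. do 2 rewrite C_INR_S in H2.
  set (K := RtoC (INR k)) in *. set (P := RtoC (INR p)) in *.
  set (M0 := mon p q k) in *. set (M1 := mon (S p) (q - 1) k) in *.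
  set (M2 := mon (S (S p)) (q - 2) k) in *. set (M3 := mon (S (S (S p))) (q - 3) k) in *.
  assert (E2 : K * (K * M0) = P ^ 2 * M0 - q * (2 * P + 1) * M1 + q * (q - 1) * M2).
  { rewrite H0. transitivity (P * (K * M0) - q * (K * M1)); [ring|].
    rewrite H0, H1. ring. }
  assert (E3 : K * (K * (K * M0)) = P ^ 3 * M0 - q * (3 * P ^ 2 + 3 * P + 1) * M1
             + q * (q - 1) * (3 * P + 3) * M2 - q * (q - 1) * (q - 2) * M3).
  { rewrite E2. transitivity (P ^ 2 * (K * M0) - q * (2 * P + 1) * (K * M1)
                              + q * (q - 1) * (K * M2)); [ring|].
    rewrite H0, H1, H2. ring. }
  transitivity (c3 * (K * (K * (K * M0))) + c2 * (K * (K * M0)) + c1 * (K * M0) + c0 * M0);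
    [ring|]. rewrite E3, E2, H0. ring.
Qed.

Lemma mon_q2 p q k : mon p (q + 2) k = mon p q k - 2 * mon (S p) q k + mon (S (S p)) q k.
Proof. replace (q + 2) with (q + 1 + 1) by ring. rewrite !mon_q1. ring. Qed.

Lemma mon_q3 p q k : mon p (q + 3) k
  = mon p q k - 3 * mon (S p) q k + 3 * mon (S (S p)) q k - mon (S (S (S p))) q k.
Proof. replace (q + 3) with (q + 2 + 1) by ring. rewrite mon_q1, !mon_q2. ring. Qed.

Lemma mon_q4 p q k : mon p (q + 4) k
  = mon p q k - 4 * mon (S p) q k + 6 * mon (S (S p)) q k - 4 * mon (S (S (S p))) q k
    + mon (S (S (S (S p)))) q k.
Proof. replace (q + 4) with (q + 3 + 1) by ring. rewrite mon_q1, !mon_q3. ring. Qed.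

Lemma symsq_mon a b c s p q k :
  symsq a b c s (mon p q) k =
  sq0 c (INR k + s) * mon p q k + sq1 a b c (INR k - 1 + s) * mon (S p) q k
  + sq2 a b (INR k - 2 + s) * mon (S (S p)) q k.
Proof.
  unfold symsq. destruct k as [|[|k]]; cbn [fps_shift]; rewrite ?mon_S, ?C_INR_S.
  - rewrite (mon_lt (S p)), (mon_lt (S (S p))) by lia. ring.
  - rewrite (mon_lt (S p)) by lia. replace (INR 0 + 1 - 1 + s) with (INR 0 + s) by ring. ring.
  - replace (INR k + 1 + 1 - 1 + s) with (INR k + 1 + s) by ring.
    replace (INR k + 1 + 1 - 2 + s) with (INR k + s) by ring. ring.
Qed.

(* The base exponent [q] is three below the exponent acted on, so that the three
   derivatives need no negative powers of [1 - X]. *)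
Ltac expand_symsq :=
  lazymatch goal with |- context [symsq ?a ?b ?c ?s (mon ?p (?q + RtoC 3%R)) ?k] =>
  rewrite (symsq_mon a b c s p (q + 3) k);
  let H0 := fresh in let H1 := fresh in let H2 := fresh in
  pose proof (mon_theta_cubic 1 (3 * (s + c - 1)) (3 * s ^ 2 + 6 * (c - 1) * s + 2 * (c - 1) ^ 2)
    (sq0 c s) p (q + 3) k) as H0;
  pose proof (mon_theta_cubic (- (2)) (- (6) * (s - 1) - 3 * (a + b + c - 1))
    (- (6) * (s - 1) ^ 2 - 6 * (a + b + c - 1) * (s - 1)
     - (4 * a * b + a + b + 1 - c + 4 * (c - 1) * (a + b)))
    (sq1 a b c (s - 1)) (S p) (q + 3) k) as H1;
  pose proof (mon_theta_cubic 1 (3 * (s - 2) + 3 * (a + b))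
    (3 * (s - 2) ^ 2 + 6 * (a + b) * (s - 2) + 4 * a * b + 2 * (a + b) ^ 2)
    (sq2 a b (s - 2)) (S (S p)) (q + 3) k) as H2;
  lazymatch type of H0 with ?u * _ = _ =>
    replace (sq0 c (INR k + s)) with u by (unfold sq0; ring) end;
  lazymatch type of H1 with ?u * _ = _ =>
    replace (sq1 a b c (INR k - 1 + s)) with u by (unfold sq1; ring) end;
  lazymatch type of H2 with ?u * _ = _ =>
    replace (sq2 a b (INR k - 2 + s)) with u by (unfold sq2; ring) end;
  rewrite H0, H1, H2; clear H0 H1 H2;
  replace (q + 3 - 1) with (q + 2) by ring; replace (q + 3 - 2) with (q + 1) by ring;
  replace (q + 3 - 3) with q by ring;
  unfold sq0, sq1, sq2
  end.

Section Linear.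

Variables a b c s : C.

Lemma symsq_ext (f g : fps) k :
  (forall l, (l <= k)%nat -> f l = g l) -> symsq a b c s f k = symsq a b c s g k.
Proof.
  intros H. unfold symsq. rewrite (H k (le_n k)).
  destruct k as [|[|k]]; cbn [fps_shift]; trivial.
  - now rewrite (H O) by lia.
  - now rewrite (H (S k)), (H k) by lia.
Qed.

Lemma symsq_scal d f k : symsq a b c s (fun l => d * f l) k = d * symsq a b c s f k.
Proof. unfold symsq. destruct k as [|[|k]]; cbn [fps_shift]; ring. Qed.

Lemma symsq_Csum (t : nat -> fps) n k :
  symsq a b c s (fun l => Csum (fun i => t i l) n) k = Csum (fun i => symsq a b c s (t i) k) n.
Proof.
  induction n as [|n IH]; simpl Csum.
  - unfold symsq. destruct k as [|[|k]]; cbn [fps_shift]; ring.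
  - rewrite <- IH. unfold symsq. destruct k as [|[|k]]; cbn [fps_shift]; ring.
Qed.

(** Summation over the rectangle leaves only the values of [G1] on the sides $i=0,m$ and of [G2] on
    the sides $j=0,n$. *)
Lemma symsq_double_telescope (t G1 G2 : nat -> nat -> fps) m n k :
  (forall i j, (j < n)%nat -> symsq a b c s (t i j) k
     = (G1 (S i) j k - G1 i j k) + (G2 i (S j) k - G2 i j k)) ->
  (forall j, G1 O j k = 0) -> (forall j, G1 m j k = 0) ->
  (forall i, G2 i O k = 0) -> (forall i, G2 i n k = 0) ->
  symsq a b c s (fun l => Csum (fun i => Csum (fun j => t i j l) n) m) k = 0.
Proof.
  intros H H10 H1m H20 H2n.
  rewrite (symsq_Csum (fun i l => Csum (fun j => t i j l) n)).
  rewrite (Csum_ext _ (fun i => Csum (fun j => G1 (S i) j k - G1 i j k) n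
                         + Csum (fun j => G2 i (S j) k - G2 i j k) n)).
  - rewrite Csum_plus, Csum_swap.
    rewrite (Csum_0 (fun j => Csum (fun i => G1 (S i) j k - G1 i j k) m)).
    + rewrite Csum_0; [ring|]. intros i _.
      rewrite (Csum_telescope (fun j => G2 i j k)), H20, H2n. ring.
    + intros j _. rewrite (Csum_telescope (fun i => G1 i j k)), H10, H1m. ring.
  - intros i. rewrite (symsq_Csum (t i)), <- Csum_plus.
    apply Csum_ext_lt. intros j Hj. now apply H.
Qed.

End Linear.

(** * The two telescoping certificates *)

Section Certificate122.

Variables a b c : C.
Variables A B h : fps.

Let be := c - a - b - 1 / 2.
Let IA (i : nat) := INR i * A i.
Let IB (j : nat) := INR j * B j.
Let hh (n : nat) := (INR n + 1 - c) * (INR n - 1 + c) * h n.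

Hypothesis HA : forall i, IA (S i) = (INR i + 1 / 2 + a - b) * (INR i + 1 / 2 - a + b) * A i.
Hypothesis HB : forall j, IB (S j) = (INR j + 1 / 2 + c - a - b) * (INR j + 1 / 2 - c + a + b) * B j.
Hypothesis Hh : forall n, hh (S n) = (INR n + 1 / 2) * h n.

(** The term of the series multiplied by $(1-X)^{be}$: since $z/(z-1)=-z/(1-z)$, its $j$-th power
    contributes a sign and lowers the exponent of $1-X$ by $j$. *)
Definition t122 (i j : nat) : fps := fun k =>
  A i * B j * (- (1)) ^ j * h (i + j)%nat * mon (i + j) (be - INR j) k.

(** The summands with [h (pred (i + j))] cancel between [G122_1 i j] and [G122_2 i j]. At $i=j=0$,
    where [pred] takes its default value, they carry a factor zero. *)
Definition G122_1 (i j : nat) : fps := fun k =>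
  IA i * B j * (- (1)) ^ j *
  (- hh (i + j)%nat * mon (i + j) (be - INR j + 1) k
   - INR j * h (pred (i + j)) * mon (S (i + j)) (be - INR j) k).

Definition G122_2 (i j : nat) : fps := fun k =>
  A i * IB j * (- (1)) ^ j *
  (- hh (i + j)%nat * mon (i + j) (be - INR j) k
   + INR i * h (pred (i + j)) * mon (S (i + j)) (be - INR j) k).

Lemma certificate122 i j k :
  symsq a b c (1 - c) (t122 i j) k
  = (G122_1 (S i) j k - G122_1 i j k) + (G122_2 i (S j) k - G122_2 i j k).
Proof.
  unfold t122. rewrite (symsq_scal _ _ _ _ _ (mon (i + j) (be - INR j))). unfold G122_1, G122_2.
  replace (i + S j)%nat with (S (i + j)) by lia. change (S i + j)%nat with (S (i + j)).
  cbn [pred Cpow].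
  rewrite HA, HB, Hh. unfold IA, IB, hh.
  (* With all exponents raised from this common base, both sides are linear in six consecutive
     series $X^{i+j+t}(1-X)^q$, $0\le t\le5$; the identity holds coefficient by coefficient, as one
     of polynomials in $i$, $j$, $a$, $b$, $c$. *)
  set (q := be - INR j - 3).
  replace (be - INR (S j)) with (q + 2) by (unfold q; rewrite C_INR_S; ring).
  replace (be - INR j + 1) with (q + 4) by (unfold q; ring).
  replace (be - INR j) with (q + 3) by (unfold q; ring).
  expand_symsq.
  repeat rewrite ?mon_q4, ?mon_q3, ?mon_q2, ?mon_q1.
  repeat rewrite C_INR_S. rewrite !C_INR_plus.
  assert (Hq : q = c - a - b - 1 / 2 - INR j - 3) by reflexivity.
  clearbody q.
  generalize (mon (i + j) q k) (mon (S (i + j)) q k) (mon (S (S (i + j))) q k)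
   (mon (S (S (S (i + j)))) q k) (mon (S (S (S (S (i + j))))) q k)
   (mon (S (S (S (S (S (i + j)))))) q k) (h (pred (i + j))) (h (i + j)%nat).
  intros y0 y1 y2 y3 y4 y5 h0 h1. rewrite Hq.
  generalize (A i) (B j) ((- (1)) ^ j) (RtoC (INR i)) (RtoC (INR j)).
  intros Ai Bj sg I J. field.
Qed.

End Certificate122.

Section Certificate211.

Variables a b p : C.
Variables u v K : fps.
Variable n : nat.

Let r := a + b - p.
Let c := p + 1 / 2.
Let IU (i : nat) := INR i * (2 * p + INR i - 1) * u i.
Let IV (j : nat) := INR j * (2 * r + INR j - 1) * v j.
Let KK (l : nat) := (a + b + INR l - 1 / 2) * K l.

Hypothesis HU : forall i, IU (S i) = (p + INR i) * u i.
Hypothesis HV : forall j, (j < n)%nat -> IV (S j) = (r + INR j) * v j.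
Hypothesis HK : forall l, KK (S l) = (2 * a + INR l) * (2 * b + INR l) * K l.

(** In the application $p=a+b+n$ and $r=-n$; the two hypotheses on [u] and [v] then say
    $u_i\sim(p)_i/((2p)_i\,i!)$ and $v_j\sim(r)_j/((2r)_j\,j!)$, without dividing by factors that
    may vanish. *)
Definition t211 (i j : nat) : fps := fun k => K (i + j)%nat * u i * v j * mon i (INR j) k.

Definition G211_1 (i j : nat) : fps := fun k =>
  IU i * v j * (- KK (i + j)%nat * mon i (INR j + 1) k
    + K (i + j)%nat * (r + INR j) * mon i (INR j) k).

Definition G211_2 (i j : nat) : fps := fun k =>
  u i * IV j * (KK (i + j)%nat * mon (S (S i)) (INR j - 1) k
    - K (i + j)%nat * (p + INR i) * mon (S i) (INR j - 1) k).

(** The same reduction to six consecutive series as in [certificate122]. The bound on $j$ is the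
    range of the recurrence for [v], whose denominators $(-2n)_j$ eventually vanish in the
    application. *)
Lemma certificate211 i j k : (j < n)%nat ->
  symsq a b c 0 (t211 i j) k
  = (G211_1 (S i) j k - G211_1 i j k) + (G211_2 i (S j) k - G211_2 i j k).
Proof.
  intros Hj. unfold t211.
  rewrite (symsq_scal _ _ _ _ _ (mon i (INR j))). unfold G211_1, G211_2.
  replace (i + S j)%nat with (S (i + j)) by lia. change (S i + j)%nat with (S (i + j)).
  rewrite HU, HV, HK by assumption.
  set (q := INR j - 3).
  replace (INR (S j) - 1) with (q + 3) by (unfold q; rewrite C_INR_S; ring).
  replace (INR j + 1) with (q + 4) by (unfold q; ring).
  replace (INR j - 1) with (q + 2) by (unfold q; ring).
  replace (mon i (INR j)) with (mon i (q + 3)) by (f_equal; unfold q; ring).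
  replace (mon (S i) (INR j)) with (mon (S i) (q + 3)) by (f_equal; unfold q; ring).
  expand_symsq.
  repeat rewrite ?mon_q4, ?mon_q3, ?mon_q2, ?mon_q1.
  unfold IU, IV, KK, c, r.
  repeat rewrite C_INR_S. rewrite !C_INR_plus.
  assert (Hq : q = INR j - 3) by reflexivity.
  clearbody q.
  generalize (mon i q k) (mon (S i) q k) (mon (S (S i)) q k)
   (mon (S (S (S i))) q k) (mon (S (S (S (S i)))) q k)
   (mon (S (S (S (S (S i))))) q k) (K (S (i + j)))%nat (K (i + j)%nat).
  intros y0 y1 y2 y3 y4 y5 K1 K0. rewrite Hq.
  generalize (u i) (v j) (RtoC (INR i)) (RtoC (INR j)).
  intros ui vj I J. field.
Qed.

End Certificate211.


(** * Pochhammer symbols *)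

Lemma RtoC_neq0 x : x <> 0%R -> RtoC x <> 0.
Proof. intros H E. apply H. now apply RtoC_inj. Qed.

Lemma C_neq0_eq (x y : C) : y = x -> x <> 0 -> y <> 0.
Proof. now intros ->. Qed.

Lemma poch_neq0 a k : (forall i, (i < k)%nat -> a + INR i <> 0) -> poch a k <> 0.
Proof.
  induction k as [|k IH]; intros H; simpl.
  - apply RtoC_neq0. lra.
  - apply Cmult_neq_0; auto with arith.
Qed.

Lemma not_nonpos_int_add a i : ~ nonpos_int a -> a + INR i <> 0.
Proof.
  intros H E. apply H. exists i.
  transitivity (a + INR i - INR i); [ring|rewrite E; ring].
Qed.

Lemma poch_neq0_nonpos a k : ~ nonpos_int a -> poch a k <> 0.
Proof. intros H. apply poch_neq0. intros i _. now apply not_nonpos_int_add. Qed.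

Lemma not_nonpos_int_plus a n : ~ nonpos_int a -> ~ nonpos_int (a + INR n).
Proof.
  intros H [k E]. apply H. exists (k + n)%nat. rewrite C_INR_plus.
  transitivity (a + INR n - INR n); [ring|rewrite E; ring].
Qed.

Lemma poch_add a k l : poch a (k + l) = poch a k * poch (a + INR k) l.
Proof.
  induction l as [|l IH].
  - rewrite Nat.add_0_r. simpl. ring.
  - rewrite Nat.add_succ_r. simpl. rewrite IH, C_INR_plus. ring.
Qed.

Lemma poch_double a k : poch (2 * a) (k + k) = 4 ^ k * poch a k * poch (a + 1 / 2) k.
Proof.
  induction k as [|k IH]; [simpl; ring|].
  replace (S k + S k)%nat with (S (S (k + k))) by lia.
  cbn [poch Cpow]. rewrite IH, C_INR_S, C_INR_plus. field.
Qed.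

Lemma poch_opp_INR_0 n : poch (- INR n) (S n) = 0.
Proof. simpl. ring. Qed.

Lemma poch_opp_INR_neq0 n k : (k <= n)%nat -> poch (- INR n) k <> 0.
Proof.
  intros H. apply poch_neq0. intros i Hi.
  apply (C_neq0_eq (RtoC (INR i - INR n))); [rewrite RtoC_minus; ring|].
  apply RtoC_neq0. apply Rminus_eq_contra, not_INR. lia.
Qed.

Lemma two_INR n : 2 * INR n = INR (2 * n).
Proof. now rewrite mult_INR, RtoC_mult. Qed.

(* [(p)_i / ((2p)_i i!)] after cancelling the common factors of [(p)_i] and [(2p)_i];
   this form is continuous at the non-positive integers. *)
Definition uhat (p : C) (i : nat) : C :=
  poch (p + INR (i - Nat.div2 i)) (Nat.div2 i)
  / (2 ^ i * poch (p + 1 / 2) (Nat.div2 i) * INR (fact i)).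

Lemma two_pow_neq0 i : (2 : C) ^ i <> 0.
Proof. apply Cpow_nz, RtoC_neq0. lra. Qed.

(** The factors $2p+2t$ of $(2p)_i$ form one symbol and the factors $2p+2t+1$ the other;
    [i - Nat.div2 i] is $i/2$ rounded up. *)
Lemma poch_two_mul p i :
  poch (2 * p) i = 2 ^ i * poch p (i - Nat.div2 i) * poch (p + 1 / 2) (Nat.div2 i).
Proof.
  destruct (Nat.Even_or_Odd i) as [[t ->]|[t ->]].
  - rewrite Nat.div2_double. replace (2 * t - t)%nat with t by lia.
    replace (2 * t)%nat with (t + t)%nat by lia. rewrite poch_double, Cpow_add_r.
    rewrite <- Cpow_mult_l. replace (2 * 2) with (RtoC 4) by ring. ring.
  - replace (2 * t + 1)%nat with (S (2 * t)) by lia. rewrite Nat.div2_succ_double.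
    replace (S (2 * t) - t)%nat with (S t) by lia.
    replace (2 * t)%nat with (t + t)%nat by lia. cbn [poch Cpow].
    rewrite poch_double, Cpow_add_r, C_INR_plus.
    rewrite <- Cpow_mult_l. replace (2 * 2) with (RtoC 4) by ring. field.
Qed.

Lemma uhat_eq_poch p i : poch p (i - Nat.div2 i) <> 0 -> poch (p + 1 / 2) (Nat.div2 i) <> 0 ->
  uhat p i = poch p i / (poch (2 * p) i * INR (fact i)).
Proof.
  intros H1 H2. unfold uhat. rewrite poch_two_mul.
  assert (Hi : (Nat.div2 i <= i)%nat) by (apply Nat.div2_decr; lia).
  replace (poch p i) with (poch p (i - Nat.div2 i) * poch (p + INR (i - Nat.div2 i)) (Nat.div2 i)).
  - field. repeat split; auto using C_INR_fact_neq0, two_pow_neq0.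
  - rewrite <- poch_add. f_equal. lia.
Qed.

Lemma uhat_eq p i : ~ nonpos_int p -> ~ nonpos_int (p + 1 / 2) ->
  uhat p i = poch p i / (poch (2 * p) i * INR (fact i)).
Proof. intros H1 H2. apply uhat_eq_poch; now apply poch_neq0_nonpos. Qed.

(** * Watson's sum *)

Definition vterm (n j : nat) : C := poch (- INR n) j / (poch (- (2 * INR n)) j * INR (fact j)).

Lemma vterm_0 n : vterm n 0 = 1.
Proof. unfold vterm. simpl. field. Qed.

Lemma vterm_gt n : vterm n (S n) = 0.
Proof. unfold vterm. rewrite poch_opp_INR_0. unfold Cdiv. ring. Qed.

Lemma poch_opp_two_INR_neq0 n j : (j <= 2 * n)%nat -> poch (- (2 * INR n)) j <> 0.
Proof. rewrite two_INR. apply poch_opp_INR_neq0. Qed.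

Lemma opp_two_INR_add_neq0 n j : (j < 2 * n)%nat -> - (2 * INR n) + INR j <> 0.
Proof.
  intros H. rewrite two_INR.
  apply (C_neq0_eq (RtoC (INR j - INR (2 * n)))); [rewrite RtoC_minus; ring|].
  apply RtoC_neq0. apply Rminus_eq_contra, not_INR. lia.
Qed.

Lemma vterm_S n j : (j <= n)%nat ->
  (INR j + 1) * (INR j - 2 * INR n) * vterm n (S j) = (INR j - INR n) * vterm n j.
Proof.
  intros Hj. destruct (Nat.eq_dec j n) as [->|Hn].
  - rewrite vterm_gt. ring.
  - unfold vterm. cbn [poch]. rewrite C_INR_fact_S. field.
    repeat split; auto using C_INR_fact_neq0, C_INR_S_neq0.
    all: first [apply opp_two_INR_add_neq0; lia|apply poch_opp_two_INR_neq0; lia].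
Qed.

(** Relates the weights for $n+1$ and $n$, as the recurrence in $n$ for Watson's sum requires. *)
Lemma vterm_n_S n j : (j <= n)%nat ->
  2 * (INR j + 1) * (2 * INR n + 1) * vterm (S n) (S j) = (2 * INR n + 1 - INR j) * vterm n j.
Proof.
  intros Hj. unfold vterm. rewrite !poch_S_l, C_INR_fact_S.
  assert (E : poch (- (2 * INR (S n)) + 1) j * (- (2 * INR n) - 1 + INR j)
            = (- (2 * INR n) - 1) * poch (- (2 * INR n)) j).
  { transitivity (poch (- (2 * INR n) - 1) (S j)).
    - cbn [poch]. do 2 f_equal. rewrite C_INR_S. ring.
    - rewrite poch_S_l. do 2 f_equal. ring. }
  replace (- INR (S n) + 1) with (- INR n) by (rewrite C_INR_S; ring).
  assert (N0 : - (2 * INR n) - 1 + INR j <> 0).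
  { apply (C_neq0_eq (RtoC (INR j - INR (2 * n + 1)))).
    - rewrite RtoC_minus, C_INR_plus, <- two_INR. simpl. ring.
    - apply RtoC_neq0. apply Rminus_eq_contra, not_INR. lia. }
  assert (N1 : (- (2 * INR n) - 1) * poch (- (2 * INR n)) j <> 0).
  { apply Cmult_neq_0; [|apply poch_opp_two_INR_neq0; lia].
    apply (C_neq0_eq (- (INR (2 * n) + 1))); [rewrite <- two_INR; ring|].
    intros H. apply (C_INR_S_neq0 (2 * n)).
    transitivity (- - (INR (2 * n) + 1)); [ring|rewrite H; ring]. }
  assert (N2 : poch (- (2 * INR (S n)) + 1) j <> 0).
  { intros H. rewrite H in E. apply N1. rewrite <- E. ring. }
  assert (N3 : poch (- (2 * INR n)) j <> 0) by (apply poch_opp_two_INR_neq0; lia).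
  assert (N4 : - (2 * INR n) - 1 <> 0) by (intros H; apply N1; rewrite H; ring).
  replace (poch (- (2 * INR (S n)) + 1) j)
    with ((- (2 * INR n) - 1) * poch (- (2 * INR n)) j / (- (2 * INR n) - 1 + INR j))
    by (rewrite <- E; field; auto).
  rewrite C_INR_S. field.
  repeat split; auto using C_INR_fact_neq0, C_INR_S_neq0.
Qed.

Definition Kterm (a b : C) (N : nat) : C :=
  poch (2 * a) N * poch (2 * b) N / poch (a + b + 1 / 2) N.

Lemma Kterm_0 a b : Kterm a b 0 = 1.
Proof. unfold Kterm. simpl. field. Qed.

Lemma Kterm_S a b N : ~ nonpos_int (a + b + 1 / 2) ->
  (a + b + INR N + 1 / 2) * Kterm a b (S N)
  = (2 * a + INR N) * (2 * b + INR N) * Kterm a b N.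
Proof.
  intros H. unfold Kterm. cbn [poch].
  pose proof (poch_neq0_nonpos _ N H) as H1.
  pose proof (not_nonpos_int_add _ N H) as H2.
  replace (a + b + INR N + 1 / 2) with (a + b + 1 / 2 + INR N) by ring.
  revert H1 H2. generalize (poch (a + b + 1 / 2) N) (a + b + 1 / 2 + INR N).
  intros x y Hx Hy. field. auto.
Qed.

(** Creative telescoping in $n$: the sum ${}_3F_2(2a,2b,-n;a+b+\frac12,-2n;1)$ satisfies a
    first-order recurrence, which the Pochhammer quotient also satisfies. *)
Lemma watson a b n : ~ nonpos_int (a + b + 1 / 2) ->
  poch (1 / 2) n * poch (a + b + 1 / 2) n * Csum (fun j => Kterm a b j * vterm n j) (S n)
  = poch (a + 1 / 2) n * poch (b + 1 / 2) n.
Proof.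
  intros H. induction n as [|n IH].
  - simpl. rewrite Kterm_0, vterm_0. ring.
  - set (w := fun n => Csum (fun j => Kterm a b j * vterm n j) (S n)) in *.
    change (poch (1 / 2) n * poch (a + b + 1 / 2) n * w n
            = poch (a + 1 / 2) n * poch (b + 1 / 2) n) in IH.
    change (poch (1 / 2) (S n) * poch (a + b + 1 / 2) (S n) * w (S n)
            = poch (a + 1 / 2) (S n) * poch (b + 1 / 2) (S n)).
    assert (Hw : 4 * (INR n + 1 / 2) * (a + b + 1 / 2 + INR n) * w (S n)
                 = 4 * (a + INR n + 1 / 2) * (b + INR n + 1 / 2) * w n).
    (* The certificate [G]: its difference is the recurrence operator applied to the summand, and it
       vanishes at both ends because [vterm n (S n)] is zero. *)
    { pose (G := fun j => match j return C with O => 0 | S l =>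
          (2 * a + INR l) * (2 * b + INR l) * Kterm a b l * vterm n l end).
      assert (HG : Csum (fun j => G (S j) - G j) (S (S n)) = 0).
      { rewrite Csum_telescope. unfold G. rewrite vterm_gt. ring. }
      assert (Hn : w n = Csum (fun j => Kterm a b j * vterm n j) (S (S n))).
      { unfold w. change (Csum (fun j => Kterm a b j * vterm n j) (S (S n)))
          with (Csum (fun j => Kterm a b j * vterm n j) (S n) + Kterm a b (S n) * vterm n (S n)).
        rewrite vterm_gt. ring. }
      rewrite (Csum_ext_lt _ (fun j =>
          4 * (a + INR n + 1 / 2) * (b + INR n + 1 / 2) * (Kterm a b j * vterm n j)
          + - (4 * (INR n + 1 / 2) * (a + b + 1 / 2 + INR n))
            * (Kterm a b j * vterm (S n) j))) in HG.
      - rewrite Csum_plus, !Csum_scal, <- Hn in HG. fold (w (S n)) in HG.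
        match type of HG with ?x + - ?y * ?z = _ =>
          transitivity (x - (x + - y * z)); [ring|rewrite HG; ring] end.
      - intros [|l] Hl.
        + unfold G. rewrite Kterm_0, !vterm_0. simpl INR. field.
        + unfold G. rewrite <- (Kterm_S a b l H).
          assert (Hl' : (l <= n)%nat) by lia.
          pose proof (vterm_S n l Hl') as V1. pose proof (vterm_n_S n l Hl') as V2.
          rewrite C_INR_S.
          assert (N1 : 2 * (INR l + 1) * (2 * INR n + 1) <> 0).
          { repeat apply Cmult_neq_0; try apply C_INR_S_neq0.
            - apply RtoC_neq0. lra.
            - rewrite two_INR. apply C_INR_S_neq0. }
          replace (vterm (S n) (S l))
            with ((2 * INR n + 1 - INR l) * vterm n l / (2 * (INR l + 1) * (2 * INR n + 1)))
            by (rewrite <- V2; field; repeat split;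
                solve [apply C_INR_S_neq0|rewrite two_INR; apply C_INR_S_neq0]).
          assert (N2 : 2 * INR n + 1 <> 0) by (rewrite two_INR; apply C_INR_S_neq0).
          (* At $l=n$ the next weight is zero outright; solving the recurrence for it would divide
             by $l-2n$, which is zero when $l=n=0$. *)
          destruct (Nat.eq_dec l n) as [->|Hln].
          * rewrite vterm_gt. field. split; [assumption|apply C_INR_S_neq0].
          * assert (N3 : INR l - 2 * INR n <> 0).
            { apply (C_neq0_eq (- (2 * INR n) + INR l)); [ring|].
              apply opp_two_INR_add_neq0. lia. }
            replace (vterm n (S l))
              with ((INR l - INR n) * vterm n l / ((INR l + 1) * (INR l - 2 * INR n)))
              by (rewrite <- V1; field; split; [assumption|apply C_INR_S_neq0]).
            field. repeat split; solve [assumption|apply C_INR_S_neq0]. }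
    cbn [poch].
    transitivity (poch (1 / 2) n * poch (a + b + 1 / 2) n
       * (4 * (INR n + 1 / 2) * (a + b + 1 / 2 + INR n) * w (S n)) / 4); [field|].
    rewrite Hw.
    transitivity (poch (1 / 2) n * poch (a + b + 1 / 2) n * w n
       * ((a + 1 / 2 + INR n) * (b + 1 / 2 + INR n))); [field|].
    rewrite IH. ring.
Qed.


(** * The identities between formal power series *)

Lemma Csum_trunc (f : nat -> C) n m : (n <= m)%nat ->
  (forall i, (n <= i < m)%nat -> f i = 0) -> Csum f m = Csum f n.
Proof.
  intros Hnm H. replace m with (n + (m - n))%nat by lia. rewrite Csum_add.
  rewrite (Csum_0 (fun i => f (n + i)%nat)); [ring|]. intros i Hi. apply H. lia.
Qed.

Definition hyper (a b c : C) : fps := fun k =>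
  poch a k * poch b k / (poch c k * INR (fact k)).

Lemma hyper_0 a b c : hyper a b c 0%nat = 1.
Proof. unfold hyper. simpl. field. Qed.

Lemma hyper_S a b c k : ~ nonpos_int c ->
  (INR k + 1) * (INR k + c) * hyper a b c (S k) = (INR k + a) * (INR k + b) * hyper a b c k.
Proof.
  intros H. unfold hyper. cbn [poch]. rewrite C_INR_fact_S.
  pose proof (poch_neq0_nonpos _ k H) as H1. pose proof (not_nonpos_int_add _ k H) as H2.
  replace (INR k + c) with (c + INR k) by ring.
  field. repeat split; auto using C_INR_fact_neq0, C_INR_S_neq0.
Qed.

Definition A122 (x y : C) (i : nat) : C := poch x i * poch y i / INR (fact i).
Definition h122 (c : C) (n : nat) : C := poch (1 / 2) n / (poch c n * poch (2 - c) n).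

Lemma A122_S x y i : INR (S i) * A122 x y (S i) = (x + INR i) * (y + INR i) * A122 x y i.
Proof.
  unfold A122. cbn [poch]. rewrite C_INR_fact_S, C_INR_S. field.
  split; [apply C_INR_fact_neq0|apply C_INR_S_neq0].
Qed.

Lemma h122_S c n : ~ nonpos_int c -> ~ nonpos_int (2 - c) ->
  (INR (S n) + 1 - c) * (INR (S n) - 1 + c) * h122 c (S n) = (INR n + 1 / 2) * h122 c n.
Proof.
  intros H1 H2. unfold h122. cbn [poch]. rewrite C_INR_S.
  replace (INR n + 1 + 1 - c) with (2 - c + INR n) by ring.
  replace (INR n + 1 - 1 + c) with (c + INR n) by ring.
  pose proof (poch_neq0_nonpos _ n H1). pose proof (not_nonpos_int_add _ n H1).
  pose proof (poch_neq0_nonpos _ n H2). pose proof (not_nonpos_int_add _ n H2).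
  field. auto.
Qed.

Definition f122 (a b c : C) : nat -> nat -> fps :=
  t122 a b c (A122 (a - b + 1 / 2) (b - a + 1 / 2))
    (A122 (a + b - c + 1 / 2) (c - a - b + 1 / 2)) (h122 c).

Lemma f122_lt a b c i j k : (k < i + j)%nat -> f122 a b c i j k = 0.
Proof. intros H. unfold f122, t122. rewrite mon_lt by assumption. ring. Qed.

Lemma formal_product a b c k : ~ nonpos_int c -> ~ nonpos_int (2 - c) ->
  fps_mul (hyper a b c) (hyper (1 + a - c) (1 + b - c) (2 - c)) k
  = Csum (fun i => Csum (fun j => f122 a b c i j k) (S k)) (S k).
Proof.
  intros H1 H2. revert k.
  set (E := fun k => Csum (fun i => Csum (fun j => f122 a b c i j k) (S k)) (S k)).
  change (forall k, fps_mul (hyper a b c) (hyper (1 + a - c) (1 + b - c) (2 - c)) k = E k).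
  apply (symsq_unique a b c (1 - c)).
  (* At $x=k+2-c$ the leading coefficient is $(k+2-c)(k+1)(k+c)$, which is where both hypotheses on
     $c$ enter. *)
  - intros k. unfold sq0. rewrite C_INR_S. repeat apply Cmult_neq_0.
    + apply (C_neq0_eq (2 - c + INR k)); [ring|now apply not_nonpos_int_add].
    + apply (C_neq0_eq (INR k + 1)); [ring|apply C_INR_S_neq0].
    + apply (C_neq0_eq (c + INR k)); [ring|now apply not_nonpos_int_add].
  - apply symsq_mul; split.
    + ring.
    + intros k. rewrite <- !Cplus_assoc, !Cplus_0_l, !Cplus_0_r. now apply hyper_S.
    + ring.
    + intros k. pose proof (hyper_S (1 + a - c) (1 + b - c) _ k H2) as HG.
      transitivity ((INR k + 1) * (INR k + (2 - c)) * hyper (1 + a - c) (1 + b - c) (2 - c) (S k));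
        [ring|]. rewrite HG. ring.
  - intros k.
    (* The summation range of [E] depends on the coefficient. It is frozen at $k$, so that the
       operator passes through the sums; the added terms have order $i+j$ beyond the coefficient and
       vanish. *)
    rewrite (symsq_ext _ _ _ _ E
      (fun l => Csum (fun i => Csum (fun j => f122 a b c i j l) (S k)) (S k))).
    + set (A := A122 (a - b + 1 / 2) (b - a + 1 / 2)).
      set (B := A122 (a + b - c + 1 / 2) (c - a - b + 1 / 2)).
      apply (symsq_double_telescope _ _ _ _ _
        (G122_1 a b c A B (h122 c)) (G122_2 a b c A B (h122 c))).
      * intros i j _. apply certificate122.
        -- intros l. unfold A. rewrite A122_S. ring.
        -- intros l. unfold B. rewrite A122_S. ring.
        -- intros l. now apply h122_S.
      * intros j. unfold G122_1. simpl INR. ring.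
      * intros j. unfold G122_1. rewrite !mon_lt by lia. ring.
      * intros j. unfold G122_2. simpl INR. ring.
      * intros j. unfold G122_2. rewrite !mon_lt by lia. ring.
    + intros l Hl. unfold E. symmetry. rewrite (Csum_trunc _ (S l) (S k)).
      * apply Csum_ext. intros i. apply Csum_trunc; [lia|].
        intros j Hj. apply f122_lt. lia.
      * lia.
      * intros i Hi. apply Csum_0. intros j _. apply f122_lt. lia.
  - unfold E, fps_mul. cbn [Csum Nat.sub]. rewrite !hyper_0. unfold f122, t122.
    cbn [plus]. rewrite mon_0. unfold A122, h122, binser. simpl. field.
Qed.

Definition f211 (a b : C) (n i j : nat) : fps := fun k =>
  Kterm a b (i + j)%nat * uhat (a + b + INR n) i * vterm n j * mon i (INR j) k.

Lemma f211_lt a b n i j k : (k < i)%nat -> f211 a b n i j k = 0.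
Proof. intros H. unfold f211. rewrite mon_lt by assumption. ring. Qed.

(** For $i=2t$ the factor $2p+2t$ on the left is absorbed by $(p+t)\,(p+t+1)_t=(p+t)_t\,(p+2t)$; for
    $i=2t+1$ the factor $2p+2t+1$ is the new one in the denominator. The recurrence thus survives at
    integers $p\le0$. *)
Lemma uhat_S p i : ~ nonpos_int (p + 1 / 2) ->
  INR (S i) * (2 * p + INR (S i) - 1) * uhat p (S i) = (p + INR i) * uhat p i.
Proof.
  intros H. unfold uhat.
  assert (H1 : forall t, poch (p + 1 / 2) t <> 0) by (intros; now apply poch_neq0_nonpos).
  assert (H2 : forall t, p + 1 / 2 + INR t <> 0) by (intros; now apply not_nonpos_int_add).
  rewrite C_INR_fact_S, C_INR_S. cbn [Cpow].
  destruct (Nat.Even_or_Odd i) as [[t ->]|[t ->]].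
  - rewrite Nat.div2_double, Nat.div2_succ_double.
    replace (2 * t - t)%nat with t by lia. replace (S (2 * t) - t)%nat with (S t) by lia.
    assert (E : (p + INR t) * poch (p + INR (S t)) t = poch (p + INR t) t * (p + 2 * INR t)).
    { transitivity (poch (p + INR t) (S t)).
      - rewrite poch_S_l, C_INR_S. do 2 f_equal. ring.
      - cbn [poch]. ring. }
    specialize (H1 t). rewrite <- two_INR.
    transitivity (((p + INR t) * poch (p + INR (S t)) t)
      / (2 ^ (2 * t) * poch (p + 1 / 2) t * INR (fact (2 * t)))).
    + field. repeat split; auto using C_INR_fact_neq0, two_pow_neq0.
      rewrite two_INR. apply C_INR_S_neq0.
    + rewrite E. field. repeat split; auto using C_INR_fact_neq0, two_pow_neq0.
  - replace (2 * t + 1)%nat with (S (2 * t)) by lia.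
    rewrite Nat.div2_succ_double. replace (S (S (2 * t))) with (2 * S t)%nat by lia.
    rewrite Nat.div2_double.
    replace (2 * S t - S t)%nat with (S t) by lia. replace (S (2 * t) - t)%nat with (S t) by lia.
    cbn [poch]. specialize (H1 t). specialize (H2 t). rewrite !C_INR_S, <- two_INR.
    assert (N : 2 * INR t + 1 + 1 <> 0).
    { rewrite two_INR, <- C_INR_S. apply C_INR_S_neq0. }
    replace (2 * p + (2 * INR t + 1 + 1) - 1) with (2 * (p + 1 / 2 + INR t)) by field.
    generalize dependent (p + 1 / 2 + INR t). intros w Hw.
    field. repeat split; auto using C_INR_fact_neq0, two_pow_neq0.
Qed.

Lemma formal_clausen_generic a b n k :
  ~ nonpos_int (a + b + 1 / 2) -> ~ nonpos_int (a + b + INR n) ->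
  poch (a + 1 / 2) n * poch (b + 1 / 2) n *
    fps_mul (hyper a b (a + b + INR n + 1 / 2)) (hyper a b (a + b + INR n + 1 / 2)) k
  = poch (1 / 2) n * poch (a + b + 1 / 2) n *
    Csum (fun i => Csum (fun j => f211 a b n i j k) (S n)) (S k).
Proof.
  intros Hg Hp. revert k. set (p := a + b + INR n) in *. set (c := p + 1 / 2).
  assert (Hc : ~ nonpos_int c).
  { intros Hc. apply (not_nonpos_int_plus _ n Hg).
    replace (a + b + 1 / 2 + INR n) with c by (unfold c, p; ring). assumption. }
  set (F := hyper a b c).
  set (E := fun k => Csum (fun i => Csum (fun j => f211 a b n i j k) (S n)) (S k)).
  set (c1 := poch (a + 1 / 2) n * poch (b + 1 / 2) n).
  set (c2 := poch (1 / 2) n * poch (a + b + 1 / 2) n).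
  (* This is $k+2p$: for even $k$ it would vanish only with $p$ a non-positive integer, for odd $k$
     only with $c=p+\frac12$ one. *)
  assert (Hcp : forall k, RtoC (INR k) + 2 * c - 1 <> 0).
  { intros k Hk. destruct (Nat.Even_or_Odd k) as [[t ->]|[t ->]].
    - apply Hp. exists t. rewrite <- two_INR in Hk.
      transitivity ((2 * INR t + 2 * c - 1) / 2 - INR t);
        [unfold c; field|rewrite Hk; field].
    - apply Hc. exists t. rewrite C_INR_plus, <- two_INR in Hk. simpl INR in Hk.
      transitivity ((2 * INR t + 1 + 2 * c - 1) / 2 - INR t); [field|rewrite Hk; field]. }
  apply (symsq_unique a b c 0 (fun k => c1 * fps_mul F F k) (fun k => c2 * E k)).
  - intros k. unfold sq0. rewrite C_INR_S. repeat apply Cmult_neq_0.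
    + apply (C_neq0_eq (INR k + 1)); [ring|apply C_INR_S_neq0].
    + apply (C_neq0_eq (c + INR k)); [ring|now apply not_nonpos_int_add].
    + apply (C_neq0_eq (INR k + 2 * c - 1)); [ring|apply Hcp].
  - assert (HF : hyp_eq a b c 0 F).
    { split; [ring|]. intros l. unfold F.
      rewrite <- !Cplus_assoc, !Cplus_0_l, !Cplus_0_r. now apply hyper_S. }
    intros k. rewrite symsq_scal, (symsq_mul a b c 0 F F HF HF). ring.
  - intros k. rewrite symsq_scal.
    rewrite (symsq_ext _ _ _ _ E
      (fun l => Csum (fun i => Csum (fun j => f211 a b n i j l) (S n)) (S k))).
    + rewrite (symsq_double_telescope _ _ _ _ _
        (G211_1 a b p (uhat p) (vterm n) (Kterm a b))
        (G211_2 a b p (uhat p) (vterm n) (Kterm a b))).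
      * ring.
      * intros i j Hj.
        apply (certificate211 a b p (uhat p) (vterm n) (Kterm a b) (S n)); trivial.
        -- intros l. now apply uhat_S.
        -- intros l Hl. rewrite C_INR_S.
           pose proof (vterm_S n l ltac:(lia)) as V.
           transitivity ((INR l + 1) * (INR l - 2 * INR n) * vterm n (S l));
             [unfold p; ring|rewrite V; unfold p; ring].
        -- intros l. rewrite <- Kterm_S by assumption. rewrite C_INR_S. field.
      * intros j. unfold G211_1. simpl INR. ring.
      * intros j. unfold G211_1. rewrite !mon_lt by lia. ring.
      * intros j. unfold G211_2. simpl INR. ring.
      * intros j. unfold G211_2. rewrite vterm_gt. ring.
    + intros l Hl. unfold E. symmetry. apply Csum_trunc; [lia|].
      intros i Hi. apply Csum_0. intros j _. apply f211_lt. lia.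
  - unfold c2, E, c1, F, fps_mul. rewrite <- (watson a b n Hg).
    cbn [Csum Nat.sub]. rewrite !hyper_0.
    change (Csum (fun j => Kterm a b j * vterm n j) n + Kterm a b n * vterm n n)
      with (Csum (fun j => Kterm a b j * vterm n j) (S n)).
    change (Csum (fun j => f211 a b n 0 j 0%nat) n + f211 a b n 0 n 0%nat)
      with (Csum (fun j => f211 a b n 0 j 0%nat) (S n)).
    rewrite (Csum_ext (fun j => f211 a b n 0 j 0%nat) (fun j => Kterm a b j * vterm n j)).
    + ring.
    + intros j. unfold f211. rewrite mon_0. unfold binser, uhat. simpl. field.
Qed.


(** * Continuity in a parameter *)

Definition ccont (f : C -> C) (x : C) : Prop :=
  forall eps, (0 < eps)%R -> exists d, (0 < d)%R /\
    forall y, (Cmod (y - x) < d)%R -> (Cmod (f y - f x) < eps)%R.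

Lemma ccont_const c x : ccont (fun _ => c) x.
Proof.
  intros eps He. exists 1%R. split; [lra|]. intros y _.
  replace (c - c) with (RtoC 0) by ring. now rewrite Cmod_0.
Qed.

Lemma ccont_id x : ccont (fun y => y) x.
Proof. intros eps He. exists eps. auto. Qed.

Lemma ccont_plus f g x : ccont f x -> ccont g x -> ccont (fun y => f y + g y) x.
Proof.
  intros Hf Hg eps He.
  destruct (Hf (eps / 2)%R ltac:(lra)) as [d1 [Hd1 H1]].
  destruct (Hg (eps / 2)%R ltac:(lra)) as [d2 [Hd2 H2]].
  exists (Rmin d1 d2). split; [now apply Rmin_pos|]. intros y Hy.
  specialize (H1 y (Rlt_le_trans _ _ _ Hy (Rmin_l _ _))).
  specialize (H2 y (Rlt_le_trans _ _ _ Hy (Rmin_r _ _))).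
  replace (f y + g y - (f x + g x)) with ((f y - f x) + (g y - g x)) by ring.
  eapply Rle_lt_trans; [apply Cmod_triangle|lra].
Qed.

Lemma ccont_mult f g x : ccont f x -> ccont g x -> ccont (fun y => f y * g y) x.
Proof.
  intros Hf Hg eps He.
  set (M := (1 + Cmod (f x) + Cmod (g x))%R).
  assert (HM : (1 <= M)%R).
  { unfold M. pose proof (Cmod_ge_0 (f x)). pose proof (Cmod_ge_0 (g x)). lra. }
  set (e := Rmin 1 (eps / (2 * M))).
  assert (Hpos : (0 < eps / (2 * M))%R) by (apply Rdiv_lt_0_compat; lra).
  assert (Hepos : (0 < e)%R) by (apply Rmin_pos; lra).
  destruct (Hf e Hepos) as [d1 [Hd1 H1]].
  destruct (Hg e Hepos) as [d2 [Hd2 H2]].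
  exists (Rmin d1 d2). split; [now apply Rmin_pos|]. intros y Hy.
  specialize (H1 y (Rlt_le_trans _ _ _ Hy (Rmin_l _ _))).
  specialize (H2 y (Rlt_le_trans _ _ _ Hy (Rmin_r _ _))).
  replace (f y * g y - f x * g x)
    with ((f y - f x) * (g y - g x) + (f y - f x) * g x + f x * (g y - g x)) by ring.
  eapply Rle_lt_trans; [apply Cmod_triangle|].
  eapply Rle_lt_trans; [apply Rplus_le_compat_r, Cmod_triangle|].
  rewrite !Cmod_mult.
  pose proof (Cmod_ge_0 (f x)). pose proof (Cmod_ge_0 (g x)).
  pose proof (Cmod_ge_0 (f y - f x)). pose proof (Cmod_ge_0 (g y - g x)).
  assert (He1 : (e <= 1)%R) by apply Rmin_l.
  assert (HeM : (e * M <= eps / 2)%R).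
  { replace (eps / 2)%R with (eps / (2 * M) * M)%R by (field; lra).
    apply Rmult_le_compat_r; [lra|apply Rmin_r]. }
  assert ((Cmod (f y - f x) * Cmod (g y - g x) <= e * 1)%R) by (apply Rmult_le_compat; lra).
  assert ((Cmod (f y - f x) * Cmod (g x) <= e * Cmod (g x))%R)
    by (apply Rmult_le_compat_r; lra).
  assert ((Cmod (f x) * Cmod (g y - g x) <= Cmod (f x) * e)%R)
    by (apply Rmult_le_compat_l; lra).
  unfold M in HeM. lra.
Qed.

Lemma ccont_inv f x : ccont f x -> f x <> 0 -> ccont (fun y => / f y) x.
Proof.
  intros Hf H0 eps He.
  apply Cmod_gt_0 in H0 as Hm. set (m := Cmod (f x)) in *.
  destruct (Hf (Rmin (m / 2) (eps * (m * m) / 2))) as [d [Hd H]].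
  { apply Rmin_pos; [lra|]. apply Rdiv_lt_0_compat; [|lra].
    repeat apply Rmult_lt_0_compat; lra. }
  exists d. split; trivial. intros y Hy. specialize (H y Hy).
  assert (H1 : (Cmod (f y - f x) < m / 2)%R) by (eapply Rlt_le_trans; [apply H|apply Rmin_l]).
  assert (H2 : (Cmod (f y - f x) < eps * (m * m) / 2)%R)
    by (eapply Rlt_le_trans; [apply H|apply Rmin_r]).
  assert (Hy0 : (m / 2 < Cmod (f y))%R).
  { assert (m <= Cmod (f y) + Cmod (f y - f x))%R; [|lra].
    unfold m. replace (f x) with (f y + - (f y - f x)) at 1 by ring.
    eapply Rle_trans; [apply Cmod_triangle|]. rewrite Cmod_opp. lra. }
  assert (Hfy : f y <> 0) by (apply Cmod_gt_0; lra).
  replace (/ f y - / f x) with (- (f y - f x) * / (f y * f x)) by (field; auto).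
  rewrite Cmod_mult, Cmod_opp, Cmod_inv, Cmod_mult by (now apply Cmult_neq_0).
  fold m. assert (Hp : (m * m / 2 < Cmod (f y) * m)%R) by nra.
  apply (Rmult_lt_reg_r (Cmod (f y) * m)); [nra|].
  rewrite Rmult_assoc, Rinv_l, Rmult_1_r by nra. nra.
Qed.

Lemma ccont_div f g x : ccont f x -> ccont g x -> g x <> 0 -> ccont (fun y => f y / g y) x.
Proof. intros Hf Hg H. apply ccont_mult; [assumption|now apply ccont_inv]. Qed.

Lemma ccont_poch g x k : ccont g x -> ccont (fun y => poch (g y) k) x.
Proof.
  intros H. induction k as [|k IH]; simpl.
  - apply ccont_const.
  - apply ccont_mult; [assumption|]. apply ccont_plus; [assumption|apply ccont_const].
Qed.

Lemma ccont_Csum (f : C -> nat -> C) x n :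
  (forall i, ccont (fun y => f y i) x) -> ccont (fun y => Csum (f y) n) x.
Proof.
  intros H. induction n as [|n IH]; simpl.
  - apply ccont_const.
  - now apply ccont_plus.
Qed.

Lemma ccont_eq f g x d : ccont f x -> ccont g x -> (0 < d)%R ->
  (forall y, y <> x -> (Cmod (y - x) < d)%R -> f y = g y) -> f x = g x.
Proof.
  intros Hf Hg Hd H. destruct (Ceq_dec (f x) (g x)) as [|Hne]; trivial. exfalso.
  assert (Hpos : (0 < Cmod (f x - g x))%R).
  { apply Cmod_gt_0. intros E. apply Hne.
    transitivity (f x - g x + g x); [ring|rewrite E; ring]. }
  set (e := Cmod (f x - g x)) in *.
  destruct (Hf (e / 2)%R ltac:(lra)) as [d1 [Hd1 H1]].
  destruct (Hg (e / 2)%R ltac:(lra)) as [d2 [Hd2 H2]].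
  set (r := (Rmin d (Rmin d1 d2) / 2)%R).
  assert (Hr : (0 < Rmin d (Rmin d1 d2))%R) by (repeat apply Rmin_pos; assumption).
  assert (Hy : Cmod (x + r - x) = r).
  { replace (x + r - x) with (RtoC r) by ring. rewrite Cmod_R, Rabs_pos_eq; trivial.
    unfold r. lra. }
  pose proof (Rmin_l d (Rmin d1 d2)). pose proof (Rmin_r d (Rmin d1 d2)).
  pose proof (Rmin_l d1 d2). pose proof (Rmin_r d1 d2).
  assert (Heq : f (x + r) = g (x + r)).
  { apply H.
    - intros E. assert (E0 : RtoC r = 0).
      { transitivity (x + r - x); [ring|rewrite E; ring]. }
      apply RtoC_inj in E0. unfold r in E0. lra.
    - rewrite Hy. unfold r. lra. }
  specialize (H1 (x + r)). specialize (H2 (x + r)). rewrite Hy in H1, H2.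
  specialize (H1 ltac:(unfold r; lra)). specialize (H2 ltac:(unfold r; lra)).
  assert (e < e)%R; [|lra].
  unfold e at 1. replace (f x - g x) with (- (f (x + r) - f x) + (g (x + r) - g x))
    by (rewrite Heq; ring).
  eapply Rle_lt_trans; [apply Cmod_triangle|]. rewrite Cmod_opp. lra.
Qed.

Lemma C_ball_Cmod (x y : C) (eps : posreal) : (Cmod (y - x) < eps)%R -> ball x eps y.
Proof. apply (C_NormedModule_mixin_compat1 x y eps). Qed.

(** Balls of [C] are squares in the two coordinates; half the radius is enough because
    $\sqrt2\le2$. *)
Lemma C_Cmod_ball (x y : C) (eps : R) (H : (0 < eps)%R) :
  ball x (eps / 2)%R y -> (Cmod (y - x) < eps)%R.
Proof.
  intros Hb. assert (He : (0 < eps / 2)%R) by lra.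
  eapply Rlt_le_trans; [apply (C_NormedModule_mixin_compat2 x y (mkposreal _ He)); exact Hb|].
  simpl. assert (sqrt 2 <= 2)%R; [|nra].
  rewrite <- (sqrt_Rsqr 2) at 2 by lra. apply sqrt_le_1_alt. unfold Rsqr. lra.
Qed.

Lemma locally_Cmod (x : C) (d : R) (P : C -> Prop) : (0 < d)%R ->
  (forall y, (Cmod (y - x) < d)%R -> P y) -> locally x P.
Proof.
  intros Hd H. assert (Hd2 : (0 < d / 2)%R) by lra.
  exists (mkposreal _ Hd2). intros y Hy. apply H. now apply C_Cmod_ball.
Qed.

Lemma ccont_filterlim f g x d : ccont g x -> (0 < d)%R ->
  (forall y, y <> x -> (Cmod (y - x) < d)%R -> f y = g y) ->
  filterlim f (locally' x) (locally (g x)).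
Proof.
  intros Hg Hd H P [eps HP].
  destruct (Hg eps (cond_pos eps)) as [d1 [Hd1 H1]].
  unfold filtermap, locally', within.
  apply (locally_Cmod x (Rmin d d1)); [now apply Rmin_pos|].
  intros y Hy Hne. rewrite H; trivial.
  - apply HP, C_ball_Cmod, H1. eapply Rlt_le_trans; [apply Hy|apply Rmin_r].
  - eapply Rlt_le_trans; [apply Hy|apply Rmin_l].
Qed.

(** * The degenerate case of the Clausen-type identity *)

Lemma C_int_gap (k l : nat) : RtoC (INR k) <> INR l -> (1 <= Cmod (INR k - INR l))%R.
Proof.
  intros H. rewrite <- RtoC_minus, Cmod_R.
  assert (Hne : k <> l) by (intros ->; now apply H).
  destruct (Nat.lt_total k l) as [Hk|[Hk|Hk]]; [|easy|].
  - apply le_INR in Hk. rewrite S_INR in Hk. rewrite Rabs_left1; lra.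
  - apply le_INR in Hk. rewrite S_INR in Hk. rewrite Rabs_pos_eq; lra.
Qed.

Lemma C_half_int_gap (k l : nat) : (1 / 2 <= Cmod (INR k - INR l + 1 / 2))%R.
Proof.
  replace (INR k - INR l + 1 / 2) with (RtoC (INR k - INR l + 1 / 2)%R).
  - rewrite Cmod_R. destruct (Nat.le_gt_cases l k) as [Hk|Hk].
    + apply le_INR in Hk. rewrite Rabs_pos_eq; lra.
    + apply le_INR in Hk. rewrite S_INR in Hk. rewrite Rabs_left1; lra.
  - rewrite RtoC_plus, RtoC_minus, RtoC_div; [reflexivity|lra].
Qed.

(** A nonzero displacement of modulus below $1/2$ moves an integer neither to an integer nor to a
    half-integer, so a punctured disc around $b$ consists of generic parameters. *)
Lemma degenerate_nearby a b n y : nonpos_int (a + b + INR n) ->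
  y <> b -> (Cmod (y - b) < 1 / 2)%R ->
  ~ nonpos_int (a + y + 1 / 2) /\ ~ nonpos_int (a + y + INR n).
Proof.
  intros [m Hm] Hne Hy. split; intros [k Hk].
  - apply (Rlt_not_le _ _ Hy).
    replace (y - b) with (- (INR k - INR (m + n) + 1 / 2)).
    + rewrite Cmod_opp. apply C_half_int_gap.
    + rewrite C_INR_plus.
      transitivity ((a + y + 1 / 2) - (a + b + INR n) + INR n - 1 / 2); [rewrite Hk, Hm|]; ring.
  - assert (E : y - b = INR m - INR k).
    { transitivity ((a + y + INR n) - (a + b + INR n)); [ring|rewrite Hk, Hm; ring]. }
    assert (1 <= Cmod (y - b))%R; [|lra]. rewrite E. apply C_int_gap.
    intros E'. apply Hne. transitivity (y - b + b); [ring|rewrite E, E'; ring].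
Qed.

Lemma not_nonpos_shift a b n : ~ nonpos_int (a + b + 1 / 2) ->
  ~ nonpos_int (a + b + INR n + 1 / 2).
Proof.
  intros H. replace (a + b + INR n + 1 / 2) with (a + b + 1 / 2 + INR n) by ring.
  now apply not_nonpos_int_plus.
Qed.

Ltac ccont_tac :=
  repeat first
    [ apply ccont_const | apply ccont_id | apply ccont_plus | apply ccont_mult
    | apply ccont_poch ].

Lemma ccont_Kterm a b N : ~ nonpos_int (a + b + 1 / 2) -> ccont (fun y => Kterm a y N) b.
Proof.
  intros H. unfold Kterm. apply ccont_div; [ccont_tac|ccont_tac|].
  now apply poch_neq0_nonpos.
Qed.

Lemma ccont_uhat a b n i : ~ nonpos_int (a + b + 1 / 2) ->
  ccont (fun y => uhat (a + y + INR n) i) b.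
Proof.
  intros H. unfold uhat. apply ccont_div; [ccont_tac|ccont_tac|].
  repeat apply Cmult_neq_0; auto using two_pow_neq0, C_INR_fact_neq0.
  apply poch_neq0_nonpos. now apply not_nonpos_shift.
Qed.

Lemma ccont_hyper a b n k : ~ nonpos_int (a + b + 1 / 2) ->
  ccont (fun y => hyper a y (a + y + INR n + 1 / 2) k) b.
Proof.
  intros H. unfold hyper. apply ccont_div; [ccont_tac|ccont_tac|].
  apply Cmult_neq_0; auto using C_INR_fact_neq0.
  apply poch_neq0_nonpos. now apply not_nonpos_shift.
Qed.

Lemma formal_clausen a b n k : ~ nonpos_int (a + b + 1 / 2) ->
  poch (a + 1 / 2) n * poch (b + 1 / 2) n *
    fps_mul (hyper a b (a + b + INR n + 1 / 2)) (hyper a b (a + b + INR n + 1 / 2)) k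
  = poch (1 / 2) n * poch (a + b + 1 / 2) n *
    Csum (fun i => Csum (fun j => f211 a b n i j k) (S n)) (S k).
Proof.
  intros H. destruct (Classical_Prop.classic (nonpos_int (a + b + INR n))) as [Hd|Hd];
    [|now apply formal_clausen_generic].
  apply (ccont_eq
    (fun y => poch (a + 1 / 2) n * poch (y + 1 / 2) n *
      fps_mul (hyper a y (a + y + INR n + 1 / 2)) (hyper a y (a + y + INR n + 1 / 2)) k)
    (fun y => poch (1 / 2) n * poch (a + y + 1 / 2) n *
      Csum (fun i => Csum (fun j => f211 a y n i j k) (S n)) (S k)) b (1 / 2)).
  - apply ccont_mult; [ccont_tac|]. unfold fps_mul.
    apply (ccont_Csum (fun y i => hyper a y (a + y + INR n + 1 / 2) i
      * hyper a y (a + y + INR n + 1 / 2) (k - i)%nat)).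
    intros i. apply ccont_mult; now apply ccont_hyper.
  - apply ccont_mult; [ccont_tac|].
    apply (ccont_Csum (fun y i => Csum (fun j => f211 a y n i j k) (S n))). intros i.
    apply (ccont_Csum (fun y j => f211 a y n i j k)). intros j. unfold f211.
    do 2 (apply ccont_mult; [|apply ccont_const]). apply ccont_mult.
    + now apply ccont_Kterm.
    + now apply ccont_uhat.
  - lra.
  - intros y Hne Hy. destruct (degenerate_nearby a b n y Hd Hne Hy).
    now apply formal_clausen_generic.
Qed.

(** The coefficient of $z^i(1-z)^j$ in cancelled form: continuous in $b$, it is the term-wise limit
    at degenerate parameters. *)
Definition clausen_coef (a b : C) (n i j : nat) : C :=
  Kterm a b (i + j) * uhat (a + b + INR n) i * vterm n j.

Lemma clausen_term_eq a b n z i j :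
  ~ nonpos_int (a + b + 1 / 2) -> ~ nonpos_int (a + b + INR n) -> (j <= n)%nat ->
  clausen_term a b n z i j = clausen_coef a b n i j * (z ^ i * (1 - z) ^ j).
Proof.
  intros H1 H2 Hj. unfold clausen_term, F211_term, clausen_coef.
  rewrite uhat_eq by (trivial; now apply not_nonpos_shift).
  unfold Kterm, vterm.
  replace (2 * a + 2 * b + 2 * INR n) with (2 * (a + b + INR n)) by ring.
  assert (N1 : poch (a + b + 1 / 2) (i + j) <> 0) by now apply poch_neq0_nonpos.
  assert (N2 : poch (2 * (a + b + INR n)) i <> 0).
  { rewrite poch_two_mul. repeat apply Cmult_neq_0;
      auto using two_pow_neq0, poch_neq0_nonpos, not_nonpos_shift. }
  assert (N3 : poch (- (2 * INR n)) j <> 0) by (apply poch_opp_two_INR_neq0; lia).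
  revert N1 N2 N3.
  generalize (poch (a + b + 1 / 2) (i + j)) (poch (2 * (a + b + INR n)) i)
    (poch (- (2 * INR n)) j).
  intros x1 x2 x3 N1 N2 N3. field. repeat split; auto using C_INR_fact_neq0.
Qed.

Lemma is_clausen_term_coef a b n z i j :
  ~ nonpos_int (a + b + 1 / 2) -> (j <= n)%nat ->
  is_clausen_term a b n z i j (clausen_coef a b n i j * (z ^ i * (1 - z) ^ j)).
Proof.
  intros H Hj. split.
  - intros H'. symmetry. now apply clausen_term_eq.
  - intros Hd. apply (ccont_filterlim _
      (fun y => clausen_coef a y n i j * (z ^ i * (1 - z) ^ j)) b (1 / 2)).
    + apply ccont_mult; [|apply ccont_const]. unfold clausen_coef.
      apply ccont_mult; [|apply ccont_const]. apply ccont_mult.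
      * now apply ccont_Kterm.
      * now apply ccont_uhat.
    + lra.
    + intros y Hne Hy. destruct (degenerate_nearby a b n y Hd Hne Hy).
      now apply clausen_term_eq.
Qed.


(** * Geometrically dominated series *)

(** Convergence of series measured by the modulus. [Csum f n] stops before index $n$, unlike
    [sum_n f n], hence the shifts by one in the passage to and from [is_series]. *)
Definition conv (f : nat -> C) (s : C) : Prop :=
  forall eps, (0 < eps)%R -> exists N, forall n, (N <= n)%nat -> (Cmod (Csum f n - s) < eps)%R.

Lemma conv_is_series f s : conv f s -> is_series f s.
Proof.
  intros H P [eps HP]. destruct (H eps (cond_pos eps)) as [N HN].
  exists N. intros n Hn. apply HP, C_ball_Cmod. rewrite sum_n_Csum. apply HN. lia.
Qed.

Lemma is_series_conv f s : is_series f s -> conv f s.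
Proof.
  intros H eps He.
  assert (He2 : (0 < eps / 2)%R) by lra.
  destruct (H (fun y => ball s (eps / 2)%R y)) as [N HN].
  { exists (mkposreal _ He2). intros y Hy. exact Hy. }
  exists (S N). intros [|n] Hn; [lia|]. rewrite <- sum_n_Csum.
  apply C_Cmod_ball; trivial. apply HN. lia.
Qed.

Lemma conv_unique f s t : conv f s -> conv f t -> s = t.
Proof.
  intros Hs Ht. destruct (Ceq_dec s t) as [|Hne]; trivial. exfalso.
  assert (Hpos : (0 < Cmod (s - t))%R).
  { apply Cmod_gt_0. intros E. apply Hne.
    transitivity (s - t + t); [ring|rewrite E; ring]. }
  destruct (Hs (Cmod (s - t) / 2)%R ltac:(lra)) as [N1 H1].
  destruct (Ht (Cmod (s - t) / 2)%R ltac:(lra)) as [N2 H2].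
  specialize (H1 (N1 + N2)%nat ltac:(lia)). specialize (H2 (N1 + N2)%nat ltac:(lia)).
  assert (Cmod (s - t) < Cmod (s - t))%R; [|lra].
  replace (s - t) with (- (Csum f (N1 + N2) - s) + (Csum f (N1 + N2) - t)) at 1 by ring.
  eapply Rle_lt_trans; [apply Cmod_triangle|]. rewrite Cmod_opp. lra.
Qed.

Lemma conv_ext f g s : (forall k, f k = g k) -> conv f s -> conv g s.
Proof.
  intros E H eps He. destruct (H eps He) as [N HN]. exists N. intros n Hn.
  rewrite <- (Csum_ext f g n E). auto.
Qed.

Lemma conv_plus f g s t : conv f s -> conv g t -> conv (fun k => f k + g k) (s + t).
Proof.
  intros Hf Hg eps He.
  destruct (Hf (eps / 2)%R ltac:(lra)) as [N1 H1].
  destruct (Hg (eps / 2)%R ltac:(lra)) as [N2 H2].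
  exists (N1 + N2)%nat. intros n Hn.
  specialize (H1 n ltac:(lia)). specialize (H2 n ltac:(lia)).
  rewrite Csum_plus.
  replace (Csum f n + Csum g n - (s + t)) with ((Csum f n - s) + (Csum g n - t)) by ring.
  eapply Rle_lt_trans; [apply Cmod_triangle|lra].
Qed.

Lemma conv_scal c f s : conv f s -> conv (fun k => c * f k) (c * s).
Proof.
  intros Hf eps He. pose proof (Cmod_ge_0 c) as Hc.
  destruct (Hf (eps / (1 + Cmod c))%R) as [N HN]; [apply Rdiv_lt_0_compat; lra|].
  exists N. intros n Hn. specialize (HN n Hn). rewrite Csum_scal.
  replace (c * Csum f n - c * s) with (c * (Csum f n - s)) by ring.
  rewrite Cmod_mult. pose proof (Cmod_ge_0 (Csum f n - s)).
  assert (E : ((1 + Cmod c) * (eps / (1 + Cmod c)) = eps)%R) by (field; lra).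
  nra.
Qed.

Lemma conv_shift f s : conv f s -> conv (fps_shift f) s.
Proof.
  intros H eps He. destruct (H eps He) as [N HN]. exists (S N).
  intros [|n] Hn; [lia|]. rewrite Csum_S_l. cbn [fps_shift].
  rewrite Cplus_0_l. apply HN. lia.
Qed.

Lemma conv_Csum (f : nat -> nat -> C) (s : nat -> C) n :
  (forall j, (j < n)%nat -> conv (f j) (s j)) ->
  conv (fun k => Csum (fun j => f j k) n) (Csum s n).
Proof.
  intros H. induction n as [|n IH]; simpl.
  - intros eps He. exists O. intros m _. rewrite Csum_0 by trivial.
    replace (0 - 0) with (RtoC 0) by ring. now rewrite Cmod_0.
  - apply (conv_plus (fun k => Csum (fun j => f j k) n) (f n)); auto with arith.
Qed.

Lemma Cmod_Csum_le f (g : R) n : (forall i, (i < n)%nat -> Cmod (f i) <= g)%R ->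
  (Cmod (Csum f n) <= INR n * g)%R.
Proof.
  induction n as [|n IH]; intros H.
  - simpl. rewrite Cmod_0. lra.
  - simpl Csum. rewrite S_INR. eapply Rle_trans; [apply Cmod_triangle|].
    pose proof (H n ltac:(lia)). pose proof (IH ltac:(auto with arith)). lra.
Qed.

Lemma Csum_geom_le f M r n p : (0 <= r < 1)%R -> (0 <= M)%R ->
  (forall k, Cmod (f k) <= M * r ^ k)%R ->
  (Cmod (Csum f (n + p) - Csum f n) <= M * r ^ n * (1 - r ^ p) / (1 - r))%R.
Proof.
  intros Hr HM H. induction p as [|p IH].
  - rewrite Nat.add_0_r. replace (Csum f n - Csum f n) with (RtoC 0) by ring.
    rewrite Cmod_0. simpl. unfold Rdiv. rewrite Rminus_diag, Rmult_0_r, Rmult_0_l. lra.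
  - rewrite Nat.add_succ_r. simpl Csum.
    replace (Csum f (n + p) + f (n + p)%nat - Csum f n)
      with ((Csum f (n + p) - Csum f n) + f (n + p)%nat) by ring.
    eapply Rle_trans; [apply Cmod_triangle|].
    specialize (H (n + p)%nat). rewrite pow_add in H.
    replace (M * r ^ n * (1 - r ^ S p) / (1 - r))%R
      with (M * r ^ n * (1 - r ^ p) / (1 - r) + M * (r ^ n * r ^ p))%R
      by (simpl; field; lra). lra.
Qed.

Lemma conv_geom f M r : (0 <= r < 1)%R -> (0 <= M)%R ->
  (forall k, Cmod (f k) <= M * r ^ k)%R -> exists s, conv f s.
Proof.
  intros Hr HM H.
  assert (Hex : ex_series (f : nat -> C_CompleteNormedModule)).
  { apply (@ex_series_le C_AbsRing C_CompleteNormedModule f (fun k => M * r ^ k)%R).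
    - intros k. exact (H k).
    - apply (@ex_series_scal R_AbsRing R_NormedModule M (fun k => r ^ k)%R).
      apply ex_series_geom. rewrite Rabs_pos_eq; lra. }
  destruct Hex as [s Hs]. exists s. now apply is_series_conv.
Qed.

Lemma conv_tail f M r s n : (0 <= r < 1)%R -> (0 <= M)%R ->
  (forall k, Cmod (f k) <= M * r ^ k)%R -> conv f s ->
  (Cmod (s - Csum f n) <= M * r ^ n / (1 - r))%R.
Proof.
  intros Hr HM H Hs. apply le_epsilon. intros eps He.
  destruct (Hs eps He) as [N HN]. specialize (HN (n + N)%nat ltac:(lia)).
  pose proof (Csum_geom_le f M r n N Hr HM H) as Hg.
  replace (s - Csum f n) with (- (Csum f (n + N) - s) + (Csum f (n + N) - Csum f n)) by ring.
  eapply Rle_trans; [apply Cmod_triangle|]. rewrite Cmod_opp.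
  assert (M * r ^ n * (1 - r ^ N) / (1 - r) <= M * r ^ n / (1 - r))%R; [|lra].
  unfold Rdiv. apply Rmult_le_compat_r; [left; apply Rinv_0_lt_compat; lra|].
  pose proof (pow_le r n ltac:(lra)). pose proof (pow_le r N ltac:(lra)).
  assert (0 <= M * r ^ n * r ^ N)%R by (repeat apply Rmult_le_pos; trivial). lra.
Qed.

Lemma INR_le_pow2 n : (INR n <= 2 ^ n)%R.
Proof.
  induction n as [|n IH]; [simpl; lra|]. rewrite S_INR. simpl.
  assert (1 <= 2 ^ n)%R by (apply pow_R1_Rle; lra). lra.
Qed.

Lemma INR_S_le_pow2 n : (INR (S n) <= 2 ^ n)%R.
Proof.
  induction n as [|n IH]; [simpl; lra|]. rewrite S_INR. simpl pow.
  assert (1 <= 2 ^ n)%R by (apply pow_R1_Rle; lra). lra.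
Qed.

Definition diag (g : nat -> nat -> C) : nat -> C :=
  fun k => Csum (fun i => g i (k - i)%nat) (S k).

Lemma diag_bound g M r k : (0 <= r)%R -> (0 <= M)%R ->
  (forall i j, Cmod (g i j) <= M * r ^ (i + j))%R -> (Cmod (diag g k) <= M * (2 * r) ^ k)%R.
Proof.
  intros Hr HM H. unfold diag.
  eapply Rle_trans; [apply (Cmod_Csum_le _ (M * r ^ k)%R)|].
  - intros i Hi. replace k with (i + (k - i))%nat at 2 by lia. apply H.
  - rewrite Rpow_mult_distr. replace (M * (2 ^ k * r ^ k))%R with (2 ^ k * (M * r ^ k))%R by ring.
    apply Rmult_le_compat_r; [|apply INR_S_le_pow2].
    apply Rmult_le_pos; [|apply pow_le]; assumption.
Qed.

(** The first $n$ diagonals truncate row $i$ at $n-i$, which costs at most $Mr^n/(1-r)\le2Mr^n$.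
    There are $n\le2^n$ such rows, and the total error $2M(2r)^n$ tends to zero because $r<1/2$. *)
Lemma conv_iterated g M r v s : (0 <= r < 1 / 2)%R -> (0 <= M)%R ->
  (forall i j, Cmod (g i j) <= M * r ^ (i + j))%R ->
  (forall i, conv (g i) (v i)) -> conv (diag g) s -> conv v s.
Proof.
  intros Hr HM H Hv Hs eps He.
  destruct (Hs (eps / 2)%R ltac:(lra)) as [N1 H1].
  assert (Hlim : exists N2, forall n, (N2 <= n)%nat -> (2 * M * (2 * r) ^ n < eps / 2)%R).
  { destruct (pow_lt_1_zero (2 * r)%R) with (y := (eps / (4 * (M + 1)))%R) as [N2 HN2].
    - rewrite Rabs_pos_eq; lra.
    - apply Rdiv_lt_0_compat; lra.
    - exists N2. intros n Hn. specialize (HN2 n Hn).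
      rewrite Rabs_pos_eq in HN2 by (apply pow_le; lra).
      assert (E : (4 * (M + 1) * (eps / (4 * (M + 1))) = eps)%R) by (field; lra).
      pose proof (pow_le (2 * r) n ltac:(lra)). nra. }
  destruct Hlim as [N2 H2]. exists (N1 + N2)%nat. intros n Hn.
  specialize (H1 n ltac:(lia)). specialize (H2 n ltac:(lia)).
  unfold diag in H1. rewrite Csum_triangle in H1.
  replace (Csum v n - s) with
    (Csum (fun i => v i - Csum (g i) (n - i)) n
     + (Csum (fun i => Csum (g i) (n - i)) n - s)).
  - eapply Rle_lt_trans; [apply Cmod_triangle|].
    assert (Cmod (Csum (fun i => (v i - Csum (g i) (n - i))%C) n) <= 2 * M * (2 * r) ^ n)%R; [|lra].
    eapply Rle_trans; [apply (Cmod_Csum_le _ (2 * M * r ^ n)%R)|].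
    + intros i Hi.
      eapply Rle_trans; [apply (conv_tail (g i) (M * r ^ i) r)|].
      * lra.
      * pose proof (pow_le r i ltac:(lra)). nra.
      * intros k. rewrite Rmult_assoc, <- pow_add. apply H.
      * apply Hv.
      * rewrite Rmult_assoc, <- pow_add. replace (i + (n - i))%nat with n by lia.
        apply Rle_div_l; [lra|]. pose proof (pow_le r n ltac:(lra)).
        assert (0 <= M * r ^ n)%R by nra. nra.
    + rewrite Rpow_mult_distr.
      replace (2 * M * (2 ^ n * r ^ n))%R with (2 ^ n * (2 * M * r ^ n))%R by ring.
      apply Rmult_le_compat_r; [|apply INR_le_pow2].
      apply Rmult_le_pos; [lra|apply pow_le; lra].
  - rewrite (Csum_ext (fun i => v i - Csum (g i) (n - i))
      (fun i => v i + - Csum (g i) (n - i))) by (intros; ring).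
    rewrite Csum_plus, Csum_opp. ring.
Qed.

(** The Cauchy product is the diagonal sum of $f_iz^i\,g_jz^j$, whose iterated sum is $st$. *)
Lemma conv_fps_mul f g z r s t : (0 <= r < 1 / 2)%R ->
  (forall k, Cmod (f k * z ^ k) <= r ^ k)%R -> (forall k, Cmod (g k * z ^ k) <= r ^ k)%R ->
  conv (fun k => f k * z ^ k) s -> conv (fun k => g k * z ^ k) t ->
  conv (fun k => fps_mul f g k * z ^ k) (s * t).
Proof.
  intros Hr Hf Hg Hs Ht.
  pose (G := fun i j => (f i * z ^ i) * (g j * z ^ j)).
  assert (HG : (forall i j, Cmod (G i j) <= 1 * r ^ (i + j))%R).
  { intros i j. unfold G. rewrite Cmod_mult, Rmult_1_l, pow_add.
    apply Rmult_le_compat; auto using Cmod_ge_0. }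
  destruct (conv_geom (diag G) 1 (2 * r)) as [D HD].
  - lra.
  - lra.
  - intros k. apply diag_bound; trivial; lra.
  - assert (HD' : conv (fun i => f i * z ^ i * t) D).
    { apply (conv_iterated G 1 r); trivial; try lra. intros i. unfold G. now apply conv_scal. }
    assert (E : D = s * t).
    { apply (conv_unique (fun i => f i * z ^ i * t)); trivial. rewrite Cmult_comm.
      apply (conv_ext (fun i => t * (f i * z ^ i))); [intros; ring|now apply conv_scal]. }
    rewrite <- E. apply (conv_ext (diag G)); trivial.
    intros k. unfold diag, G, fps_mul. rewrite <- Csum_scal_r.
    apply Csum_ext_lt. intros i Hi.
    replace (z ^ k) with (z ^ i * z ^ (k - i)); [ring|].
    rewrite <- Cpow_add_r. f_equal. lia.
Qed.

(** * Growth of Pochhammer symbols *)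

Lemma Cmod_poch_le a : exists R, (1 <= R)%R /\
  forall k, (Cmod (poch a k) <= R ^ k * INR (fact k))%R.
Proof.
  exists (1 + Cmod a)%R. pose proof (Cmod_ge_0 a) as Ha. split; [lra|].
  induction k as [|k IH].
  - simpl. rewrite Cmod_1. lra.
  - cbn [poch pow]. rewrite Cmod_mult, fact_simpl, mult_INR, S_INR.
    assert (Hk : (Cmod (a + INR k) <= Cmod a + INR k)%R).
    { eapply Rle_trans; [apply Cmod_triangle|]. rewrite Cmod_R, Rabs_pos_eq; [lra|apply pos_INR]. }
    replace ((1 + Cmod a) * (1 + Cmod a) ^ k * ((INR k + 1) * INR (fact k)))%R
      with ((1 + Cmod a) ^ k * INR (fact k) * ((1 + Cmod a) * (INR k + 1)))%R by ring.
    apply Rmult_le_compat; auto using Cmod_ge_0.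
    pose proof (pos_INR k). nra.
Qed.

(** It suffices that $k+1\le R\,|c+k|$ for all $k$. Finitely many $k$ are covered by enlarging $R$,
    each factor being nonzero. *)
Lemma Cmod_poch_ge c : ~ nonpos_int c -> exists R, (1 <= R)%R /\
  forall k, (INR (fact k) <= R ^ k * Cmod (poch c k))%R.
Proof.
  intros Hc.
  assert (Hfin : forall N, exists R, (1 <= R)%R /\
    forall k, (k < N)%nat -> (INR k + 1 <= R * Cmod (c + INR k))%R).
  { induction N as [|N [R [HR H]]].
    - exists 1%R. split; [lra|]. intros; lia.
    - pose proof (not_nonpos_int_add c N Hc) as HN. apply Cmod_gt_0 in HN.
      exists (R + (INR N + 1) / Cmod (c + INR N))%R.
      assert (Hp : (0 <= (INR N + 1) / Cmod (c + INR N))%R).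
      { apply Rdiv_le_0_compat; trivial. pose proof (pos_INR N). lra. }
      split; [lra|]. intros k Hk. destruct (Nat.eq_dec k N) as [->|Hne].
      + rewrite Rmult_plus_distr_r. unfold Rdiv at 1.
        rewrite Rmult_assoc, Rinv_l by lra. nra.
      + specialize (H k ltac:(lia)). pose proof (Cmod_ge_0 (c + INR k)). nra. }
  (* Beyond this bound $|c+k|\ge k-|c|\ge(k+1)/2$. *)
  destruct (INR_unbounded (2 * Cmod c + 1)) as [N HN].
  destruct (Hfin N) as [R [HR H]]. exists (R + 2)%R. split; [lra|].
  assert (Hall : forall k, (INR k + 1 <= (R + 2) * Cmod (c + INR k))%R).
  { intros k. pose proof (Cmod_ge_0 (c + INR k)) as Hge.
    destruct (Nat.lt_ge_cases k N) as [Hk|Hk].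
    - specialize (H k Hk). nra.
    - apply le_INR in Hk.
      assert (Hk2 : (INR k - Cmod c <= Cmod (c + INR k))%R).
      { assert (INR k <= Cmod (c + INR k) + Cmod c)%R; [|lra].
        rewrite <- (Rabs_pos_eq (INR k)) at 1 by apply pos_INR. rewrite <- Cmod_R.
        replace (RtoC (INR k)) with ((c + INR k) + - c) at 1 by ring.
        eapply Rle_trans; [apply Cmod_triangle|]. rewrite Cmod_opp. lra. }
      nra. }
  induction k as [|k IH].
  - simpl. rewrite Cmod_1. lra.
  - cbn [poch pow]. rewrite Cmod_mult, fact_simpl, mult_INR, S_INR.
    replace ((R + 2) * (R + 2) ^ k * (Cmod (poch c k) * Cmod (c + INR k)))%R
      with (((R + 2) * Cmod (c + INR k)) * ((R + 2) ^ k * Cmod (poch c k)))%R by ring.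
    apply Rmult_le_compat; trivial; try apply pos_INR. pose proof (pos_INR k). lra.
Qed.

Lemma Rdiv_le_of_le (x y w : R) : (0 < y)%R -> (x <= w * y)%R -> (x / y <= w)%R.
Proof. intros Hy H. apply Rle_div_l; trivial. Qed.

Lemma Cmod_hyper_le a b c : ~ nonpos_int c -> exists R, (1 <= R)%R /\
  forall k, (Cmod (hyper a b c k) <= R ^ k)%R.
Proof.
  intros Hc.
  destruct (Cmod_poch_le a) as [Ra [HRa Ha]]. destruct (Cmod_poch_le b) as [Rb [HRb Hb]].
  destruct (Cmod_poch_ge c Hc) as [Rc [HRc Hcc]].
  exists (Ra * Rb * Rc)%R. split; [assert (1 <= Ra * Rb)%R by nra; nra|]. intros k. unfold hyper.
  pose proof (poch_neq0_nonpos c k Hc) as N1. pose proof (C_INR_fact_neq0 k) as N2.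
  assert (N3 : poch c k * INR (fact k) <> 0) by now apply Cmult_neq_0.
  rewrite Cmod_div by assumption. apply Rdiv_le_of_le; [now apply Cmod_gt_0|].
  rewrite !Cmod_mult, !Rpow_mult_distr, Cmod_R, Rabs_pos_eq by apply pos_INR.
  specialize (Ha k). specialize (Hb k). specialize (Hcc k).
  pose proof (INR_fact_lt_0 k) as Hf. set (F := INR (fact k)) in *.
  pose proof (pow_lt Ra k ltac:(lra)). pose proof (pow_lt Rb k ltac:(lra)).
  eapply Rle_trans; [apply Rmult_le_compat; [apply Cmod_ge_0|apply Cmod_ge_0|exact Ha|exact Hb]|].
  replace (Ra ^ k * Rb ^ k * Rc ^ k * (Cmod (poch c k) * F))%R
    with ((Ra ^ k * Rb ^ k * F) * (Rc ^ k * Cmod (poch c k)))%R by ring.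
  replace (Ra ^ k * F * (Rb ^ k * F))%R with ((Ra ^ k * Rb ^ k * F) * F)%R by ring.
  apply Rmult_le_compat_l; trivial.
  apply Rmult_le_pos; [|lra]. apply Rmult_le_pos; lra.
Qed.


(** * The binomial series *)

Lemma binser_S q l : binser q (S l) = binser (q + 1) (S l) + binser q l.
Proof.
  pose proof (mon_q1 0 q (S l)) as H.
  change (binser (q + 1) (S l) = binser q (S l) - binser q l) in H. rewrite H. ring.
Qed.

Lemma binser_0 q : binser q 0%nat = 1.
Proof. unfold binser. simpl. field. Qed.

Lemma binser_succ q l : (INR l + 1) * binser q (S l) = (INR l - q) * binser q l.
Proof.
  unfold binser. cbn [poch]. rewrite C_INR_fact_S. field.
  split; [apply C_INR_fact_neq0|apply C_INR_S_neq0].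
Qed.

(** Double induction along Pascal's rule; for $m>0$ the coefficient is $\binom{m+l-1}{l}$. *)
Lemma Cmod_binser_opp_INR m l : (Cmod (binser (- INR m) l) <= 2 ^ (m + l))%R.
Proof.
  revert l. induction m as [|m IHm]; intros l.
  - destruct l as [|l].
    + rewrite binser_0, Cmod_1. simpl. lra.
    + assert (E : binser (- INR 0) (S l) = 0).
      { unfold binser. rewrite poch_S_l. simpl (INR 0). unfold Cdiv. ring. }
      rewrite E, Cmod_0. apply pow_le. lra.
  - induction l as [|l IHl].
    + rewrite binser_0, Cmod_1. apply pow_R1_Rle. lra.
    + rewrite binser_S. replace (- INR (S m) + 1) with (- INR m) by (rewrite C_INR_S; ring).
      eapply Rle_trans; [apply Cmod_triangle|].
      specialize (IHm (S l)). replace (S m + S l)%nat with (S (m + S l)) by lia.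
      replace (S m + l)%nat with (m + S l)%nat in IHl by lia. cbn [pow]. lra.
Qed.

Lemma Cmod_poch_mono x m l : (Cmod x <= INR m)%R ->
  (Cmod (poch x l) <= Cmod (poch (INR m) l))%R.
Proof.
  intros H. induction l as [|l IH]; simpl; [lra|]. rewrite !Cmod_mult.
  apply Rmult_le_compat; auto using Cmod_ge_0.
  eapply Rle_trans; [apply Cmod_triangle|].
  rewrite <- RtoC_plus, !Cmod_R, !Rabs_pos_eq; try apply pos_INR.
  - lra.
  - pose proof (pos_INR m). pose proof (pos_INR l). lra.
Qed.

(** Factorwise, $|(-q)_l|\le(m)_l$. The explicit dependence on $m$ matters because in (1) the
    exponent varies with $j$. *)
Lemma Cmod_binser_le q m l : (Cmod q <= INR m)%R -> (Cmod (binser q l) <= 2 ^ (m + l))%R.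
Proof.
  intros H. eapply Rle_trans; [|apply Cmod_binser_opp_INR].
  unfold binser. rewrite !Cmod_div by apply C_INR_fact_neq0.
  unfold Rdiv. apply Rmult_le_compat_r.
  - left. apply Rinv_0_lt_compat. apply Cmod_gt_0, C_INR_fact_neq0.
  - replace (- - INR m) with (RtoC (INR m)) by ring. apply Cmod_poch_mono.
    now rewrite Cmod_opp.
Qed.

(** * Derivatives of complex functions along a real segment *)

Definition cder (f : R -> C) (t : R) (d : C) : Prop :=
  is_derive (fun x => Re (f x)) t (Re d) /\ is_derive (fun x => Im (f x)) t (Im d).

Lemma is_derive_val (f : R -> R) t d d' : d = d' -> is_derive f t d -> is_derive f t d'.
Proof. now intros ->. Qed.

Lemma cder_mult f g t df dg : cder f t df -> cder g t dg ->
  cder (fun x => f x * g x) t (df * g t + f t * dg).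
Proof.
  intros [Hf1 Hf2] [Hg1 Hg2]. split; simpl.
  - eapply is_derive_val; [|apply (is_derive_minus (fun x => Re (f x) * Re (g x))%R
       (fun x => Im (f x) * Im (g x))%R)].
    2: apply (is_derive_mult (fun x => Re (f x)) (fun x => Re (g x))); eauto using Rmult_comm.
    2: apply (is_derive_mult (fun x => Im (f x)) (fun x => Im (g x))); eauto using Rmult_comm.
    unfold minus, plus, opp, mult, Re, Im; simpl; unfold mult; simpl. ring.
  - eapply is_derive_val; [|apply (is_derive_plus (fun x => Re (f x) * Im (g x))%R
       (fun x => Im (f x) * Re (g x))%R)].
    2: apply (is_derive_mult (fun x => Re (f x)) (fun x => Im (g x))); eauto using Rmult_comm.
    2: apply (is_derive_mult (fun x => Im (f x)) (fun x => Re (g x))); eauto using Rmult_comm.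
    unfold minus, plus, opp, mult, Re, Im; simpl; unfold mult; simpl. ring.
Qed.

Lemma cder_const c t : cder (fun _ => c) t 0.
Proof. split; apply @is_derive_const. Qed.

Lemma cder_scal c f t d : cder f t d -> cder (fun x => c * f x) t (c * d).
Proof.
  intros H. replace (c * d) with (0 * f t + c * d) by ring.
  apply (cder_mult (fun _ => c)); [apply cder_const|assumption].
Qed.

Lemma cder_Cexp w t d : cder w t d -> cder (fun x => Cexp (w x)) t (Cexp (w t) * d).
Proof.
  intros [H1 H2].
  assert (He : forall y, is_derive exp y (exp y)) by (intros; auto_derive; trivial; ring).
  assert (Hc : forall y, is_derive cos y (- sin y)%R) by (intros; auto_derive; trivial; ring).
  assert (Hs : forall y, is_derive sin y (cos y)) by (intros; auto_derive; trivial; ring).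
  pose proof (is_derive_comp exp _ t _ _ (He _) H1) as E1.
  pose proof (is_derive_comp cos _ t _ _ (Hc _) H2) as E2.
  pose proof (is_derive_comp sin _ t _ _ (Hs _) H2) as E3.
  split; simpl.
  - eapply is_derive_val; [|apply (is_derive_mult (fun x => exp (Re (w x)))
      (fun x => cos (Im (w x))) t _ _ E1 E2 Rmult_comm)].
    unfold plus, mult, scal; simpl; unfold mult; simpl. unfold Re, Im. ring.
  - eapply is_derive_val; [|apply (is_derive_mult (fun x => exp (Re (w x)))
      (fun x => sin (Im (w x))) t _ _ E1 E3 Rmult_comm)].
    unfold plus, mult, scal; simpl; unfold mult; simpl. unfold Re, Im. ring.
Qed.

Lemma ln_sqrt u : (0 < u)%R -> ln (sqrt u) = (ln u / 2)%R.
Proof.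
  intros H. pose proof (sqrt_lt_R0 u H) as Hs.
  rewrite <- (sqrt_sqrt u) at 2 by lra. rewrite ln_mult by assumption. lra.
Qed.

(** The segment from $1$ to $1-z$ stays in the half-plane of positive real part, where the formula
    for [Clog] is smooth. *)
Lemma cder_Clog_line (z : C) t : (Cmod z < 1)%R -> (0 <= t <= 1)%R ->
  cder (fun x : R => Clog (1 - x * z)) t (- z / (1 - t * z)).
Proof.
  intros Hz Ht. destruct z as [x y].
  assert (Hx : (Rabs x < 1)%R).
  { eapply Rle_lt_trans; [|exact Hz]. apply (re_le_Cmod (x, y)). }
  assert (Hpos : (0 < 1 - t * x)%R).
  { apply Rabs_def2 in Hx. destruct (Rle_lt_dec x 0); nra. }
  assert (Hu : (0 < (1 - t * x) ^ 2 + (t * y) ^ 2)%R).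
  { pose proof (pow2_ge_0 (t * y)). pose proof (pow_lt _ 2 Hpos). lra. }
  split.
  (* The square root in [Cmod] is taken out of the logarithm; this holds near $t$, where the real
     part remains positive. *)
  - apply (is_derive_ext_loc (fun s => ln ((1 - s * x) ^ 2 + (s * y) ^ 2) / 2)%R).
    + assert (Hc : continuous (fun s : R => (1 - s * x)%R) t).
      { apply (ex_derive_continuous (fun s : R => (1 - s * x)%R)). auto_derive. trivial. }
      specialize (Hc _ (open_gt 0 _ Hpos)). unfold filtermap in Hc.
      eapply filter_imp; [|exact Hc]. intros s Hs. simpl in Hs.
      unfold Clog, Re, Im. simpl fst. unfold Cmod. simpl fst. simpl snd.
      rewrite <- ln_sqrt.
      * do 2 f_equal. ring.
      * pose proof (pow2_ge_0 (s * y)). pose proof (pow_lt _ 2 Hs). lra.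
    + auto_derive; [lra|]. unfold Re; simpl. field.
      repeat split; nra.
  - unfold Clog, Im; simpl. auto_derive; [lra|]. field.
    repeat split; nra.
Qed.

Lemma cder_zero_eq f a b : (a < b)%R -> (forall t, (a <= t <= b)%R -> cder f t 0) -> f a = f b.
Proof.
  intros Hab H. apply injective_projections.
  - apply (eq_is_derive (fun x => Re (f x)) a b); trivial. intros t Ht. apply (H t Ht).
  - apply (eq_is_derive (fun x => Im (f x)) a b); trivial. intros t Ht. apply (H t Ht).
Qed.

Lemma is_pseries_parts (c : nat -> C) (t : R) s : conv (fun l => c l * t ^ l) s ->
  is_pseries (fun l => Re (c l)) t (Re s) /\ is_pseries (fun l => Im (c l)) t (Im s).
Proof.
  intros H.
  assert (E : forall n, sum_n (fun l => Re (c l) * t ^ l)%R n = Re (Csum (fun l => c l * t ^ l) (S n))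
     /\ sum_n (fun l => Im (c l) * t ^ l)%R n = Im (Csum (fun l => c l * t ^ l) (S n))).
  { assert (E0 : forall l, Re (c l * t ^ l) = (Re (c l) * t ^ l)%R
                           /\ Im (c l * t ^ l) = (Im (c l) * t ^ l)%R).
    { intros l. rewrite <- RtoC_pow. unfold Re, Im. simpl. split; ring. }
    induction n as [|n [IH1 IH2]].
    - rewrite !sum_O. simpl Csum. destruct (E0 O) as [E1 E2].
      rewrite <- E1, <- E2. unfold Re, Im; simpl. split; ring.
    - rewrite !sum_Sn, IH1, IH2. destruct (E0 (S n)) as [E1 E2].
      rewrite <- E1, <- E2. split; reflexivity. }
  rewrite !is_pseries_R. unfold is_series.
  split; apply (proj2 (filterlim_locally _ _)); intros eps; destruct (H eps (cond_pos eps)) as [N HN]; exists N; intros n Hn;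
    destruct (E n) as [E1 E2]; specialize (HN (S n) ltac:(lia));
    [change (Rabs (sum_n (fun l => Re (c l) * t ^ l)%R n - Re s) < eps)%R; rewrite E1
    |change (Rabs (sum_n (fun l => Im (c l) * t ^ l)%R n - Im s) < eps)%R; rewrite E2];
    (eapply Rle_lt_trans; [|exact HN]);
    set (w := Csum (fun l => c l * t ^ l) (S n)).
  - eapply Rle_trans; [|apply (Rle_trans _ _ _ (Rmax_l _ (Rabs (snd (w - s)))) (Rmax_Cmod (w - s)))].
    right. reflexivity.
  - eapply Rle_trans; [|apply (Rle_trans _ _ _ (Rmax_r (Rabs (fst (w - s))) _) (Rmax_Cmod (w - s)))].
    right. reflexivity.
Qed.

(** A total function of $t$ built from real power series, so that term-by-term differentiation is
    inherited from the real case. *)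
Definition cPS (c : nat -> C) (t : R) : C :=
  (PSeries (fun l => Re (c l)) t, PSeries (fun l => Im (c l)) t).

Lemma conv_cPS c M r t : (0 <= r < 1)%R -> (0 <= M)%R ->
  (forall l, Cmod (c l) <= M * r ^ l)%R -> (0 <= t <= 1)%R ->
  conv (fun l => c l * t ^ l) (cPS c t).
Proof.
  intros Hr HM H Ht.
  destruct (conv_geom (fun l => c l * t ^ l) M r) as [s Hs]; trivial.
  - intros l. rewrite Cmod_mult, <- RtoC_pow, Cmod_R, Rabs_pos_eq by (apply pow_le; lra).
    specialize (H l). pose proof (Cmod_ge_0 (c l)).
    assert (t ^ l <= 1)%R by (rewrite <- (pow1 l); apply pow_incr; lra).
    pose proof (pow_le t l ltac:(lra)). nra.
  - destruct (is_pseries_parts c t s Hs) as [H1 H2].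
    apply is_pseries_unique in H1. apply is_pseries_unique in H2.
    unfold cPS. rewrite H1, H2. now destruct s.
Qed.

(** Puts the whole segment $[0,1]$ strictly inside the disc of convergence. *)
Lemma CV_radius_ge_2 (a : nat -> R) M : (0 <= M)%R ->
  (forall l, Rabs (a l) <= M * (1 / 4) ^ l)%R -> Rbar_le 2 (CV_radius a).
Proof.
  intros HM H. apply (proj1 (CV_radius_bounded a)). exists M. intros n.
  rewrite Rabs_mult, (Rabs_pos_eq (2 ^ n)) by (apply pow_le; lra).
  specialize (H n). pose proof (pow_lt 2 n ltac:(lra)).
  apply Rle_trans with (M * (1 / 4) ^ n * 2 ^ n)%R; [apply Rmult_le_compat_r; lra|].
  rewrite Rmult_assoc, <- Rpow_mult_distr.
  assert ((1 / 4 * 2) ^ n <= 1)%R by (apply Rle_trans with (1 ^ n)%R; [apply pow_incr; lra|rewrite pow1; lra]).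
  nra.
Qed.

Lemma cder_cPS c M t : (0 <= M)%R ->
  (forall l, Cmod (c l) <= M * (1 / 4) ^ l)%R -> (0 <= t <= 1)%R ->
  cder (cPS c) t (cPS (fun l => INR (S l) * c (S l)) t).
Proof.
  intros HM H Ht.
  assert (Hr : forall a, (forall l, Rabs (a l) <= Cmod (c l))%R ->
    is_derive (PSeries a) t (PSeries (PS_derive a) t)).
  { intros a Ha. apply is_derive_PSeries.
    apply Rbar_lt_le_trans with 2%R; [simpl; rewrite Rabs_pos_eq; lra|].
    apply (CV_radius_ge_2 a M); trivial. intros l. eapply Rle_trans; [apply Ha|apply H]. }
  assert (Hc : forall l, (Rabs (Re (c l)) <= Cmod (c l) /\ Rabs (Im (c l)) <= Cmod (c l))%R).
  { intros l. pose proof (Rmax_Cmod (c l)) as Hm. split.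
    - eapply Rle_trans; [apply Rmax_l|exact Hm].
    - eapply Rle_trans; [apply Rmax_r|exact Hm]. }
  split.
  - eapply is_derive_val; [|apply Hr; intros l; apply Hc].
    apply PSeries_ext. intros l. unfold PS_derive, Re, Cmult, RtoC. cbn [fst snd]. ring.
  - eapply is_derive_val; [|apply Hr; intros l; apply Hc].
    apply PSeries_ext. intros l. unfold PS_derive, Im, Cmult, RtoC. cbn [fst snd]. ring.
Qed.

Lemma Cexp_0 : Cexp 0 = 1.
Proof. unfold Cexp. simpl. rewrite exp_0, cos_0, sin_0. apply injective_projections; simpl; ring. Qed.

Lemma Cexp_opp w : Cexp (- w) * Cexp w = 1.
Proof.
  unfold Cexp, Re, Im. simpl. rewrite exp_Ropp, cos_neg, sin_neg.
  pose proof (exp_pos (fst w)) as He. pose proof (sin2_cos2 (snd w)) as E. unfold Rsqr in E.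
  apply injective_projections; simpl.
  - transitivity (sin (snd w) * sin (snd w) + cos (snd w) * cos (snd w))%R; [field; lra|exact E].
  - field. lra.
Qed.

Lemma Cexp_neq0 w : Cexp w <> 0.
Proof.
  intros E. pose proof (Cexp_opp w) as H. rewrite E, Cmult_0_r in H.
  apply RtoC_inj in H. lra.
Qed.

Lemma Clog_1 : Clog 1 = 0.
Proof.
  unfold Clog. rewrite Cmod_1, ln_1. simpl.
  replace (0 / 1)%R with 0%R by field. now rewrite atan_0.
Qed.

(* [Cpower (1 - t z) (- q) * sum_l binser q l (t z)^l] has zero derivative in [t]. *)
Lemma binomial_series q z : (Cmod z <= 1 / 8)%R ->
  conv (fun l => binser q l * z ^ l) (Cpower (1 - z) q).
Proof.
  intros Hz. destruct (INR_unbounded (Cmod q)) as [m Hm].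
  set (c := fun l => binser q l * z ^ l). set (M := (2 ^ m)%R).
  assert (HM : (0 <= M)%R) by (apply pow_le; lra).
  (* The ratio $1/4$ is the growth factor $2$ of [binser] times the bound $1/8$ on $|z|$. *)
  assert (Hc : (forall l, Cmod (c l) <= M * (1 / 4) ^ l)%R).
  { intros l. unfold c. rewrite Cmod_mult, Cmod_pow.
    replace (1 / 4)%R with (2 * (1 / 8))%R by lra. rewrite Rpow_mult_distr, <- Rmult_assoc.
    apply Rmult_le_compat; auto using Cmod_ge_0, pow_le.
    - unfold M. rewrite <- pow_add. apply Cmod_binser_le. lra.
    - apply pow_incr. split; [apply Cmod_ge_0|assumption]. }
  set (c' := fun l => INR (S l) * c (S l)).
  assert (Hc' : (forall l, Cmod (c' l) <= M * (1 / 2) ^ l)%R).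
  { intros l. unfold c'. rewrite Cmod_mult, Cmod_R, Rabs_pos_eq by apply pos_INR.
    specialize (Hc (S l)). pose proof (INR_S_le_pow2 l). pose proof (Cmod_ge_0 (c (S l))).
    apply Rle_trans with (2 ^ l * (M * (1 / 4) ^ S l))%R.
    - apply Rmult_le_compat; auto using pos_INR.
    - replace (1 / 2)%R with (2 * (1 / 4))%R by lra. rewrite Rpow_mult_distr. cbn [pow].
      pose proof (pow_le 2 l ltac:(lra)). pose proof (pow_le (1 / 4) l ltac:(lra)).
      assert (0 <= M * (2 ^ l * (1 / 4) ^ l))%R by (repeat apply Rmult_le_pos; assumption).
      lra. }
  assert (Hne : forall t : R, (0 <= t <= 1)%R -> 1 - t * z <> 0).
  { intros t Ht E. assert (E1 : RtoC 1 = t * z).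
    { transitivity (1 - t * z + t * z); [ring|rewrite E; ring]. }
    apply (f_equal Cmod) in E1. rewrite Cmod_1, Cmod_mult, Cmod_R, Rabs_pos_eq in E1 by lra.
    pose proof (Cmod_ge_0 z). nra. }
  (* The differential equation of $(1-tz)^q$, which on coefficients is [binser_succ]. *)
  assert (Hode : forall t : R, (0 <= t <= 1)%R ->
    (1 - t * z) * cPS c' t = - q * z * cPS c t).
  { intros t Ht.
    pose proof (conv_cPS c M (1 / 4) t ltac:(lra) HM Hc Ht) as H0.
    pose proof (conv_cPS c' M (1 / 2) t ltac:(lra) HM Hc' Ht) as H1.
    apply (conv_unique (fun l => - q * z * (c l * t ^ l))); [|now apply conv_scal].
    replace ((1 - t * z) * cPS c' t) with (cPS c' t + - (t * z) * cPS c' t) by ring.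
    pose proof (conv_shift _ _ (conv_scal (- (t * z)) _ _ H1)) as H2.
    refine (conv_ext _ _ _ _ (conv_plus _ _ _ _ H1 H2)).
    intros l. unfold c'. cbv beta.
    assert (El : INR (S l) * c (S l) = z * (INR l - q) * c l).
    { unfold c. rewrite C_INR_S.
      transitivity ((INR l + 1) * binser q (S l) * z ^ S l); [ring|].
      rewrite binser_succ. cbn [Cpow]. ring. }
    destruct l as [|l]; cbn [fps_shift].
    - rewrite El. simpl. ring.
    - rewrite El. cbn [Cpow]. ring. }
  set (P := fun t : R => Cexp (- q * Clog (1 - t * z))).
  assert (HP : forall t, (0 <= t <= 1)%R -> cder P t (P t * (- q * (- z / (1 - t * z))))).
  { intros t Ht. apply (cder_Cexp (fun t : R => - q * Clog (1 - t * z))).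
    apply cder_scal, cder_Clog_line; trivial. lra. }
  assert (Hconst : P 0%R * cPS c 0 = P 1%R * cPS c 1).
  { apply (cder_zero_eq (fun t => P t * cPS c t)); [lra|]. intros t Ht.
    replace (RtoC 0) with (P t * (- q * (- z / (1 - t * z))) * cPS c t + P t * cPS c' t).
    - apply cder_mult; auto. now apply (cder_cPS c M).
    - replace (cPS c' t) with (- q * z * cPS c t / (1 - t * z))
        by (rewrite <- Hode by trivial; field; auto).
      field. auto. }
  assert (H1 : cPS c 1 = Cpower (1 - z) q).
  { unfold P in Hconst.
    replace (1 - RtoC 0 * z) with (RtoC 1) in Hconst by ring.
    replace (1 - RtoC 1 * z) with (1 - z) in Hconst by ring.
    rewrite Clog_1, Cmult_0_r, Cexp_0 in Hconst.
    assert (H0 : cPS c 0 = 1).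
    { unfold cPS. rewrite !PSeries_0. unfold c. rewrite binser_0.
      apply injective_projections; simpl; ring. }
    rewrite H0 in Hconst. unfold Cpower.
    replace (- q * Clog (1 - z)) with (- (q * Clog (1 - z))) in Hconst by ring.
    transitivity (Cexp (q * Clog (1 - z)) * (Cexp (- (q * Clog (1 - z))) * cPS c 1)).
    - rewrite Cmult_assoc, (Cmult_comm (Cexp _)), Cexp_opp. ring.
    - rewrite <- Hconst. ring. }
  rewrite <- H1. apply (conv_ext (fun l => c l * RtoC 1 ^ l)).
  - intros l. rewrite <- RtoC_pow, pow1. ring.
  - apply (conv_cPS c M (1 / 4)); trivial; lra.
Qed.


(** * Convergence of the double series *)

Lemma conv_one_minus_X f z s : conv (fun k => f k * z ^ k) s ->
  conv (fun k => (f k - fps_shift f k) * z ^ k) ((1 - z) * s).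
Proof.
  intros H. replace ((1 - z) * s) with (s + - z * s) by ring.
  refine (conv_ext _ _ _ _ (conv_plus _ _ _ _ H (conv_shift _ _ (conv_scal (- z) _ _ H)))).
  intros [|k]; cbn [fps_shift Cpow]; ring.
Qed.

Lemma mon_ge p q l : mon p q (p + l)%nat = binser q l.
Proof. induction p as [|p IH]; [reflexivity|]. exact IH. Qed.

Lemma mon_exp0 i k : mon i 0 k = if Nat.eq_dec i k then 1 else 0.
Proof.
  destruct (Nat.lt_ge_cases k i) as [H|H].
  - rewrite mon_lt by assumption. destruct (Nat.eq_dec i k); [lia|reflexivity].
  - replace k with (i + (k - i))%nat at 1 by lia. rewrite mon_ge.
    destruct (k - i)%nat as [|l] eqn:E; destruct (Nat.eq_dec i k); try lia.
    + apply binser_0.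
    + unfold binser. rewrite poch_S_l. unfold Cdiv. ring.
Qed.

(** Re-expands $\sum_if_iz^i(1-z)^j$ in powers of $z$, one factor $1-z$ at a time by [mon_q1]. *)
Lemma conv_mon_sum (f : nat -> C) z s j : conv (fun k => f k * z ^ k) s ->
  conv (fun k => Csum (fun i => f i * mon i (INR j) k) (S k) * z ^ k) (s * (1 - z) ^ j).
Proof.
  intros H. induction j as [|j IH].
  - apply (conv_ext (fun k => f k * z ^ k)).
    + intros k. f_equal. cbn [Csum]. simpl INR.
      rewrite Csum_0.
      * rewrite mon_exp0. destruct (Nat.eq_dec k k); [ring|easy].
      * intros i Hi. rewrite mon_exp0. destruct (Nat.eq_dec i k); [lia|ring].
    + simpl. now rewrite Cmult_1_r.
  - cbn [Cpow]. replace (s * ((1 - z) * (1 - z) ^ j)) with ((1 - z) * (s * (1 - z) ^ j)) by ring.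
    refine (conv_ext _ _ _ _ (conv_one_minus_X _ _ _ IH)).
    intros k. cbv beta. f_equal. rewrite C_INR_S.
    rewrite (Csum_ext (fun i => f i * mon i (INR j + 1) k)
      (fun i => f i * mon i (INR j) k + - (f i * mon (S i) (INR j) k)))
      by (intros; rewrite mon_q1; ring).
    rewrite Csum_plus, Csum_opp. destruct k as [|k]; cbn [fps_shift].
    + cbn [Csum]. rewrite (mon_lt 1) by lia. ring.
    + cbn [Csum]. rewrite (mon_lt (S (S k))) by lia.
      change (Csum (fun i => f i * mon (S i) (INR j) (S k)) k)
        with (Csum (fun i => f i * mon i (INR j) k) k).
      rewrite (mon_S k). ring.
Qed.

Lemma poch_1_fact k : poch 1 k = INR (fact k).
Proof.
  induction k as [|k IH]; [reflexivity|]. cbn [poch]. rewrite IH, C_INR_fact_S. ring.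
Qed.

(** $\binom{i+j}{j}$ is the coefficient of $X^j$ in $(1-X)^{-(i+1)}$. *)
Lemma fact_add_le i j : (INR (fact (i + j)) <= 2 ^ (S i + j) * INR (fact i) * INR (fact j))%R.
Proof.
  pose proof (Cmod_binser_opp_INR (S i) j) as H. unfold binser in H.
  rewrite Cmod_div, Cmod_R, (Rabs_pos_eq (INR (fact j))) in H
    by (apply C_INR_fact_neq0 || apply pos_INR).
  apply (proj1 (Rle_div_l _ _ _ (INR_fact_lt_0 j))) in H.
  replace (- - INR (S i)) with (1 + INR i) in H by (rewrite C_INR_S; ring).
  assert (E : (INR (fact (i + j)) = INR (fact i) * Cmod (poch (1 + INR i) j))%R).
  { rewrite <- (Rabs_pos_eq (INR (fact (i + j)))) by apply pos_INR.
    rewrite <- (Rabs_pos_eq (INR (fact i))) by apply pos_INR.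
    rewrite <- !Cmod_R, <- Cmod_mult, <- !poch_1_fact. now rewrite poch_add. }
  rewrite E. pose proof (pos_INR (fact i)). nra.
Qed.

Lemma fact_mul_le i j : (INR (fact i) * INR (fact j) <= INR (fact (i + j)))%R.
Proof.
  induction j as [|j IH].
  - rewrite Nat.add_0_r. simpl. lra.
  - rewrite Nat.add_succ_r, !fact_simpl, !mult_INR.
    assert (H : (INR (S j) <= INR (S (i + j)))%R) by (apply le_INR; lia).
    pose proof (pos_INR (fact i)). pose proof (pos_INR (fact j)). pose proof (pos_INR (S j)).
    replace (INR (fact i) * (INR (S j) * INR (fact j)))%R
      with (INR (S j) * (INR (fact i) * INR (fact j)))%R by ring.
    apply Rmult_le_compat; trivial. now apply Rmult_le_pos.
Qed.

Lemma pow_div2_le R i : (1 <= R)%R -> (R ^ Nat.div2 i <= R ^ i)%R.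
Proof. intros H. apply Rle_pow; trivial. apply Nat.div2_decr. lia. Qed.

(** With $t=\lfloor i/2\rfloor$, the numerator is at most $2^{m+i}\,t!$ and $(p+\frac12)_t$ is at
    least $t!/R^t$ in modulus, so the factorials of $t$ cancel. *)
Lemma Cmod_uhat_le p : ~ nonpos_int (p + 1 / 2) -> exists M R, (0 <= M)%R /\ (1 <= R)%R /\
  forall i, (Cmod (uhat p i) * INR (fact i) <= M * R ^ i)%R.
Proof.
  intros H. destruct (Cmod_poch_ge _ H) as [R [HR Hp]].
  destruct (INR_unbounded (Cmod p)) as [m Hm].
  exists (2 ^ m)%R, R. split; [apply pow_le; lra|]. split; trivial. intros i.
  unfold uhat. set (t := Nat.div2 i). assert (Ht : (t <= i)%nat) by (apply Nat.div2_decr; lia).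
  pose proof (poch_neq0_nonpos _ t H) as N1. pose proof (C_INR_fact_neq0 i) as N2.
  pose proof (two_pow_neq0 i) as N3.
  rewrite Cmod_div, !Cmod_mult by (repeat apply Cmult_neq_0; assumption).
  rewrite Cmod_pow, !Cmod_R, (Rabs_pos_eq (INR (fact i))) by apply pos_INR.
  rewrite (Rabs_pos_eq 2) by lra.
  pose proof (INR_fact_lt_0 i) as Hf. apply Cmod_gt_0 in N1.
  pose proof (pow_lt 2 i ltac:(lra)) as H2.
  assert (Hn : (Cmod (poch (p + INR (i - t)) t) <= 2 ^ m * 2 ^ i * INR (fact t))%R).
  { assert (Hb : (Cmod (- (p + INR (i - t))) <= INR (m + (i - t)))%R).
    { rewrite Cmod_opp, plus_INR. eapply Rle_trans; [apply Cmod_triangle|].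
      rewrite Cmod_R, Rabs_pos_eq by apply pos_INR. lra. }
    pose proof (Cmod_binser_le _ _ t Hb) as Hq. unfold binser in Hq.
    rewrite Cmod_div, Cmod_R, (Rabs_pos_eq (INR (fact t))) in Hq
      by (apply C_INR_fact_neq0 || apply pos_INR).
    apply (proj1 (Rle_div_l _ _ _ (INR_fact_lt_0 t))) in Hq.
    replace (- - (p + INR (i - t))) with (p + INR (i - t)) in Hq by ring.
    replace (m + (i - t) + t)%nat with (m + i)%nat in Hq by lia.
    now rewrite pow_add in Hq. }
  specialize (Hp t). pose proof (pow_div2_le R i HR) as Hd. fold t in Hd.
  unfold Rdiv. rewrite Rmult_assoc.
  replace (/ (2 ^ i * Cmod (poch (p + 1 / 2) t) * INR (fact i)) * INR (fact i))%R
    with (/ (2 ^ i * Cmod (poch (p + 1 / 2) t)))%R by (field; repeat split; lra).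
  apply Rdiv_le_of_le; [now apply Rmult_lt_0_compat|].
  eapply Rle_trans; [exact Hn|].
  replace (2 ^ m * R ^ i * (2 ^ i * Cmod (poch (p + 1 / 2) t)))%R
    with (2 ^ m * 2 ^ i * (R ^ i * Cmod (poch (p + 1 / 2) t)))%R by ring.
  apply Rmult_le_compat_l.
  - apply Rmult_le_pos; [apply pow_le|]; lra.
  - eapply Rle_trans; [exact Hp|]. apply Rmult_le_compat_r; lra.
Qed.

Lemma Cmod_Kterm_le a b : ~ nonpos_int (a + b + 1 / 2) -> exists R, (1 <= R)%R /\
  forall N, (Cmod (Kterm a b N) <= R ^ N * INR (fact N))%R.
Proof.
  intros H.
  destruct (Cmod_hyper_le (2 * a) (2 * b) _ H) as [R [HR Hh]].
  exists R. split; trivial. intros N.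
  replace (Kterm a b N) with (hyper (2 * a) (2 * b) (a + b + 1 / 2) N * INR (fact N)).
  - rewrite Cmod_mult, Cmod_R, Rabs_pos_eq by apply pos_INR.
    apply Rmult_le_compat_r; [apply pos_INR|apply Hh].
  - unfold hyper, Kterm. field. split; [now apply poch_neq0_nonpos|apply C_INR_fact_neq0].
Qed.

(** The factor $(i+j)!$ in the bound for [Kterm] is absorbed by the $i!$ gained in [uhat]. The ratio
    [R] is chosen before $j$, so that one disc serves all columns. *)
Lemma Cmod_clausen_coef_le a b n : ~ nonpos_int (a + b + 1 / 2) ->
  exists R, (1 <= R)%R /\ forall j, exists M, (0 <= M)%R /\
    forall i, (Cmod (clausen_coef a b n i j) <= M * R ^ i)%R.
Proof.
  intros H. destruct (Cmod_Kterm_le a b H) as [RK [HRK HK]].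
  destruct (Cmod_uhat_le (a + b + INR n) (not_nonpos_shift a b n H)) as [Mu [Ru [HMu [HRu Hu]]]].
  exists (2 * RK * Ru)%R. split; [assert (1 <= RK * Ru)%R by nra; nra|]. intros j.
  exists (RK ^ j * 2 ^ S j * INR (fact j) * Mu * Cmod (vterm n j))%R. split.
  - repeat apply Rmult_le_pos; try apply pow_le; auto using pos_INR, Cmod_ge_0; lra.
  - intros i. unfold clausen_coef. rewrite !Cmod_mult.
    rewrite !Rpow_mult_distr.
    replace (RK ^ j * 2 ^ S j * INR (fact j) * Mu * Cmod (vterm n j) * (2 ^ i * RK ^ i * Ru ^ i))%R
      with (RK ^ (i + j) * (2 ^ (S i + j) * INR (fact j)) * (Mu * Ru ^ i) * Cmod (vterm n j))%R
      by (rewrite !pow_add; cbn [pow]; ring).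
    apply Rmult_le_compat_r; [apply Cmod_ge_0|].
    specialize (HK (i + j)%nat). specialize (Hu i). pose proof (fact_add_le i j) as Hf.
    pose proof (Cmod_ge_0 (uhat (a + b + INR n) i)) as Hu0.
    pose proof (pow_le RK (i + j) ltac:(lra)) as HRp.
    eapply Rle_trans; [apply Rmult_le_compat_r; [exact Hu0|exact HK]|].
    rewrite !Rmult_assoc. apply Rmult_le_compat_l; trivial.
    eapply Rle_trans; [apply Rmult_le_compat_r; [exact Hu0|exact Hf]|].
    replace (2 ^ (S i + j) * INR (fact i) * INR (fact j) * Cmod (uhat (a + b + INR n) i))%R
      with (2 ^ (S i + j) * INR (fact j) * (Cmod (uhat (a + b + INR n) i) * INR (fact i)))%R by ring.
    rewrite <- (Rmult_assoc (2 ^ (S i + j))).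
    apply Rmult_le_compat_l; trivial.
    apply Rmult_le_pos; [apply pow_le; lra|apply pos_INR].
Qed.

Lemma Cmod_scaled_le (f : nat -> C) R M z r k : (0 <= R)%R -> (0 <= M)%R -> (R * Cmod z <= r)%R ->
  (Cmod (f k) <= M * R ^ k)%R -> (Cmod (f k * z ^ k) <= M * r ^ k)%R.
Proof.
  intros HR HM Hz Hf. rewrite Cmod_mult, Cmod_pow.
  pose proof (Cmod_ge_0 z) as Hz0. pose proof (pow_le (Cmod z) k Hz0) as Hp.
  eapply Rle_trans; [apply Rmult_le_compat_r; [exact Hp|exact Hf]|].
  rewrite Rmult_assoc, <- Rpow_mult_distr. apply Rmult_le_compat_l; trivial.
  apply pow_incr. split; trivial. now apply Rmult_le_pos.
Qed.

Lemma exists_small_radius (R e : R) : (0 < e)%R -> (1 <= R)%R ->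
  exists d, (0 < d)%R /\ forall x, (0 <= x < d)%R -> (R * x <= e)%R.
Proof.
  intros He HR. exists (e / R)%R. split; [apply Rdiv_lt_0_compat; lra|]. intros x Hx.
  replace e with (R * (e / R))%R by (field; lra). apply Rmult_le_compat_l; lra.
Qed.

Lemma finite_choice n (P : nat -> C -> Prop) : (forall j, exists x, P j x) ->
  exists s, forall j, (j < n)%nat -> P j (s j).
Proof.
  intros H. induction n as [|n [s Hs]].
  - exists (fun _ => RtoC 0). intros; lia.
  - destruct (H n) as [x Hx]. exists (fun j => if Nat.eq_dec j n then x else s j).
    intros j Hj. destruct (Nat.eq_dec j n) as [->|Hn]; [assumption|]. apply Hs. lia.
Qed.

Definition clausen_row (a b : C) (n : nat) (z : C) (i : nat) : C :=
  Csum (fun j => clausen_coef a b n i j * (z ^ i * (1 - z) ^ j)) (S n).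

(** As $j$ takes finitely many values, the double series is a finite combination of its columns,
    each a power series in $z$ times $(1-z)^j$. *)
Lemma clausen_identity a b n : ~ nonpos_int (a + b + 1 / 2) ->
  exists d, (0 < d)%R /\ forall z, (Cmod z < d)%R -> exists F D : C,
    conv (fun k => hyper a b (a + b + INR n + 1 / 2) k * z ^ k) F
    /\ conv (clausen_row a b n z) D
    /\ poch (a + 1 / 2) n * poch (b + 1 / 2) n * F ^ 2
       = poch (1 / 2) n * poch (a + b + 1 / 2) n * D.
Proof.
  intros H.
  destruct (Cmod_hyper_le a b _ (not_nonpos_shift a b n H)) as [R1 [HR1 H1]].
  destruct (Cmod_clausen_coef_le a b n H) as [R2 [HR2 H2]].
  destruct (exists_small_radius (R1 * R2) (1 / 4)) as [d [Hd Hz]]; [lra|nra|].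
  exists d. split; trivial. intros z Hzd. pose proof (Cmod_ge_0 z) as Hz0.
  specialize (Hz (Cmod z) (conj Hz0 Hzd)).
  assert (Hz1 : (R1 * Cmod z <= 1 / 4)%R).
  { eapply Rle_trans; [|exact Hz]. apply Rmult_le_compat_r; nra. }
  assert (Hz2 : (R2 * Cmod z <= 1 / 4)%R).
  { eapply Rle_trans; [|exact Hz]. apply Rmult_le_compat_r; nra. }
  set (h := hyper a b (a + b + INR n + 1 / 2)) in *.
  assert (Hh : forall k, (Cmod (h k * z ^ k) <= (1 / 4) ^ k)%R).
  { intros k. rewrite <- (Rmult_1_l ((1 / 4) ^ k)).
    apply (Cmod_scaled_le h R1); try lra. rewrite Rmult_1_l. apply H1. }
  destruct (conv_geom (fun k => h k * z ^ k) 1 (1 / 4)) as [F HF]; try lra.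
  { intros k. rewrite Rmult_1_l. apply Hh. }
  assert (Hrow : forall j, exists s, conv (fun i => clausen_coef a b n i j * z ^ i) s).
  { intros j. destruct (H2 j) as [M [HM HMj]].
    apply (conv_geom _ M (1 / 4)); trivial; try lra.
    intros k. apply (Cmod_scaled_le (fun i => clausen_coef a b n i j) R2); trivial; lra. }
  destruct (finite_choice (S n) _ Hrow) as [s Hs].
  set (D := Csum (fun j => s j * (1 - z) ^ j) (S n)).
  exists F, D. split; trivial. split.
  - unfold clausen_row, D.
    apply (conv_Csum (fun j i => clausen_coef a b n i j * (z ^ i * (1 - z) ^ j))).
    intros j Hj. rewrite Cmult_comm.
    apply (conv_ext (fun i => (1 - z) ^ j * (clausen_coef a b n i j * z ^ i)));
      [intros; ring|]. now apply conv_scal, Hs.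
  - pose proof (conv_fps_mul h h z (1 / 4) F F ltac:(lra) Hh Hh HF HF) as HFF.
    (* The number [D], already the sum by rows, is also the sum of the expansion in powers of $z$,
       to which the formal identity applies. *)
    assert (HD : conv (fun k => Csum (fun i => Csum (fun j => f211 a b n i j k) (S n)) (S k) * z ^ k) D).
    { unfold D.
      apply (conv_ext (fun k => Csum (fun j =>
          Csum (fun i => clausen_coef a b n i j * mon i (INR j) k) (S k) * z ^ k) (S n))).
      - intros k. rewrite Csum_scal_r. f_equal. now rewrite Csum_swap.
      - apply (conv_Csum (fun j k =>
          Csum (fun i => clausen_coef a b n i j * mon i (INR j) k) (S k) * z ^ k)).
        intros j Hj. now apply (conv_mon_sum (fun i => clausen_coef a b n i j)), Hs. }
    replace (F ^ 2) with (F * F) by (simpl; ring).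
    apply (conv_unique (fun k => poch (a + 1 / 2) n * poch (b + 1 / 2) n * (fps_mul h h k * z ^ k))).
    + now apply conv_scal.
    + refine (conv_ext _ _ _ _ (conv_scal (poch (1 / 2) n * poch (a + b + 1 / 2) n) _ _ HD)).
      intros k. cbv beta. rewrite !Cmult_assoc. f_equal. symmetry. now apply formal_clausen.
Qed.


(** * Bounds and summation for the product of two solutions *)

Lemma Cmod_A122_le x y : exists R, (1 <= R)%R /\
  forall i, (Cmod (A122 x y i) <= R ^ i * INR (fact i))%R.
Proof.
  destruct (Cmod_poch_le x) as [Rx [HRx Hx]]. destruct (Cmod_poch_le y) as [Ry [HRy Hy]].
  exists (Rx * Ry)%R. split; [nra|]. intros i. unfold A122.
  rewrite Cmod_div, Cmod_mult, Cmod_R, Rabs_pos_eq by (apply C_INR_fact_neq0 || apply pos_INR).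
  apply Rdiv_le_of_le; [apply INR_fact_lt_0|]. rewrite Rpow_mult_distr.
  replace (Rx ^ i * Ry ^ i * INR (fact i) * INR (fact i))%R
    with ((Rx ^ i * INR (fact i)) * (Ry ^ i * INR (fact i)))%R by ring.
  apply Rmult_le_compat; auto using Cmod_ge_0.
Qed.

(** The net gain of one factorial compensates the factorials in the bounds for the two [A122]
    factors, since $i!\,j!\le(i+j)!$. Writing $(1)_n=n!$ reduces one quotient to a hypergeometric
    coefficient. *)
Lemma Cmod_h122_le c : ~ nonpos_int c -> ~ nonpos_int (2 - c) -> exists R, (1 <= R)%R /\
  forall n, (Cmod (h122 c n) * INR (fact n) <= R ^ n)%R.
Proof.
  intros H1 H2. destruct (Cmod_hyper_le (1 / 2) 1 c H1) as [R1 [HR1 Hh]].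
  destruct (Cmod_poch_ge _ H2) as [R2 [HR2 Hp]].
  exists (R1 * R2)%R. split; [nra|]. intros n.
  pose proof (poch_neq0_nonpos _ n H1) as N1. pose proof (poch_neq0_nonpos _ n H2) as N2.
  replace (h122 c n) with (hyper (1 / 2) 1 c n / poch (2 - c) n).
  - rewrite Cmod_div, Rpow_mult_distr by assumption. apply Cmod_gt_0 in N2.
    replace (Cmod (hyper (1 / 2) 1 c n) / Cmod (poch (2 - c) n) * INR (fact n))%R
      with (Cmod (hyper (1 / 2) 1 c n) * (INR (fact n) / Cmod (poch (2 - c) n)))%R
      by (field; lra).
    apply Rmult_le_compat; auto using Cmod_ge_0.
    + apply Rdiv_le_0_compat; [apply pos_INR|assumption].
    + apply Rdiv_le_of_le; auto.
  - unfold h122, hyper. rewrite poch_1_fact. field. repeat split; auto using C_INR_fact_neq0.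
Qed.

Definition coef122 (a b c : C) (i j : nat) : C :=
  A122 (a - b + 1 / 2) (b - a + 1 / 2) i * A122 (a + b - c + 1 / 2) (c - a - b + 1 / 2) j
  * (- (1)) ^ j * h122 c (i + j).

Lemma Cmod_coef122_le a b c : ~ nonpos_int c -> ~ nonpos_int (2 - c) -> exists R, (1 <= R)%R /\
  forall i j, (Cmod (coef122 a b c i j) <= R ^ (i + j))%R.
Proof.
  intros H1 H2.
  destruct (Cmod_A122_le (a - b + 1 / 2) (b - a + 1 / 2)) as [R1 [HR1 HA]].
  destruct (Cmod_A122_le (a + b - c + 1 / 2) (c - a - b + 1 / 2)) as [R2 [HR2 HB]].
  destruct (Cmod_h122_le c H1 H2) as [R3 [HR3 Hh]].
  exists (R1 * R2 * R3)%R. split; [assert (1 <= R1 * R2)%R by nra; nra|]. intros i j.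
  unfold coef122. rewrite !Cmod_mult, Cmod_pow, Cmod_m1, pow1, Rmult_1_r, !Rpow_mult_distr.
  specialize (HA i). specialize (HB j). specialize (Hh (i + j)%nat).
  pose proof (fact_mul_le i j) as Hf.
  pose proof (Cmod_ge_0 (h122 c (i + j))) as Hh0.
  assert (HRi : (R1 ^ i <= R1 ^ (i + j))%R) by (apply Rle_pow; [lra|lia]).
  assert (HRj : (R2 ^ j <= R2 ^ (i + j))%R) by (apply Rle_pow; [lra|lia]).
  pose proof (pow_le R1 i ltac:(lra)) as P1. pose proof (pow_le R2 j ltac:(lra)) as P2.
  eapply Rle_trans.
  { apply Rmult_le_compat_r; [exact Hh0|].
    apply Rmult_le_compat; [apply Cmod_ge_0|apply Cmod_ge_0|exact HA|exact HB]. }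
  replace (R1 ^ i * INR (fact i) * (R2 ^ j * INR (fact j)) * Cmod (h122 c (i + j)))%R
    with (R1 ^ i * R2 ^ j * (Cmod (h122 c (i + j)) * (INR (fact i) * INR (fact j))))%R by ring.
  apply Rmult_le_compat.
  - now apply Rmult_le_pos.
  - repeat apply Rmult_le_pos; trivial; apply pos_INR.
  - apply Rmult_le_compat; trivial.
  - eapply Rle_trans; [|exact Hh]. now apply Rmult_le_compat_l.
Qed.

Lemma conv_cPS_1 f M r : (0 <= r < 1)%R -> (0 <= M)%R ->
  (forall l, Cmod (f l) <= M * r ^ l)%R -> conv f (cPS f 1).
Proof.
  intros Hr HM H. apply (conv_ext (fun l => f l * RtoC 1 ^ l)).
  - intros l. rewrite <- RtoC_pow, pow1. ring.
  - apply (conv_cPS f M r); trivial. lra.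
Qed.

(** Each factor $1-z$ is absorbed on the level of the binomial series, where it is [mon_q1]. *)
Lemma Cpower_sub_nat z q j : (Cmod z <= 1 / 8)%R ->
  Cpower (1 - z) (q - INR j) * (1 - z) ^ j = Cpower (1 - z) q.
Proof.
  intros Hz. induction j as [|j IH].
  - simpl. replace (q - 0) with q by ring. ring.
  - rewrite <- IH. cbn [Cpow]. rewrite Cmult_assoc. f_equal.
    rewrite Cmult_comm.
    apply (conv_unique (fun l => binser (q - INR j) l * z ^ l)).
    + refine (conv_ext _ _ _ _ (conv_one_minus_X _ _ _ (binomial_series (q - INR (S j)) z Hz))).
      intros l. cbv beta. f_equal.
      pose proof (mon_q1 0 (q - INR (S j)) l) as E.
      replace (q - INR (S j) + 1) with (q - INR j) in E by (rewrite C_INR_S; ring).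
      symmetry. exact E.
    + now apply binomial_series.
Qed.

(** Expanding $(1-z)^{c-a-b-1/2-j}$ gives a triple series; regrouped by total degree it has the
    coefficients of the formal identity. *)
Lemma diag_diag_f122 a b c z N :
  diag (fun i => diag (fun j l =>
     coef122 a b c i j * binser (c - a - b - 1 / 2 - INR j) l * z ^ (i + j + l))) N
  = Csum (fun i => Csum (fun j => f122 a b c i j N) (S N)) (S N) * z ^ N.
Proof.
  unfold diag at 1. rewrite <- Csum_scal_r. apply Csum_ext_lt. intros i Hi.
  rewrite (Csum_trunc (fun j => f122 a b c i j N) (S (N - i)) (S N)).
  - unfold diag. rewrite <- Csum_scal_r. apply Csum_ext_lt. intros j Hj.
    unfold f122, t122. fold (coef122 a b c i j).
    replace N with ((i + j) + (N - i - j))%nat at 3 by lia. rewrite mon_ge.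
    replace (i + j + (N - i - j))%nat with N by lia. unfold coef122. ring.
  - lia.
  - intros j Hj. apply f122_lt. lia.
Qed.

Lemma product_identity a b c : ~ nonpos_int c -> ~ nonpos_int (2 - c) ->
  exists d, (0 < d)%R /\ forall z, (Cmod z < d)%R -> exists F G D : C,
    conv (fun k => hyper a b c k * z ^ k) F
    /\ conv (fun k => hyper (1 + a - c) (1 + b - c) (2 - c) k * z ^ k) G
    /\ is_F122 (1 / 2) (a - b + 1 / 2) (a + b - c + 1 / 2)
         (b - a + 1 / 2) (c - a - b + 1 / 2) c (2 - c) z (z / (z - 1)) D
    /\ F * G = Cpower (1 - z) (c - a - b - 1 / 2) * D.
Proof.
  intros H1 H2.
  destruct (Cmod_hyper_le a b c H1) as [R1 [HR1 Hf]].
  destruct (Cmod_hyper_le (1 + a - c) (1 + b - c) (2 - c) H2) as [R2 [HR2 Hg]].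
  destruct (Cmod_coef122_le a b c H1 H2) as [R3 [HR3 Hc]].
  (* The factor $2$ pays for the growth of [binser]. The ratio $1/8$ rises to $1/4$ after the inner
     regrouping, still below the $1/2$ that the outer one allows. *)
  destruct (exists_small_radius (2 * (R1 * R2 * R3)) (1 / 8)) as [d [Hd Hz]];
    [lra|assert (1 <= R1 * R2)%R by nra; nra|].
  exists d. split; trivial. intros z Hzd. pose proof (Cmod_ge_0 z) as Hz0.
  specialize (Hz (Cmod z) (conj Hz0 Hzd)).
  assert (HR12 : (1 <= R1 * R2)%R) by nra. assert (HR23 : (1 <= R2 * R3)%R) by nra.
  assert (HR13 : (1 <= R1 * R3)%R) by nra.
  assert (Hz1 : (R1 * Cmod z <= 1 / 8)%R).
  { eapply Rle_trans; [|exact Hz]. apply Rmult_le_compat_r; nra. }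
  assert (Hz2 : (R2 * Cmod z <= 1 / 8)%R).
  { eapply Rle_trans; [|exact Hz]. apply Rmult_le_compat_r; nra. }
  assert (Hz3 : (2 * R3 * Cmod z <= 1 / 8)%R).
  { eapply Rle_trans; [|exact Hz]. apply Rmult_le_compat_r; nra. }
  assert (Hz8 : (Cmod z <= 1 / 8)%R) by nra.
  set (f := hyper a b c) in *. set (g := hyper (1 + a - c) (1 + b - c) (2 - c)) in *.
  assert (Hfz : forall k, (Cmod (f k * z ^ k) <= (1 / 8) ^ k)%R).
  { intros k. rewrite <- (Rmult_1_l ((1 / 8) ^ k)).
    apply (Cmod_scaled_le f R1); try lra. rewrite Rmult_1_l. apply Hf. }
  assert (Hgz : forall k, (Cmod (g k * z ^ k) <= (1 / 8) ^ k)%R).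
  { intros k. rewrite <- (Rmult_1_l ((1 / 8) ^ k)).
    apply (Cmod_scaled_le g R2); try lra. rewrite Rmult_1_l. apply Hg. }
  destruct (conv_geom (fun k => f k * z ^ k) 1 (1 / 8)) as [F HF]; try lra.
  { intros k. rewrite Rmult_1_l. apply Hfz. }
  destruct (conv_geom (fun k => g k * z ^ k) 1 (1 / 8)) as [G HG]; try lra.
  { intros k. rewrite Rmult_1_l. apply Hgz. }
  set (be := c - a - b - 1 / 2).
  destruct (INR_unbounded (Cmod be)) as [m Hm].
  set (M := (2 ^ m)%R). assert (HM : (0 <= M)%R) by (apply pow_le; lra).
  set (T := fun i j l => coef122 a b c i j * binser (be - INR j) l * z ^ (i + j + l)).
  assert (HT : forall i j l, (Cmod (T i j l) <= M * (1 / 8) ^ i * (1 / 8) ^ (j + l))%R).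
  { intros i j l. unfold T. rewrite !Cmod_mult, Cmod_pow, (Rmult_assoc M), <- pow_add.
    assert (Hb : (Cmod (binser (be - INR j) l) <= 2 ^ (m + j + l))%R).
    { apply Cmod_binser_le. rewrite plus_INR. unfold Cminus.
      eapply Rle_trans; [apply Cmod_triangle|].
      rewrite Cmod_opp, Cmod_R, (Rabs_pos_eq (INR j)) by apply pos_INR. lra. }
    specialize (Hc i j).
    assert (Hc' : (Cmod (coef122 a b c i j) <= R3 ^ (i + (j + l)))%R).
    { eapply Rle_trans; [exact Hc|]. apply Rle_pow; [lra|lia]. }
    assert (Hb' : (Cmod (binser (be - INR j) l) <= M * 2 ^ (i + (j + l)))%R).
    { eapply Rle_trans; [exact Hb|]. unfold M. rewrite <- pow_add. apply Rle_pow; [lra|lia]. }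
    replace (i + j + l)%nat with (i + (j + l))%nat by lia. set (k := (i + (j + l))%nat) in *.
    pose proof (pow_le (Cmod z) k Hz0) as Hpz.
    eapply Rle_trans; [apply Rmult_le_compat_r; [exact Hpz|];
      apply Rmult_le_compat; [apply Cmod_ge_0|apply Cmod_ge_0|exact Hc'|exact Hb']|].
    replace (R3 ^ k * (M * 2 ^ k) * Cmod z ^ k)%R with (M * (2 * R3 * Cmod z) ^ k)%R
      by (rewrite !Rpow_mult_distr; ring).
    apply Rmult_le_compat_l; trivial. apply pow_incr. split; trivial. nra. }
  assert (HMi : forall i, (0 <= M * (1 / 8) ^ i)%R).
  { intros i. apply Rmult_le_pos; trivial. apply pow_le. lra. }
  assert (Hdiag : forall i k, (Cmod (diag (T i) k) <= M * (1 / 8) ^ i * (1 / 4) ^ k)%R).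
  { intros i k. replace (1 / 4)%R with (2 * (1 / 8))%R by lra.
    apply diag_bound; [lra|apply HMi|]. intros j l. apply HT. }
  set (P := Cpower (1 - z) be).
  assert (HP : P <> 0) by apply Cexp_neq0.
  (* An explicit value for the sum over $j$ and $l$ at fixed $i$; it will be $P$ times the $i$-th
     inner sum of the double series. *)
  set (V := fun i => cPS (diag (T i)) 1).
  assert (HV : forall i, conv (diag (T i)) (V i)).
  { intros i. apply (conv_cPS_1 _ (M * (1 / 8) ^ i) (1 / 4)); trivial. lra. }
  assert (HVsum : conv V (F * G)).
  { apply (conv_iterated (fun i => diag (T i)) M (1 / 4)); trivial; [lra| |].
    - intros i k. eapply Rle_trans; [apply Hdiag|]. rewrite pow_add, <- Rmult_assoc.
      apply Rmult_le_compat_r; [apply pow_le; lra|]. apply Rmult_le_compat_l; trivial.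
      apply pow_incr. lra.
    - apply (conv_ext (fun k => fps_mul f g k * z ^ k)).
      + intros k. unfold f, g. rewrite formal_product by assumption.
        symmetry. apply diag_diag_f122.
      + apply (conv_fps_mul f g z (1 / 8)); trivial. lra. }
  assert (Hz_ne : 1 - z <> 0).
  { intros E. assert (E1 : z = 1) by (transitivity (1 - (1 - z)); [ring|rewrite E; ring]).
    rewrite E1, Cmod_1 in Hz8. lra. }
  exists F, G, (F * G / P). repeat split; trivial.
  - exists (fun i => / P * V i). split.
    + intros i. apply conv_is_series.
      (* Summing over $l$ first restores the powers of $1-z$. *)
      assert (HVi : conv (fun j => coef122 a b c i j * z ^ (i + j) * Cpower (1 - z) (be - INR j)) (V i)).
      { apply (conv_iterated (T i) (M * (1 / 8) ^ i) (1 / 8)); trivial; [lra|].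
        intros j. refine (conv_ext _ _ _ _ (conv_scal (coef122 a b c i j * z ^ (i + j)) _ _
          (binomial_series (be - INR j) z Hz8))).
        intros l. unfold T. rewrite (Cpow_add_r z (i + j) l). ring. }
      refine (conv_ext _ _ _ _ (conv_scal (/ P) _ _ HVi)).
      intros j. cbv beta.
      assert (HS : P = Cpower (1 - z) (be - INR j) * (1 - z) ^ j)
        by (symmetry; now apply Cpower_sub_nat).
      assert (HSne : Cpower (1 - z) (be - INR j) <> 0) by apply Cexp_neq0.
      rewrite HS. unfold F122_term, coef122, A122, h122.
      assert (Ey : (z / (z - 1)) ^ j = (- (1)) ^ j * z ^ j / (1 - z) ^ j).
      { replace (z / (z - 1)) with ((- (1) * z) * / (1 - z)).
        - rewrite !Cpow_mult_l, Cpow_inv by assumption. reflexivity.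
        - field. split; [|assumption]. intros E. apply Hz_ne.
          transitivity (- (z - 1)); [ring|rewrite E; ring]. }
      rewrite Ey, Cpow_add_r.
      pose proof (poch_neq0_nonpos _ (i + j) H1) as N1.
      pose proof (poch_neq0_nonpos _ (i + j) H2) as N2.
      assert (N3 : (1 - z) ^ j <> 0) by now apply Cpow_nz.
      revert N1 N2 N3 HSne.
      generalize (poch c (i + j)) (poch (2 - c) (i + j)) ((1 - z) ^ j)
        (Cpower (1 - z) (be - INR j)).
      intros x1 x2 x3 x4 N1 N2 N3 N4. field.
      repeat split; auto using C_INR_fact_neq0.
    + apply conv_is_series. unfold Cdiv. rewrite Cmult_comm.
      refine (conv_ext _ _ _ _ (conv_scal (/ P) _ _ HVsum)). reflexivity.
  - fold P. field. assumption.
Qed.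


(** * The rectangular sum *)

(** The factors in reverse order, each with its sign changed. *)
Lemma poch_reflect y x k : x = - (y + INR k - 1) -> poch x k = (- (1)) ^ k * poch y k.
Proof.
  revert y x. induction k as [|k IH]; intros y x ->; [simpl; ring|].
  rewrite poch_S_l. cbn [Cpow poch]. rewrite (IH y) by (rewrite C_INR_S; ring).
  rewrite C_INR_S. ring.
Qed.

Lemma half_not_nonpos k : ~ nonpos_int (INR k + 1 / 2).
Proof.
  intros [l E]. assert (E' : RtoC (INR k + 1 / 2)%R = RtoC (- INR l)%R).
  { rewrite RtoC_plus, RtoC_div, RtoC_opp by lra. exact E. }
  apply RtoC_inj in E'. pose proof (pos_INR k). pose proof (pos_INR l). lra.
Qed.

Lemma half_int_not_nonpos (k l : nat) x : x = INR k - INR l + 1 / 2 -> ~ nonpos_int x.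
Proof.
  intros -> [p E]. pose proof (C_half_int_gap (k + p) l) as H.
  assert (E' : INR (k + p) - INR l + 1 / 2 = 0).
  { rewrite C_INR_plus. transitivity (INR k - INR l + 1 / 2 + INR p); [ring|rewrite E; ring]. }
  rewrite E', Cmod_0 in H. lra.
Qed.

Lemma conv_drop f s n : conv f s -> conv (fun i => f (n + i)%nat) (s - Csum f n).
Proof.
  intros H eps He. destruct (H eps He) as [N HN]. exists N. intros k Hk.
  specialize (HN (n + k)%nat ltac:(lia)). rewrite Csum_add in HN.
  replace (Csum (fun i => f (n + i)%nat) k - (s - Csum f n))
    with (Csum f n + Csum (fun i => f (n + i)%nat) k - s) by ring. assumption.
Qed.

Lemma m1_pow_sqr k : (- (1)) ^ k * (- (1)) ^ k = 1.
Proof. rewrite <- Cpow_mult_l. replace (- (1) * - (1)) with (RtoC 1) by ring. apply Cpow_1_l. Qed.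

Lemma m1_pow_neq0 k : (- (1) : C) ^ k <> 0.
Proof.
  intros E. pose proof (m1_pow_sqr k) as Hk. rewrite E, Cmult_0_l in Hk.
  apply RtoC_inj in Hk. lra.
Qed.

Section Rectangle.

Variables (m n : nat) (a : C).

(** This [b] makes $a+b+n=-m$. The primed parameters exceed $a$ and $b$ by $(2m+1)/2$, because
    discarding $2m+1$ indices shifts $(2a)_{i+j}$ and $(2b)_{i+j}$ by $2m+1$; they satisfy
    $a'+b'+n=m+1$. *)
Let b := - a - INR m - INR n.
Let a' := a + INR m + 1 / 2.
Let b' := 1 / 2 - a - INR n.

Lemma rect_p : a + b + INR n = - INR m.
Proof. unfold b. ring. Qed.

Lemma rect_p_half_neq0 t : poch (- INR m + 1 / 2) t <> 0.
Proof. apply poch_neq0_nonpos, (half_int_not_nonpos 0 m). simpl. ring. Qed.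

Lemma rect_gamma : ~ nonpos_int (a + b + 1 / 2).
Proof.
  apply (half_int_not_nonpos 0 (m + n)). unfold b. rewrite C_INR_plus. simpl. ring.
Qed.

Lemma rect_gamma' : ~ nonpos_int (a' + b' + 1 / 2).
Proof.
  apply (half_int_not_nonpos (S m) n). unfold a', b'. rewrite C_INR_S. field.
Qed.

Lemma uhat_neg_low i : (i <= 2 * m)%nat ->
  uhat (- INR m) i = poch (- INR m) i / (poch (- (2 * INR m)) i * INR (fact i)).
Proof.
  intros Hi. rewrite uhat_eq_poch.
  - do 3 f_equal. ring.
  - apply poch_opp_INR_neq0. pose proof (Nat.div2_odd i). destruct (Nat.odd i); simpl in *; lia.
  - apply rect_p_half_neq0.
Qed.

Lemma poch_neg_high i : (m < i)%nat -> poch (- INR m) i = 0.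
Proof.
  intros H. replace i with (S m + (i - S m))%nat by lia.
  rewrite poch_add, poch_opp_INR_0. ring.
Qed.

(** Past index $2m+1$ the recurrence of [uhat] for $-m$ has left factors $(i+2m+2)(i+1)$ and right
    factor $m+1+i$, exactly as for $m+1$ at index $i$. *)
Lemma uhat_neg_high i :
  uhat (- INR m) (S (2 * m) + i) = uhat (- INR m) (S (2 * m)) * uhat (INR m + 1) i.
Proof.
  assert (H1 : ~ nonpos_int (- INR m + 1 / 2)).
  { apply (half_int_not_nonpos 0 m). simpl. ring. }
  assert (H2 : ~ nonpos_int (INR m + 1 + 1 / 2)).
  { rewrite <- C_INR_S. apply half_not_nonpos. }
  induction i as [|i IH].
  - rewrite Nat.add_0_r. replace (uhat (INR m + 1) 0) with (RtoC 1); [ring|].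
    unfold uhat. simpl. field.
  - rewrite Nat.add_succ_r.
    pose proof (uhat_S _ (S (2 * m) + i) H1) as E1. pose proof (uhat_S _ i H2) as E2.
    rewrite IH in E1. clear IH.
    rewrite !C_INR_S, C_INR_plus, C_INR_S, <- two_INR in E1. rewrite C_INR_S in E2.
    assert (N1 : INR i + 1 <> 0) by apply C_INR_S_neq0.
    assert (N2 : 2 * INR m + 1 + INR i + 1 <> 0).
    { rewrite two_INR, <- C_INR_S, <- C_INR_plus. apply C_INR_S_neq0. }
    apply (f_equal (fun x => x / ((INR i + 1) * (2 * INR m + 1 + INR i + 1)))) in E1.
    apply (f_equal (fun x => x / ((INR i + 1) * (2 * INR m + 1 + INR i + 1)))) in E2.
    transitivity ((2 * INR m + 1 + INR i + 1) *
      (2 * - INR m + (2 * INR m + 1 + INR i + 1) - 1) * uhat (- INR m) (S (S (2 * m) + i))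
      / ((INR i + 1) * (2 * INR m + 1 + INR i + 1))); [field; auto|].
    rewrite E1.
    transitivity (uhat (- INR m) (S (2 * m)) *
      ((INR i + 1) * (2 * (INR m + 1) + (INR i + 1) - 1) * uhat (INR m + 1) (S i)
       / ((INR i + 1) * (2 * INR m + 1 + INR i + 1)))); [rewrite E2; field; auto|].
    field. auto.
Qed.

(** The value of [clausen_coef a b n] at $i=2m+1$, $j=0$, the leading coefficient of the tail. *)
Definition rect_kappa : C :=
  poch (2 * a) (S (2 * m)) * poch (2 * b) (S (2 * m)) / poch (a + b + 1 / 2) (S (2 * m))
  * uhat (- INR m) (S (2 * m)).

Lemma clausen_coef_high i j :
  clausen_coef a b n (S (2 * m) + i) j = rect_kappa * clausen_coef a' b' n i j.
Proof.
  unfold clausen_coef. rewrite rect_p.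
  replace (a' + b' + INR n) with (INR m + 1) by (unfold a', b'; field).
  rewrite uhat_neg_high. unfold Kterm, rect_kappa.
  rewrite <- Nat.add_assoc. rewrite !(poch_add _ (S (2 * m)) (i + j)).
  assert (EI : RtoC (INR (S (2 * m))) = 2 * INR m + 1) by (rewrite C_INR_S, <- two_INR; reflexivity).
  rewrite EI.
  replace (2 * a + (2 * INR m + 1)) with (2 * a') by (unfold a'; field).
  replace (2 * b + (2 * INR m + 1)) with (2 * b') by (unfold b, b'; field).
  replace (a + b + 1 / 2 + (2 * INR m + 1)) with (a' + b' + 1 / 2) by (unfold a', b', b; field).
  pose proof (poch_neq0_nonpos _ (S (2 * m)) rect_gamma) as N1.
  pose proof (poch_neq0_nonpos _ (i + j) rect_gamma') as N2.
  revert N1 N2. generalize (poch (a + b + 1 / 2) (S (2 * m))) (poch (a' + b' + 1 / 2) (i + j)).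
  intros x1 x2 N1 N2. field. auto.
Qed.

Lemma clausen_row_high z i :
  clausen_row a b n z (S (2 * m) + i)
  = rect_kappa * z ^ (2 * m + 1) * clausen_row a' b' n z i.
Proof.
  unfold clausen_row. rewrite <- Csum_scal. apply Csum_ext. intros j.
  rewrite clausen_coef_high, Cpow_add_r.
  replace (S (2 * m)) with (2 * m + 1)%nat by lia. ring.
Qed.

Lemma clausen_row_low z :
  Csum (clausen_row a b n z) (S (2 * m))
  = F211_rect m n (2 * a) (- (2 * a) - 2 * INR m - 2 * INR n) (- INR m) (- INR n)
      (1 / 2 - INR m - INR n) (- (2 * INR m)) (- (2 * INR n)) z (1 - z).
Proof.
  unfold F211_rect. rewrite sum_n_Csum. rewrite (Csum_trunc _ (S m) (S (2 * m))).
  - apply Csum_ext_lt. intros i Hi. rewrite sum_n_Csum. unfold clausen_row.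
    apply Csum_ext_lt. intros j Hj. unfold clausen_coef, F211_term. rewrite rect_p.
    rewrite uhat_neg_low by lia. unfold Kterm, vterm.
    pose proof (poch_neq0_nonpos _ (i + j) rect_gamma) as N1.
    replace (2 * b) with (- (2 * a) - 2 * INR m - 2 * INR n) by (unfold b; ring).
    replace (a + b + 1 / 2) with (1 / 2 - INR m - INR n) in N1 |- * by (unfold b; field).
    assert (N2 : poch (- (2 * INR m)) i <> 0) by (apply poch_opp_two_INR_neq0; lia).
    assert (N3 : poch (- (2 * INR n)) j <> 0) by (apply poch_opp_two_INR_neq0; lia).
    revert N1 N2 N3.
    generalize (poch (1 / 2 - INR m - INR n) (i + j)) (poch (- (2 * INR m)) i)
      (poch (- (2 * INR n)) j).
    intros x1 x2 x3 N1 N2 N3. field. repeat split; auto using C_INR_fact_neq0.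
  - lia.
  - intros i Hi. unfold clausen_row. apply Csum_0. intros j _. unfold clausen_coef.
    rewrite rect_p, uhat_neg_low, poch_neg_high by lia. unfold Cdiv. ring.
Qed.

Lemma poch_half_neq0 k : poch (1 / 2) k <> 0.
Proof.
  apply poch_neq0_nonpos. replace (1 / 2) with (INR 0 + 1 / 2) by (simpl; ring).
  apply half_not_nonpos.
Qed.

Lemma rect_coef_F :
  poch (a + 1 / 2) n * poch (b + 1 / 2) n / (poch (1 / 2) n * poch (a + b + 1 / 2) n)
  = poch (a + 1 / 2) n * poch (a + INR m + 1 / 2) n
    / (poch (1 / 2) n * poch (INR m + 1 / 2) n).
Proof.
  rewrite (poch_reflect (a + INR m + 1 / 2) (b + 1 / 2)) by (unfold b; field).
  rewrite (poch_reflect (INR m + 1 / 2) (a + b + 1 / 2)) by (unfold b; field).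
  pose proof (poch_half_neq0 n). pose proof (poch_neq0_nonpos _ n (half_not_nonpos m)).
  pose proof (m1_pow_neq0 n). field. auto.
Qed.

(** Duplication of $(1)_{2m+1}$. *)
Lemma fact_odd_half : RtoC (INR (fact (S (2 * m))))
  = 2 ^ S (2 * m) * poch (1 / 2) (m + 1) * INR (fact m).
Proof.
  rewrite <- !poch_1_fact. replace (poch 1 (S (2 * m))) with (poch (2 * (1 / 2)) (S (2 * m)))
    by (f_equal; field).
  rewrite poch_two_mul, Nat.div2_succ_double.
  replace (S (2 * m) - m)%nat with (m + 1)%nat by lia.
  replace (1 / 2 + 1 / 2) with (RtoC 1) by field. reflexivity.
Qed.

(** The minus sign comes from moving the tail to the left-hand side; it is offset by the odd
    reflection of $(2b)_{2m+1}$. *)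
Lemma rect_coef_G :
  - rect_kappa * (poch (a' + 1 / 2) n * poch (b' + 1 / 2) n)
    / (poch (1 / 2) n * poch (a' + b' + 1 / 2) n)
  = poch (a + 1 / 2) m * poch (a + INR n + 1 / 2) m * poch a (m + n + 1) ^ 2
    / (poch (1 / 2) m * poch (1 / 2) (m + 1) ^ 2 * poch (1 / 2) n * poch (1 / 2) (m + n)).
Proof.
  unfold rect_kappa, uhat. rewrite Nat.div2_succ_double.
  replace (S (2 * m) - m)%nat with (m + 1)%nat by lia.
  replace (- INR m + INR (m + 1)) with (RtoC 1) by (rewrite C_INR_plus; simpl; ring).
  rewrite poch_1_fact, fact_odd_half.
  assert (Ea : poch (2 * a) (S (2 * m)) = 2 ^ S (2 * m) * poch a (m + 1) * poch (a + 1 / 2) m).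
  { rewrite poch_two_mul, Nat.div2_succ_double.
    replace (S (2 * m) - m)%nat with (m + 1)%nat by lia. reflexivity. }
  assert (Eb : poch (2 * b) (S (2 * m))
             = - (2 ^ S (2 * m) * poch (a + INR n) (m + 1) * poch (a + INR n + 1 / 2) m)).
  { rewrite (poch_reflect (2 * (a + INR n)))
      by (unfold b; rewrite C_INR_S, <- two_INR; ring).
    rewrite (poch_two_mul (a + INR n)), Nat.div2_succ_double.
    replace (S (2 * m) - m)%nat with (m + 1)%nat by lia.
    replace ((- (1)) ^ S (2 * m)) with (- (1) : C); [ring|].
    cbn [Cpow]. replace (2 * m)%nat with (m + m)%nat by lia.
    rewrite Cpow_add_r, m1_pow_sqr. ring. }
  (* The two symbols join into $(\frac12-m-n)_{2m+n+1}$, which is cut again at $\frac12$. *)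
  assert (Eg : poch (a + b + 1 / 2) (S (2 * m)) * poch (a' + b' + 1 / 2) n
             = (- (1)) ^ (m + n) * poch (1 / 2) (m + n) * poch (1 / 2) (m + 1)).
  { replace (a' + b' + 1 / 2) with (a + b + 1 / 2 + INR (S (2 * m)))
      by (rewrite C_INR_S, <- two_INR; unfold a', b', b; field).
    rewrite <- poch_add. replace (S (2 * m) + n)%nat with ((m + n) + (m + 1))%nat by lia.
    rewrite poch_add. f_equal.
    - apply poch_reflect. rewrite C_INR_plus. unfold b. field.
    - f_equal. rewrite C_INR_plus. unfold b. field. }
  assert (Eh : poch (- INR m + 1 / 2) m = (- (1)) ^ m * poch (1 / 2) m)
    by (apply poch_reflect; field).
  assert (E1 : poch (a' + 1 / 2) n = poch (a + INR (m + 1)) n).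
  { f_equal. unfold a'. rewrite C_INR_plus. simpl. field. }
  assert (E2 : poch (b' + 1 / 2) n = (- (1)) ^ n * poch a n)
    by (apply poch_reflect; unfold b'; field).
  (* The square of $(a)_{m+n+1}$ arises from two different splittings of this symbol. *)
  assert (E3 : poch a (m + 1) * poch (a + INR (m + 1)) n = poch a (m + n + 1)).
  { rewrite <- poch_add. f_equal. lia. }
  assert (E4 : poch a n * poch (a + INR n) (m + 1) = poch a (m + n + 1)).
  { rewrite <- poch_add. f_equal. lia. }
  pose proof (poch_neq0_nonpos _ (S (2 * m)) rect_gamma) as N1.
  pose proof (poch_neq0_nonpos _ n rect_gamma') as N2.
  pose proof (poch_half_neq0 n) as N3. pose proof (poch_half_neq0 m) as N4.
  pose proof (poch_half_neq0 (m + n)) as N5. pose proof (poch_half_neq0 (m + 1)) as N6.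
  pose proof (C_INR_fact_neq0 m) as N7. pose proof (two_pow_neq0 (S (2 * m))) as N8.
  pose proof (m1_pow_neq0 m) as N9. pose proof (m1_pow_neq0 n) as N10.
  rewrite E1, E2, Ea, Eb, Eh.
  rewrite Cpow_add_r in Eg.
  transitivity (2 ^ S (2 * m) * 2 ^ S (2 * m) * poch (a + 1 / 2) m * poch (a + INR n + 1 / 2) m
     * (poch a (m + 1) * poch (a + INR (m + 1)) n) * (poch a n * poch (a + INR n) (m + 1))
     * (- (1)) ^ n * INR (fact m)
     / (poch (a + b + 1 / 2) (S (2 * m)) * poch (a' + b' + 1 / 2) n
        * (2 ^ S (2 * m) * ((- (1)) ^ m * poch (1 / 2) m)
           * (2 ^ S (2 * m) * poch (1 / 2) (m + 1) * INR (fact m)) * poch (1 / 2) n))).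
  - revert N1 N2 N3 N4 N6 N7 N8 N9. clear.
    generalize (poch (a + b + 1 / 2) (S (2 * m))) (poch (a' + b' + 1 / 2) n)
      (poch (1 / 2) n) (poch (1 / 2) m) (poch (1 / 2) (m + 1)) (RtoC (INR (fact m)))
      ((2 : C) ^ S (2 * m)) ((- (1) : C) ^ m).
    intros. field. repeat split; assumption.
  - rewrite Eg, E3, E4.
    pose proof (m1_pow_sqr m) as Em.
    revert N3 N4 N5 N6 N7 N8 N9 N10 Em. clear.
    generalize (poch (1 / 2) n) (poch (1 / 2) m) (poch (1 / 2) (m + n)) (poch (1 / 2) (m + 1))
      (RtoC (INR (fact m))) ((2 : C) ^ S (2 * m)) ((- (1) : C) ^ m) ((- (1) : C) ^ n).
    intros x1 x2 x3 x4 x5 x6 x7 x8 N3 N4 N5 N6 N7 N8 N9 N10 Em.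
    transitivity (poch (a + 1 / 2) m * poch (a + INR n + 1 / 2) m * poch a (m + n + 1) ^ 2
      / ((x7 * x7) * (x2 * x4 ^ 2 * x1 * x3))).
    + field. repeat split; assumption.
    + rewrite Em. field. repeat split; assumption.
Qed.

Lemma rectangle_identity : exists d, (0 < d)%R /\ forall z, (Cmod z < d)%R -> exists F G : C,
  conv (fun k => hyper a b (1 / 2 - INR m) k * z ^ k) F
  /\ conv (fun k => hyper a' b' (INR m + 3 / 2) k * z ^ k) G
  /\ poch (a + 1 / 2) n * poch (a + INR m + 1 / 2) n
     / (poch (1 / 2) n * poch (INR m + 1 / 2) n) * F ^ 2
     + poch (a + 1 / 2) m * poch (a + INR n + 1 / 2) m * poch a (m + n + 1) ^ 2
       / (poch (1 / 2) m * poch (1 / 2) (m + 1) ^ 2 * poch (1 / 2) n * poch (1 / 2) (m + n))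
       * z ^ (2 * m + 1) * G ^ 2
     = F211_rect m n (2 * a) (- (2 * a) - 2 * INR m - 2 * INR n) (- INR m) (- INR n)
         (1 / 2 - INR m - INR n) (- (2 * INR m)) (- (2 * INR n)) z (1 - z).
Proof.
  destruct (clausen_identity a b n rect_gamma) as [d1 [Hd1 H1]].
  destruct (clausen_identity a' b' n rect_gamma') as [d2 [Hd2 H2]].
  exists (Rmin d1 d2). split; [now apply Rmin_pos|]. intros z Hz.
  destruct (H1 z (Rlt_le_trans _ _ _ Hz (Rmin_l _ _))) as [F [D [HF [HD E1]]]].
  destruct (H2 z (Rlt_le_trans _ _ _ Hz (Rmin_r _ _))) as [G [D' [HG [HD' E2]]]].
  exists F, G. split; [|split].
  - now replace (1 / 2 - INR m) with (a + b + INR n + 1 / 2) by (unfold b; ring).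
  - now replace (INR m + 3 / 2) with (a' + b' + INR n + 1 / 2) by (unfold a', b'; field).
  - rewrite <- rect_coef_F, <- rect_coef_G, <- clausen_row_low.
    (* The tail of the degenerate series, a multiple of the series with primed parameters, is summed
       in two ways. *)
    assert (ED : D - Csum (clausen_row a b n z) (S (2 * m)) = rect_kappa * z ^ (2 * m + 1) * D').
    { apply (conv_unique (fun i => clausen_row a b n z (S (2 * m) + i))).
      - now apply conv_drop.
      - apply (conv_ext (fun i => rect_kappa * z ^ (2 * m + 1) * clausen_row a' b' n z i)).
        + intros i. symmetry. apply clausen_row_high.
        + now apply conv_scal. }
    pose proof (poch_half_neq0 n) as N1.
    pose proof (poch_neq0_nonpos _ n rect_gamma) as N2.
    pose proof (poch_neq0_nonpos _ n rect_gamma') as N3.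
    transitivity ((poch (a + 1 / 2) n * poch (b + 1 / 2) n * F ^ 2)
        / (poch (1 / 2) n * poch (a + b + 1 / 2) n)
      - rect_kappa * z ^ (2 * m + 1) * (poch (a' + 1 / 2) n * poch (b' + 1 / 2) n * G ^ 2)
        / (poch (1 / 2) n * poch (a' + b' + 1 / 2) n)).
    + revert N1 N2 N3. generalize (poch (1 / 2) n) (poch (a + b + 1 / 2) n)
        (poch (a' + b' + 1 / 2) n). intros. field. auto.
    + rewrite E1, E2.
      transitivity (D - rect_kappa * z ^ (2 * m + 1) * D').
      * revert N1 N2 N3. generalize (poch (1 / 2) n) (poch (a + b + 1 / 2) n)
          (poch (a' + b' + 1 / 2) n). intros. field. auto.
      * rewrite <- ED. ring.
Qed.

End Rectangle.

(** * The three identities near the origin *)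

Lemma conv_hyper_is_2F1 a b c z F :
  conv (fun k => hyper a b c k * z ^ k) F -> is_2F1 a b c z F.
Proof. apply conv_is_series. Qed.

Lemma locally_0_Cmod (d : R) (P : C -> Prop) : (0 < d)%R ->
  (forall z, (Cmod z < d)%R -> P z) -> locally (RtoC 0) P.
Proof.
  intros Hd H. apply (locally_Cmod 0 d); trivial. intros y Hy. apply H.
  now replace (y - 0) with y in Hy by ring.
Qed.

Theorem theorem1p2 (m n : nat) :
  (forall a b c : C,
     ~ nonpos_int c -> ~ nonpos_int (2 - c) ->
     locally (RtoC 0) (fun z : C =>
       exists F G D : C,
         is_2F1 a b c z F
         /\ is_2F1 (1 + a - c) (1 + b - c) (2 - c) z G
         /\ is_F122 (1 / 2) (a - b + 1 / 2) (a + b - c + 1 / 2)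
              (b - a + 1 / 2) (c - a - b + 1 / 2) c (2 - c)
              z (z / (z - 1)) D
         /\ F * G = Cpower (1 - z) (c - a - b - 1 / 2) * D))
  /\
  (forall a b : C,
     ~ nonpos_int (a + b + 1 / 2) ->
     locally (RtoC 0) (fun z : C =>
       exists F D : C,
         is_2F1 a b (a + b + INR n + 1 / 2) z F
         /\ is_clausen_F211 a b n z D
         /\ (poch (a + 1 / 2) n * poch (b + 1 / 2) n <> 0 ->
             F ^ 2 = poch (1 / 2) n * poch (a + b + 1 / 2) n
                     / (poch (a + 1 / 2) n * poch (b + 1 / 2) n) * D)
         /\ poch (a + 1 / 2) n * poch (b + 1 / 2) n * F ^ 2
            = poch (1 / 2) n * poch (a + b + 1 / 2) n * D))
  /\
  (forall a : C,
     locally (RtoC 0) (fun z : C =>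
       exists F G : C,
         is_2F1 a (- a - INR m - INR n) (1 / 2 - INR m) z F
         /\ is_2F1 (a + INR m + 1 / 2) (1 / 2 - a - INR n)
              (INR m + 3 / 2) z G
         /\ poch (a + 1 / 2) n * poch (a + INR m + 1 / 2) n
            / (poch (1 / 2) n * poch (INR m + 1 / 2) n) * F ^ 2
            + poch (a + 1 / 2) m * poch (a + INR n + 1 / 2) m
              * poch a (m + n + 1) ^ 2
              / (poch (1 / 2) m * poch (1 / 2) (m + 1) ^ 2
                 * poch (1 / 2) n * poch (1 / 2) (m + n))
              * z ^ (2 * m + 1) * G ^ 2
            = F211_rect m n (2 * a) (- (2 * a) - 2 * INR m - 2 * INR n)
                (- INR m) (- INR n) (1 / 2 - INR m - INR n)
                (- (2 * INR m)) (- (2 * INR n)) z (1 - z))).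
Proof.
  split; [|split].
  - intros a b c H1 H2. destruct (product_identity a b c H1 H2) as [d [Hd H]].
    apply (locally_0_Cmod d); trivial. intros z Hz.
    destruct (H z Hz) as [F [G [D [HF [HG HD]]]]].
    exists F, G, D. split; [|split]; trivial; now apply conv_hyper_is_2F1.
  - intros a b H0. destruct (clausen_identity a b n H0) as [d [Hd H]].
    apply (locally_0_Cmod d); trivial. intros z Hz.
    destruct (H z Hz) as [F [D [HF [HD E]]]].
    exists F, D. split; [now apply conv_hyper_is_2F1|]. split; [|split; trivial].
    + exists (fun i j => clausen_coef a b n i j * (z ^ i * (1 - z) ^ j)). split.
      * intros i j Hj. now apply is_clausen_term_coef.
      * apply conv_is_series. refine (conv_ext _ _ _ _ HD).
        intros i. symmetry. apply sum_n_Csum.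
    + intros Hne.
      transitivity (poch (a + 1 / 2) n * poch (b + 1 / 2) n * F ^ 2
                    / (poch (a + 1 / 2) n * poch (b + 1 / 2) n)).
      * revert Hne. generalize (poch (a + 1 / 2) n * poch (b + 1 / 2) n).
        intros x Hx. field. assumption.
      * rewrite E. unfold Cdiv. ring.
  - intros a. destruct (rectangle_identity m n a) as [d [Hd H]].
    apply (locally_0_Cmod d); trivial. intros z Hz.
    destruct (H z Hz) as [F [G [HF [HG E]]]].
    exists F, G. split; [|split]; trivial; now apply conv_hyper_is_2F1.
Qed.
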